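(* For every real $t$, \[ Z(t)=2\,\Re\bigl\{e^{i\vartheta(t)}U(t)\bigr\}. \]
   Context: Let $\Omega$ be the complex plane with the two cuts $\{iy: y\ge \tfrac12\}$ and $\{iy: y\le -\tfrac12\}$ removed. $\vartheta$ is the Riemann–Siegel theta function: the holomorphic function on $\Omega$ with $\vartheta(0)=0$ and \[ e^{i\vartheta(t)}=\pi^{-it/2}\sqrt{\frac{\Gamma(\frac14+\frac{it}{2})}{\Gamma(\frac14-\frac{it}{2})}}, \] which for real $t$ equals $\pi^{-it/2}\Gamma(\frac14+\frac{it}2)/|\Gamma(\frac14+\frac{it}2)|$. The function $Z(t)=e^{i\vartheta(t)}\zeta(\frac12+it)$ (real for real $t$), where $\zeta$ is the Riemann zeta function. For real $t$ define \[ U(t)=\frac{1}{2\pi i}\int_{-i\sigma-\infty}^{-i\sigma+\infty} e^{i\vartheta(t+x)-i\vartheta(t)}\,\zeta\bigl(\tfrac12+i(t+x)\bigr)\,\frac{\pi}{2\sinh\frac{\pi x}{2}}\,dx, \] with $0<\sigma<\frac12$ (the integration is along the horizontal line $\Im x=-\sigma$; the value is independent of $\sigma\in(0,\frac12)$). *)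

(* Defs.v *)
From Stdlib Require Import Reals.
From Coquelicot Require Import Coquelicot.
Open Scope R_scope.

Definition cexp (z : C) : C := (exp (Re z) * cos (Im z), exp (Re z) * sin (Im z)).

Definition csinh (z : C) : C := ((cexp z - cexp (- z)) / RtoC 2)%C.

(* Sum of a complex series (real and imaginary parts summed separately;
   equals the sum of the series whenever it converges). *)
Definition CSeries (a : nat -> C) : C :=
  (Series (fun n => Re (a n)), Series (fun n => Im (a n))).

Definition Rcpow (b : R) (z : C) : C := cexp (z * RtoC (ln b))%C.

(* Euler's Gamma integral, valid (and used only) for Re z > 0:
   Gamma(z) = \int_0^oo u^(z-1) e^(-u) du. *)
Definition CGamma (z : C) : C :=
  RInt_gen (V := C_R_CompleteNormedModule)
    (fun u : R => (Rcpow u (z - RtoC 1) * RtoC (exp (- u)))%C)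
    (at_right 0) (Rbar_locally p_infty).

(* Dirichlet eta function eta(s) = sum_{n>=1} (-1)^(n-1) n^(-s), convergent for Re s > 0. *)
Definition eta (s : C) : C :=
  CSeries (fun n : nat => (RtoC ((-1) ^ n) * Rcpow (INR (S n)) (- s))%C).

(* Riemann zeta function for Re s > 0, s <> 1 (away from the zeros of 1 - 2^(1-s)),
   via its standard analytic continuation zeta(s) = eta(s) / (1 - 2^(1-s)).
   It is only used here on the strip 0 < Re s < 1. *)
Definition zeta (s : C) : C := (eta s / (RtoC 1 - Rcpow 2 (RtoC 1 - s)))%C.

(* The horizontal strip |Im z| < 1/2 (a connected subset of Omega containing
   every point where theta is evaluated in the statement). *)
Definition strip (z : C) : Prop := Rabs (Im z) < / 2.

Definition is_RS_theta (th : C -> C) : Prop :=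
  (forall z, strip z -> ex_derive (K := C_AbsRing) (V := C_NormedModule) th z) /\
  th (RtoC 0) = RtoC 0 /\
  (forall z, strip z ->
     (cexp (Ci * th z) * cexp (Ci * th z))%C =
     (Rcpow PI (- (Ci * z)) *
        (CGamma (RtoC (/ 4) + Ci * z / RtoC 2) /
         CGamma (RtoC (/ 4) - Ci * z / RtoC 2)))%C).

Definition U (th : C -> C) (sigma t : R) : C :=
  (/ (RtoC (2 * PI) * Ci) *
   RInt_gen (V := C_R_CompleteNormedModule)
     (fun s : R =>
        let x : C := (s, Ropp sigma) in
        (cexp (Ci * th (RtoC t + x) - Ci * th (RtoC t)) *
         zeta (RtoC (/ 2) + Ci * (RtoC t + x)) *
         (RtoC PI / (RtoC 2 * csinh (RtoC PI * x / RtoC 2))))%C)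
     (Rbar_locally m_infty) (Rbar_locally p_infty))%C.

Definition Zfun (th : C -> C) (t : R) : C :=
  (cexp (Ci * th (RtoC t)) * zeta (RtoC (/ 2) + Ci * RtoC t))%C.

(* Main.v *)
Require Import Defs.
From Stdlib Require Import Reals Lra Lia ClassicalEpsilon ChoiceFacts.
From Coquelicot Require Import Coquelicot.
Open Scope R_scope.

(** Write Z(z) = e^(i theta(z)) zeta(1/2 + i z) on the strip |Im z| < 1/2.  The kernel
    pi / (2 sinh(pi x / 2)) has residue 1 at x = 0, so shifting the contour of U from
    Im x = -sigma to Im x = sigma gives Z(t) = A - B, where A = e^(i theta(t)) U(t) and B
    is the same integral along Im x = sigma.  The functional equation says that Z takes
    conjugate values at conjugate points, hence B = - conj A and Z(t) = A + conj A.  It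
    also gives Z(z)^2 = zeta(s) zeta(1 - s) with s = 1/2 + i z, so that Z grows at most
    linearly and the contour shift is legitimate.

    The functional equation is Riemann's.  Jacobi's identity sqrt x J(x) = J(1/x) for
    J(x) = 1 + 2 sum_{n >= 1} e^(-pi n^2 x) comes from the residues of
    e^(-pi x z^2) / (e^(2 pi i z) - 1) at the integers: the reflection z -> -z exchanges
    the lines Im z = 1 and Im z = -1, and on the latter the quotient expands into a
    geometric series of Gaussians.  It makes
    phi(x) = sum_{n >= 1} e^(-pi n^2 x) - 1 / (2 sqrt x) satisfy
    phi(1/x) = sqrt x phi(x), and in the critical strip the Mellin transform of
    phi(x) - 2 phi(4 x) = sum_{n >= 1} (-1)^(n-1) e^(-pi n^2 x) is
    pi^(-s/2) Gamma(s/2) eta(s). *)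

(** * Limits and derivatives of complex functions *)

Notation Climit f F l := (filterlim f F (locally (T := C_UniformSpace) l)).
Notation Ccontinuous := (continuous (U := C_UniformSpace)).
Notation is_Cderive := (is_derive (K := C_AbsRing) (V := AbsRing_NormedModule C_AbsRing)).
Notation ex_Cderive := (ex_derive (K := C_AbsRing) (V := AbsRing_NormedModule C_AbsRing)).

Lemma exp_le (x y : R) : x <= y -> exp x <= exp y.
Proof. intros [x_lt_y | ->]; [left; now apply exp_increasing | apply Rle_refl]. Qed.

Lemma exp_neg_lt_1 (a : R) : 0 < a -> exp (- a) < 1.
Proof. intros a_pos; rewrite <- exp_0; apply exp_increasing; lra. Qed.

Lemma exp_pow (x : R) (n : nat) : exp x ^ n = exp (INR n * x).
Proof.
  induction n as [| n IH]; [now rewrite Rmult_0_l, exp_0 |].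
  rewrite S_INR; simpl; rewrite IH, <- exp_plus; f_equal; ring.
Qed.

Lemma im_le_Cmod (z : C) : Rabs (Im z) <= Cmod z.
Proof. eapply Rle_trans; [apply Rmax_r | apply Rmax_Cmod]. Qed.

Lemma Cmod_le_Rabs (z : C) : Cmod z <= Rabs (Re z) + Rabs (Im z).
Proof.
  destruct z as [x y]; simpl.
  replace ((x, y) : C) with (RtoC x + Ci * RtoC y)%C
    by (apply injective_projections; simpl; ring).
  eapply Rle_trans; [apply Cmod_triangle |].
  rewrite Cmod_mult, Cmod_Ci, !Cmod_R; lra.
Qed.

Lemma Cmod_minus_sym (z w : C) : Cmod (z - w) = Cmod (w - z).
Proof. rewrite <- Cmod_opp; f_equal; ring. Qed.

Lemma Cmod_minus_le (z w : C) : Cmod (z - w) <= Cmod z + Cmod w.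
Proof. rewrite <- (Cmod_opp w); apply Cmod_triangle. Qed.

Lemma Cmod_minus_ge (z w : C) : Cmod z - Cmod w <= Cmod (z - w).
Proof.
  pose proof (Cmod_triangle (z - w) w) as triangle.
  replace (z - w + w)%C with z in triangle by ring; lra.
Qed.

Lemma Cmult_minus_distr_r (z w k : C) : ((z - w) * k)%C = (z * k - w * k)%C.
Proof. ring. Qed.

Lemma Re_div_2 (z : C) : Re (z / 2) = Re z / 2.
Proof. destruct z; simpl; field. Qed.

Lemma Cmult_integral (z w : C) : (z * w)%C = RtoC 0 -> z = RtoC 0 \/ w = RtoC 0.
Proof.
  intros product_0; destruct (classic (z = RtoC 0)) as [z_0 | z_neq_0]; [now left | right].
  apply NNPP; intros w_neq_0; now apply (Cmult_neq_0 z w).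
Qed.

Lemma Csquare_eq_1 (z : C) : (z * z)%C = RtoC 1 -> z = RtoC 1 \/ z = (- RtoC 1)%C.
Proof.
  intros square_1; destruct (Cmult_integral (z - 1) (z + 1)) as [eq | eq].
  - replace ((z - 1) * (z + 1))%C with (z * z - 1)%C by ring; rewrite square_1; ring.
  - left; now apply Ceq_minus.
  - right; apply Ceq_minus; rewrite <- eq; ring.
Qed.

Lemma RtoC_neq_0 (x : R) : x <> 0 -> RtoC x <> RtoC 0.
Proof. intros x_neq_0 eq_0; now apply x_neq_0, RtoC_inj. Qed.

Lemma Cinv_0 : (/ RtoC 0)%C = RtoC 0.
Proof. apply injective_projections; simpl; unfold Rdiv; ring. Qed.

Lemma Cconj_RtoC (x : R) : Cconj (RtoC x) = RtoC x.
Proof. apply injective_projections; simpl; ring. Qed.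

Section ComplexLimits.

Context {T : Type} {F : (T -> Prop) -> Prop} {FF : Filter F}.

Lemma filterlim_C_iff (f : T -> C) (l : C) :
  Climit f F l <-> forall eps, 0 < eps -> F (fun x => Cmod (f x - l) < eps).
Proof.
  split.
  - intros lim eps eps_pos.
    exact (proj1 (filterlim_locally_ball_norm (U := C_NormedModule) f l) lim
             (mkposreal eps eps_pos)).
  - intros lim; apply (filterlim_locally_ball_norm (U := C_NormedModule)).
    intros eps; apply (lim eps), cond_pos.
Qed.

Lemma filterlim_R_iff (f : T -> R) (l : R) :
  filterlim f F (locally l) <-> forall eps, 0 < eps -> F (fun x => Rabs (f x - l) < eps).
Proof.
  split.
  - intros lim eps eps_pos.
    exact (proj1 (filterlim_locally f l) lim (mkposreal eps eps_pos)).
  - intros lim; apply filterlim_locally; intros eps; apply (lim eps), cond_pos.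
Qed.

Lemma filterlim_Cmod_0 (f : T -> C) (l : C) (bound : T -> R) :
  F (fun x => Cmod (f x - l) <= bound x) -> filterlim bound F (locally 0) -> Climit f F l.
Proof.
  intros f_le lim; apply filterlim_C_iff; intros eps eps_pos.
  generalize (filter_and _ _ f_le (proj1 (filterlim_R_iff _ _) lim eps eps_pos)).
  apply filter_imp; intros x [le_bound bound_small].
  rewrite Rminus_0_r in bound_small; pose proof (Rle_abs (bound x)); lra.
Qed.

Lemma filterlim_Cplus (f g : T -> C) (l m : C) :
  Climit f F l -> Climit g F m -> Climit (fun x => f x + g x)%C F (l + m)%C.
Proof.
  intros lim_f lim_g.
  exact (filterlim_comp_2 _ _ _ lim_f lim_g (filterlim_plus (V := C_NormedModule) l m)).
Qed.

Lemma filterlim_Cminus (f g : T -> C) (l m : C) :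
  Climit f F l -> Climit g F m -> Climit (fun x => f x - g x)%C F (l - m)%C.
Proof.
  intros lim_f lim_g; apply filterlim_Cplus; [exact lim_f |].
  exact (filterlim_comp _ _ _ _ _ _ _ _ lim_g (filterlim_opp (V := C_NormedModule) m)).
Qed.

Lemma filterlim_Cmult (f g : T -> C) (l m : C) :
  Climit f F l -> Climit g F m -> Climit (fun x => f x * g x)%C F (l * m)%C.
Proof.
  assert (to_AbsRing : forall h (k : C), Climit h F k ->
    filterlim h F (locally (T := AbsRing_UniformSpace C_AbsRing) k)).
  { intros h k lim P near_k; apply lim, locally_C, near_k. }
  intros lim_f lim_g P near_lm.
  exact (filterlim_comp_2 _ _ _ (to_AbsRing f l lim_f) (to_AbsRing g m lim_g)
           (filterlim_mult (K := C_AbsRing) l m) P (proj1 (locally_C (l * m)%C P) near_lm)).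
Qed.

Lemma filterlim_Cinv (f : T -> C) (l : C) :
  l <> RtoC 0 -> Climit f F l -> Climit (fun x => / f x)%C F (/ l)%C.
Proof.
  intros l_neq_0 lim; assert (l_pos := proj1 (Cmod_gt_0 l) l_neq_0).
  apply filterlim_C_iff; intros eps eps_pos.
  assert (delta_pos : 0 < Rmin (Cmod l / 2) (eps * (Cmod l * (Cmod l / 2)))).
  { apply Rmin_pos; [lra | repeat apply Rmult_lt_0_compat; lra]. }
  generalize (proj1 (filterlim_C_iff _ _) lim _ delta_pos); apply filter_imp; intros x near.
  assert (near_half := Rlt_le_trans _ _ _ near (Rmin_l _ _)).
  assert (near_eps := Rlt_le_trans _ _ _ near (Rmin_r _ _)).
  assert (f_ge : Cmod l / 2 <= Cmod (f x)).
  { pose proof (Cmod_minus_ge l (l - f x)) as ge.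
    replace (l - (l - f x))%C with (f x) in ge by ring.
    rewrite Cmod_minus_sym in near_half; lra. }
  assert (f_neq_0 : f x <> RtoC 0) by (apply Cmod_gt_0; lra).
  replace (/ f x - / l)%C with ((l - f x) / (l * f x))%C by (field; auto).
  rewrite Cmod_div, Cmod_mult, Cmod_minus_sym by now apply Cmult_neq_0.
  apply Rlt_div_l; [nra |].
  eapply Rlt_le_trans; [exact near_eps |].
  apply Rmult_le_compat_l; [lra |]; apply Rmult_le_compat_l; lra.
Qed.

Lemma filterlim_Cconj (f : T -> C) (l : C) :
  Climit f F l -> Climit (fun x => Cconj (f x)) F (Cconj l).
Proof.
  intros lim; apply filterlim_C_iff; intros eps eps_pos.
  generalize (proj1 (filterlim_C_iff _ _) lim eps eps_pos); apply filter_imp; intros x near.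
  now rewrite <- Cminus_conj, Cmod_conj.
Qed.

Lemma filterlim_Cpair (f g : T -> R) (x y : R) :
  filterlim f F (locally x) -> filterlim g F (locally y) ->
  Climit (fun t => (f t, g t)) F (x, y).
Proof.
  intros lim_f lim_g; apply filterlim_locally; intros eps.
  generalize (filter_and _ _ (proj1 (filterlim_locally _ _) lim_f eps)
                             (proj1 (filterlim_locally _ _) lim_g eps)).
  apply filter_imp; auto.
Qed.

Lemma filterlim_RtoC (f : T -> R) (x : R) :
  filterlim f F (locally x) -> Climit (fun t => RtoC (f t)) F (RtoC x).
Proof. intros lim; apply (filterlim_Cpair f (fun _ => 0)); [exact lim | apply filterlim_const]. Qed.

Lemma filterlim_Re (f : T -> C) (l : C) :
  Climit f F l -> filterlim (fun t => Re (f t)) F (locally (Re l)).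
Proof.
  intros lim; destruct l as [x y].
  exact (filterlim_comp _ _ _ _ _ _ _ _ lim (continuous_fst (U := R_UniformSpace) (V := R_UniformSpace) x y)).
Qed.

Lemma filterlim_Im (f : T -> C) (l : C) :
  Climit f F l -> filterlim (fun t => Im (f t)) F (locally (Im l)).
Proof.
  intros lim; destruct l as [x y].
  exact (filterlim_comp _ _ _ _ _ _ _ _ lim (continuous_snd (U := R_UniformSpace) (V := R_UniformSpace) x y)).
Qed.

End ComplexLimits.

Lemma Climit_unique {T : Type} {F : (T -> Prop) -> Prop} {FF : ProperFilter F} (f : T -> C) (l m : C) :
  Climit f F l -> Climit f F m -> l = m.
Proof. apply (filterlim_locally_unique (V := C_NormedModule)). Qed.

Lemma continuous_Cmult (f g : R -> C) (x : R) :
  Ccontinuous f x -> Ccontinuous g x -> Ccontinuous (fun t => f t * g t)%C x.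
Proof. apply filterlim_Cmult. Qed.

Lemma continuous_RtoC (f : R -> R) (x : R) : continuous f x -> Ccontinuous (fun t => RtoC (f t)) x.
Proof. apply filterlim_RtoC. Qed.

Lemma is_Cderive_iff (f : C -> C) (z l : C) :
  is_Cderive f z l <-> forall eps, 0 < eps -> exists delta, 0 < delta /\
    forall w, Cmod (w - z) < delta -> Cmod (f w - f z - l * (w - z)) <= eps * Cmod (w - z).
Proof.
  split.
  - intros [_ domin] eps eps_pos.
    destruct (domin z (fun P near => near) (mkposreal eps eps_pos)) as [delta near].
    exists delta; split; [apply cond_pos |]; intros w close.
    rewrite (Cmult_comm l); exact (near w close).
  - intros estimate; split; [apply (is_linear_scal_l (K := C_AbsRing)) |].
    intros x x_lim eps.
    replace x with z by exact (is_filter_lim_locally_unique (V := AbsRing_NormedModule C_AbsRing) z x x_lim).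
    destruct (estimate eps (cond_pos eps)) as [delta [delta_pos near]].
    exists (mkposreal delta delta_pos); intros w close.
    specialize (near w close); rewrite (Cmult_comm l) in near; exact near.
Qed.

(* [C_NormedModule] carries the product topology of [R * R] and [AbsRing_NormedModule C_AbsRing]
   that of the modulus, so the two derivatives are not convertible. *)
Lemma ex_Cderive_of_C_NormedModule (f : C -> C) (z : C) :
  ex_derive (K := C_AbsRing) (V := C_NormedModule) f z -> ex_Cderive f z.
Proof.
  intros [l [_ domin]]; exists l; apply is_Cderive_iff; intros eps eps_pos.
  destruct (domin z (fun P near => near) (mkposreal eps eps_pos)) as [delta near].
  exists delta; split; [apply cond_pos |]; intros w close.
  rewrite (Cmult_comm l); exact (near w close).
Qed.

Lemma ex_Cderive_continuous (f : C -> C) (z : C) : ex_Cderive f z -> Ccontinuous f z.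
Proof.
  intros diff P near_f; apply locally_C.
  exact (ex_derive_continuous (V := AbsRing_NormedModule C_AbsRing) f z diff P
           (proj1 (locally_C (f z) P) near_f)).
Qed.

Lemma is_Cderive_mult (f g : C -> C) (z l m : C) :
  is_Cderive f z l -> is_Cderive g z m -> is_Cderive (fun w => f w * g w)%C z (l * g z + f z * m)%C.
Proof.
  intros diff_f diff_g.
  exact (is_derive_mult (K := C_AbsRing) f g z l m diff_f diff_g Cmult_comm).
Qed.

Lemma ex_Cderive_plus (f g : C -> C) (z : C) :
  ex_Cderive f z -> ex_Cderive g z -> ex_Cderive (fun w => f w + g w)%C z.
Proof. apply (ex_derive_plus (V := AbsRing_NormedModule C_AbsRing)). Qed.

Lemma ex_Cderive_minus (f g : C -> C) (z : C) :
  ex_Cderive f z -> ex_Cderive g z -> ex_Cderive (fun w => f w - g w)%C z.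
Proof. apply (ex_derive_minus (V := AbsRing_NormedModule C_AbsRing)). Qed.

Lemma ex_Cderive_opp (f : C -> C) (z : C) : ex_Cderive f z -> ex_Cderive (fun w => - f w)%C z.
Proof. apply (ex_derive_opp (V := AbsRing_NormedModule C_AbsRing)). Qed.

Lemma ex_Cderive_mult (f g : C -> C) (z : C) :
  ex_Cderive f z -> ex_Cderive g z -> ex_Cderive (fun w => f w * g w)%C z.
Proof. intros [l diff_f] [m diff_g]; eexists; apply is_Cderive_mult; eassumption. Qed.

Lemma ex_Cderive_comp (f g : C -> C) (z : C) :
  ex_Cderive f (g z) -> ex_Cderive g z -> ex_Cderive (fun w => f (g w)) z.
Proof. apply (ex_derive_comp (V := AbsRing_NormedModule C_AbsRing)). Qed.

Lemma locally_C_iff (z : C) (P : C -> Prop) :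
  locally (T := C_UniformSpace) z P <->
  exists delta, 0 < delta /\ forall w, Cmod (w - z) < delta -> P w.
Proof.
  split.
  - intros near; apply locally_C in near; destruct near as [delta near].
    exists delta; split; [apply cond_pos | exact near].
  - intros [delta [delta_pos near]]; apply locally_C.
    now exists (mkposreal delta delta_pos).
Qed.

Lemma Climit_locally' (f : C -> C) (z : C) :
  Ccontinuous f z -> Climit f (locally' (T := C_UniformSpace) z) (f z).
Proof.
  apply filterlim_filter_le_1; intros P; unfold locally', within; apply filter_imp; auto.
Qed.

Lemma is_Cderive_quotient (f : C -> C) (z l : C) :
  is_Cderive f z l <->
  Climit (fun w => (f w - f z) / (w - z))%C (locally' (T := C_UniformSpace) z) l.
Proof.
  assert (error : forall w, w <> z ->
    Cmod (f w - f z - l * (w - z)) = Cmod ((f w - f z) / (w - z) - l) * Cmod (w - z)).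
  { intros w w_neq_z; rewrite <- Cmod_mult; f_equal; field; now apply Cminus_eq_contra. }
  rewrite is_Cderive_iff; split.
  - intros estimate; apply filterlim_C_iff; intros eps eps_pos; apply locally_C_iff.
    destruct (estimate (eps / 2)) as [delta [delta_pos near]]; [lra |].
    exists delta; split; [exact delta_pos |]; intros w close w_neq_z.
    specialize (near w close); rewrite (error w w_neq_z) in near.
    apply Rmult_le_reg_r in near; [lra | now apply Cmod_gt_0, Cminus_eq_contra].
  - intros lim eps eps_pos.
    destruct (proj1 (locally_C_iff _ _) (proj1 (filterlim_C_iff _ _) lim eps eps_pos))
      as [delta [delta_pos near]].
    exists delta; split; [exact delta_pos |]; intros w close.
    destruct (classic (w = z)) as [-> | w_neq_z].
    + replace (f z - f z - l * (z - z))%C with (RtoC 0) by ring.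
      rewrite Cmod_0; apply Rmult_le_pos; [lra | apply Cmod_ge_0].
    + rewrite (error w w_neq_z); apply Rmult_le_compat_r; [apply Cmod_ge_0 |].
      left; now apply near.
Qed.

Lemma is_Cderive_Cinv (z : C) : z <> RtoC 0 -> is_Cderive Cinv z (- (/ z * / z))%C.
Proof.
  intros z_neq_0; apply is_Cderive_quotient.
  assert (lim : Climit (fun w => (- RtoC 1) * (/ w * / z))%C
                  (locally' (T := C_UniformSpace) z) ((- RtoC 1) * (/ z * / z))%C).
  { apply filterlim_Cmult; [apply filterlim_const |].
    apply filterlim_Cmult; [| apply filterlim_const].
    apply filterlim_Cinv; [exact z_neq_0 |].
    exact (Climit_locally' (fun w => w) z (filterlim_id _ _)). }
  replace (- (/ z * / z))%C with ((- RtoC 1) * (/ z * / z))%C by ring.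
  revert lim; apply filterlim_ext_loc.
  assert (z_pos := proj1 (Cmod_gt_0 z) z_neq_0).
  apply locally_C_iff; exists (Cmod z); split; [exact z_pos |]; intros w close w_neq_z.
  assert (w_neq_0 : w <> RtoC 0).
  { intros ->; replace (0 - z)%C with (- z)%C in close by ring; rewrite Cmod_opp in close; lra. }
  field; repeat split; trivial; now apply Cminus_eq_contra.
Qed.

Lemma ex_Cderive_inv (f : C -> C) (z : C) :
  ex_Cderive f z -> f z <> RtoC 0 -> ex_Cderive (fun w => / f w)%C z.
Proof.
  intros diff_f f_neq_0; apply (ex_Cderive_comp Cinv f); [| exact diff_f].
  eexists; now apply is_Cderive_Cinv.
Qed.

Lemma ex_Cderive_div (f g : C -> C) (z : C) :
  ex_Cderive f z -> ex_Cderive g z -> g z <> RtoC 0 -> ex_Cderive (fun w => f w / g w)%C z.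
Proof. intros; apply ex_Cderive_mult; [| apply ex_Cderive_inv]; assumption. Qed.

(** * Series *)

Lemma minus_plus_r {G : AbelianGroup} (x y : G) : plus (minus x y) y = x.
Proof.
  unfold minus; rewrite <- plus_assoc.
  etransitivity; [apply f_equal, plus_opp_l | apply plus_zero_r].
Qed.

Lemma plus_minus_r {G : AbelianGroup} (x y : G) : minus (plus x y) y = x.
Proof.
  unfold minus; rewrite <- plus_assoc.
  etransitivity; [apply f_equal, plus_opp_r | apply plus_zero_r].
Qed.

Notation Csum_n := (sum_n (G := C_AbelianMonoid)).

Lemma Csum_n_S (a : nat -> C) (n : nat) : Csum_n a (S n) = (Csum_n a n + a (S n))%C.
Proof. apply (sum_Sn (G := C_AbelianMonoid)). Qed.

Lemma Csum_n_ext (a b : nat -> C) (n : nat) : (forall k, a k = b k) -> Csum_n a n = Csum_n b n.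
Proof. apply (sum_n_ext (G := C_AbelianMonoid)). Qed.

Lemma Csum_n_Cmult_l (c : C) (a : nat -> C) (n : nat) :
  Csum_n (fun k => c * a k)%C n = (c * Csum_n a n)%C.
Proof. apply (sum_n_mult_l (K := C_Ring)). Qed.

Lemma Csum_n_pair (a : nat -> C) (n : nat) :
  Csum_n a n = (sum_n (fun k => Re (a k)) n, sum_n (fun k => Im (a k)) n).
Proof.
  induction n as [| n IH]; [rewrite !sum_O; apply surjective_pairing |].
  rewrite Csum_n_S, IH, !sum_Sn; reflexivity.
Qed.

Lemma Csum_n_RtoC (a : nat -> R) (n : nat) : Csum_n (fun k => RtoC (a k)) n = RtoC (sum_n a n).
Proof.
  induction n as [| n IH]; [now rewrite !sum_O |].
  rewrite Csum_n_S, IH, sum_Sn, <- RtoC_plus; reflexivity.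
Qed.

Lemma ex_Cderive_Csum_n (f : nat -> C -> C) (n : nat) (z : C) :
  (forall k, ex_Cderive (f k) z) -> ex_Cderive (fun w => Csum_n (fun k => f k w) n) z.
Proof.
  intros diff; induction n as [| n IH].
  - apply (ex_derive_ext (V := AbsRing_NormedModule C_AbsRing) (f 0%nat)); [| apply diff].
    intros w; now rewrite sum_O.
  - apply (ex_derive_ext (V := AbsRing_NormedModule C_AbsRing)
      (fun w => Csum_n (fun k => f k w) n + f (S n) w)%C).
    + intros w; now rewrite Csum_n_S.
    + apply ex_Cderive_plus; [exact IH | apply diff].
Qed.

Lemma sum_n_pairs {G : AbelianMonoid} (a : nat -> G) (n : nat) :
  sum_n a (S (2 * n)) = sum_n (fun m => plus (a (2 * m)%nat) (a (S (2 * m)))) n.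
Proof.
  induction n as [| n IH]; [rewrite sum_Sn, !sum_O; reflexivity |].
  replace (S (2 * S n)) with (S (S (S (2 * n)))) by lia.
  rewrite (sum_Sn a (S (S (2 * n)))), (sum_Sn a (S (2 * n))), IH, (sum_Sn _ n), <- plus_assoc.
  now replace (2 * S n)%nat with (S (S (2 * n))) by lia.
Qed.

Section Series.

Context {K : AbsRing} {V : NormedModule K}.

Lemma is_series_norm_le (a : nat -> V) (b : nat -> R) (l : V) (m : R) :
  (forall n, norm (a n) <= b n) -> is_series a l -> is_series b m -> norm l <= m.
Proof.
  intros a_le a_sum b_sum.
  apply (is_lim_seq_le (fun n => norm (sum_n a n)) (sum_n b) (norm l) m).
  - intros n; eapply Rle_trans; [apply norm_sum_n_m | now apply sum_n_m_le].
  - exact (filterlim_comp _ _ _ _ _ _ _ _ a_sum (filterlim_norm l)).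
  - exact b_sum.
Qed.

Lemma is_series_telescope (A : nat -> R) :
  is_lim_seq A 0 -> is_series (fun n => A n - A (S n)) (A 0%nat).
Proof.
  intros A_lim; change (is_lim_seq (sum_n (fun n => A n - A (S n))) (A 0%nat)).
  apply (is_lim_seq_ext (fun n => A 0%nat - A (S n))).
  - intros n; induction n as [| n IH]; [now rewrite sum_O |].
    rewrite sum_Sn, <- IH; unfold plus; simpl; ring.
  - rewrite <- (Rminus_0_r (A 0%nat)) at 1.
    apply is_lim_seq_minus'; [apply is_lim_seq_const | now apply is_lim_seq_incr_1 in A_lim].
Qed.

Lemma telescoping_series_le (a : nat -> V) (A : nat -> R) (l : V) :
  (forall n, norm (a n) <= A n - A (S n)) -> is_lim_seq A 0 -> is_series a l -> norm l <= A 0%nat.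
Proof. intros a_le A_lim a_sum; now apply is_series_norm_le with (3 := is_series_telescope A A_lim) (2 := a_sum). Qed.

Lemma telescoping_series_remainder_le (a : nat -> V) (A : nat -> R) (l : V) (n : nat) :
  (forall n, norm (a n) <= A n - A (S n)) -> is_lim_seq A 0 -> is_series a l ->
  norm (minus l (sum_n a n)) <= A (S n).
Proof.
  intros a_le A_lim a_sum; rewrite <- (Nat.add_0_r (S n)).
  apply (telescoping_series_le (fun k => a (S n + k)%nat) (fun k => A (S n + k)%nat)).
  - intros k; rewrite Nat.add_succ_r; apply a_le.
  - apply (is_lim_seq_ext (fun k => A (k + S n)%nat)); [intros k; f_equal; lia | now apply is_lim_seq_incr_n].
  - apply is_series_incr_n; [lia |]; refine (eq_ind_r (is_series a) a_sum _); apply (minus_plus_r (G := V)).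
Qed.

Lemma is_series_pairs (a : nat -> V) (l : V) :
  is_series a l -> is_series (fun m => plus (a (2 * m)%nat) (a (S (2 * m)))) l.
Proof.
  intros a_sum; apply (filterlim_ext (fun n => sum_n a (S (2 * n)))); [intros n; apply sum_n_pairs |].
  apply (filterlim_comp _ _ _ (fun n => S (2 * n)) _ _ eventually); [| exact a_sum].
  apply eventually_subseq; intros n; lia.
Qed.

Lemma is_series_of_pairs (a : nat -> V) (l : V) :
  filterlim a eventually (locally (zero : V)) ->
  is_series (fun m => plus (a (2 * m)%nat) (a (S (2 * m)))) l -> is_series a l.
Proof.
  intros a_lim pairs_sum.
  assert (odd_lim : filterlim (fun n => sum_n a (S (2 * n))) eventually (locally l)).
  { revert pairs_sum; apply filterlim_ext; intros n; symmetry; apply sum_n_pairs. }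
  assert (even_lim : filterlim (fun n => sum_n a (2 * n)) eventually (locally l)).
  { apply (filterlim_ext (fun n => minus (sum_n a (S (2 * n))) (a (S (2 * n))))).
    { intros n; rewrite sum_Sn; apply (plus_minus_r (G := V)). }
    rewrite <- (minus_zero_r l).
    refine (filterlim_comp_2 _ _ _ odd_lim _ (filterlim_plus l (opp (zero : V)))).
    refine (filterlim_comp _ _ _ (fun n => a (S (2 * n))) opp _ _ _ _ (filterlim_opp (zero : V))).
    refine (filterlim_comp _ _ _ (fun n => S (2 * n)) a _ eventually _ _ a_lim).
    apply eventually_subseq; intros n; lia. }
  intros P near; destruct (odd_lim P near) as [N odd]; destruct (even_lim P near) as [M even].
  exists (2 * N + 2 * M + 1)%nat; intros n n_ge.
  destruct (Nat.Even_or_Odd n) as [[m ->] | [m ->]]; [apply even; lia |].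
  rewrite Nat.add_1_r; apply odd; lia.
Qed.

End Series.

Lemma alternating_series_remainder_le (u : nat -> R) (l : R) (n : nat) :
  (forall k, u (S k) <= u k) -> is_lim_seq u 0 -> is_series (fun k => (-1) ^ k * u k) l ->
  Rabs (l - sum_n (fun k => (-1) ^ k * u k) n) <= u (S n).
Proof.
  intros u_decr u_lim u_sum.
  assert (brackets : forall m, sum_n (fun k => (-1) ^ k * u k) (S (2 * m)) <= l <=
                               sum_n (fun k => (-1) ^ k * u k) (2 * m)).
  { intros m; rewrite !sum_n_Reals; apply (alternated_series_ineq u l m u_decr).
    - now apply is_lim_seq_Reals.
    - now apply is_series_Reals. }
  assert (step : forall m, sum_n (fun k => (-1) ^ k * u k) (S m) =
                           sum_n (fun k => (-1) ^ k * u k) m + (-1) ^ S m * u (S m)).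
  { intros m; apply (sum_Sn (G := R_AbelianMonoid)). }
  destruct (Nat.Even_or_Odd n) as [[m ->] | [m ->]].
  - assert (bracket := brackets m); rewrite (step (2 * m)%nat), pow_1_odd in bracket.
    apply Rabs_le; lra.
  - rewrite Nat.add_1_r; assert (lower := brackets m); assert (upper := brackets (S m)).
    replace (2 * S m)%nat with (S (S (2 * m))) in upper by lia.
    rewrite (step (S (2 * m))) in upper.
    replace (S (S (2 * m))) with (2 * S m)%nat in upper by lia; rewrite pow_1_even in upper.
    replace (S (S (2 * m))) with (2 * S m)%nat by lia; apply Rabs_le; lra.
Qed.

Notation is_Cseries := (is_series (V := C_R_NormedModule)).

Lemma CSeries_unique (a : nat -> C) (l : C) : is_Cseries a l -> CSeries a = l.
Proof.
  intros a_sum; apply injective_projections; simpl; apply is_series_unique.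
  - apply (filterlim_ext (fun n => Re (Csum_n a n))); [intros n; now rewrite Csum_n_pair | now apply filterlim_Re].
  - apply (filterlim_ext (fun n => Im (Csum_n a n))); [intros n; now rewrite Csum_n_pair | now apply filterlim_Im].
Qed.

(** * Integrals along intervals and lines *)

Section LinearMaps.

Context {V W : NormedModule R_AbsRing} (L : V -> W) (L_linear : is_linear L).

Lemma Riemann_sum_linear (f : R -> V) (ptd : SF_seq) :
  L (Riemann_sum f ptd) = Riemann_sum (fun x => L (f x)) ptd.
Proof.
  induction ptd as [h0 | h0 ptd IH] using SF_cons_ind; [exact (linear_zero L L_linear) |].
  now rewrite !Riemann_sum_cons, (linear_plus L L_linear), (linear_scal L L_linear), IH.
Qed.

Lemma is_RInt_linear (f : R -> V) (a b : R) (l : V) :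
  is_RInt f a b l -> is_RInt (fun x => L (f x)) a b (L l).
Proof.
  intros int_f.
  apply (filterlim_ext (fun ptd => L (scal (sign (b - a)) (Riemann_sum f ptd)))).
  - intros ptd; now rewrite (linear_scal L L_linear), Riemann_sum_linear.
  - exact (filterlim_comp _ _ _ _ _ _ _ _ int_f (linear_cont L l L_linear)).
Qed.

Lemma is_RInt_gen_linear {Fa Fb : (R -> Prop) -> Prop} {FFa : Filter Fa} {FFb : Filter Fb}
  (f : R -> V) (l : V) :
  is_RInt_gen f Fa Fb l -> is_RInt_gen (fun x => L (f x)) Fa Fb (L l).
Proof.
  intros int_f P near.
  assert (near_int := int_f (fun y => P (L y)) (linear_cont L l L_linear P near)).
  unfold filtermapi in *; revert near_int; apply filter_imp.
  intros [a b] [y [int_y P_y]]; exists (L y); split; [now apply is_RInt_linear | exact P_y].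
Qed.

End LinearMaps.

Section GeneralizedIntegrals.

Context {V : CompleteNormedModule R_AbsRing} {Fa Fb : (R -> Prop) -> Prop}
  {FFa : ProperFilter' Fa} {FFb : ProperFilter' Fb}.

Lemma filterlim_RInt_gen (f : R -> V) (l : V) :
  is_RInt_gen f Fa Fb l ->
  filterlim (fun ab => RInt f (fst ab) (snd ab)) (filter_prod Fa Fb) (locally l).
Proof.
  intros int_f P near; assert (near_int := int_f P near).
  unfold filtermapi, filtermap in *; revert near_int; apply filter_imp.
  intros [a b] [y [int_y P_y]]; simpl in *; now rewrite (is_RInt_unique f a b y int_y).
Qed.

Lemma is_RInt_gen_comp {Ga Gb : (R -> Prop) -> Prop} {FGa : Filter Ga} {FGb : Filter Gb}
  (f : R -> V) (g dg : R -> R) (l : V) :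
  filterlim g Ga Fa -> filterlim g Gb Fb ->
  filter_prod Ga Gb (fun ab => forall x, Rmin (fst ab) (snd ab) <= x <= Rmax (fst ab) (snd ab) ->
    continuous f (g x) /\ is_derive g x (dg x) /\ continuous dg x) ->
  is_RInt_gen f Fa Fb l -> is_RInt_gen (fun y => scal (dg y) (f (g y))) Ga Gb l.
Proof.
  intros lim_a lim_b regular int_f P near.
  destruct (int_f P near) as [Qa Qb near_a near_b int_ab].
  assert (near_ab : filter_prod Ga Gb (fun ab => Qa (g (fst ab)) /\ Qb (g (snd ab)))).
  { apply Filter_prod with (fun a => Qa (g a)) (fun b => Qb (g b));
      [exact (lim_a Qa near_a) | exact (lim_b Qb near_b) | now intros]. }
  unfold filtermapi; generalize (filter_and _ _ regular near_ab); apply filter_imp.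
  intros [a b] [regular_ab [Qa_a Qb_b]]; destruct (int_ab (g a) (g b) Qa_a Qb_b) as [y [int_y P_y]].
  exists y; split; [| exact P_y]; simpl in *.
  rewrite <- (is_RInt_unique f (g a) (g b) y int_y).
  apply is_RInt_comp; intros x x_in; now apply regular_ab.
Qed.

End GeneralizedIntegrals.

Lemma filterlim_exp_decay (c D : R) :
  0 < c -> filterlim (fun x => D * exp (- (c * x))) (Rbar_locally p_infty) (locally 0).
Proof.
  intros c_pos.
  assert (exp_lim : filterlim (fun x => exp (- (c * x))) (Rbar_locally p_infty) (locally 0)).
  { eapply filterlim_comp; [| exact is_lim_exp_m].
    intros P [M below_M]; exists (- M / c); intros x x_gt; apply below_M.
    apply Rlt_div_l in x_gt; lra. }
  rewrite <- (Rmult_0_r D) at 1.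
  exact (filterlim_comp _ _ _ _ _ _ _ _ exp_lim (filterlim_scal_r (V := R_NormedModule) D 0)).
Qed.

Lemma is_lim_seq_exp_decay (c D : R) (T : nat -> R) :
  0 < c -> is_lim_seq T p_infty -> is_lim_seq (fun n => D * exp (- (c * T n))) 0.
Proof. intros c_pos T_lim; exact (filterlim_comp _ _ _ _ _ _ _ _ T_lim (filterlim_exp_decay c D c_pos)). Qed.

Lemma is_lim_seq_INR_plus (a : R) : is_lim_seq (fun n => INR n + a) p_infty.
Proof. apply (is_lim_seq_plus _ _ p_infty a); [apply is_lim_seq_INR | apply is_lim_seq_const | easy]. Qed.

Lemma is_RInt_exp_decay (K c a b : R) : 0 < c ->
  is_RInt (fun x => K * exp (- (c * x))) a b (K / c * exp (- (c * a)) - K / c * exp (- (c * b))).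
Proof.
  intros c_pos.
  replace (K / c * exp (- (c * a)) - K / c * exp (- (c * b)))
    with (minus (- (K / c) * exp (- (c * b))) (- (K / c) * exp (- (c * a))))
    by (unfold minus, plus, opp; simpl; ring).
  apply (is_RInt_derive (V := R_CompleteNormedModule) (fun x => - (K / c) * exp (- (c * x)))).
  - intros x _; auto_derive; auto; field; lra.
  - intros x _; apply (ex_derive_continuous (V := R_NormedModule)); auto_derive; auto.
Qed.

Section LineIntegrals.

Context {V : CompleteNormedModule R_AbsRing}.

Notation is_RInt_line f l := (is_RInt_gen f (Rbar_locally m_infty) (Rbar_locally p_infty) l).

Lemma is_RInt_gen_comp_opp {Fa Fb Ga Gb : (R -> Prop) -> Prop}
  {FFa : ProperFilter' Fa} {FFb : ProperFilter' Fb} {FGa : Filter Ga} {FGb : Filter Gb}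
  (f : R -> V) (l : V) :
  filterlim Ropp Ga Fb -> filterlim Ropp Gb Fa -> (forall x, continuous f x) ->
  is_RInt_gen f Fa Fb l -> is_RInt_gen (fun x => f (- x)) Ga Gb l.
Proof.
  intros lim_a lim_b f_cont int_f.
  rewrite <- (opp_opp l); apply (is_RInt_gen_swap (V := V)).
  apply (is_RInt_gen_ext (fun x => opp (scal (-1) (f (- x))))).
  - apply filter_forall; intros ab x _; transitivity (opp (opp (f (- x)))); [| apply opp_opp].
    f_equal; exact (scal_opp_one (V := V) (f (- x))).
  - apply (is_RInt_gen_opp (V := V)).
    refine (is_RInt_gen_comp f Ropp (fun _ => -1) l lim_b lim_a _ int_f).
    apply filter_forall; intros ab x _; split; [apply f_cont | split; [| apply continuous_const]].
    auto_derive; auto; ring.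
Qed.

Lemma is_RInt_line_translate (f : R -> V) (k : R) (l : V) :
  (forall x, continuous f x) -> is_RInt_line f l -> is_RInt_line (fun x => f (x + k)) l.
Proof.
  intros f_cont int_f.
  apply (is_RInt_gen_ext (fun x => scal 1 (f (x + k)))).
  { apply filter_forall; intros ab x _; apply (scal_one (V := V)). }
  refine (is_RInt_gen_comp f (fun x => x + k) (fun _ => 1) l _ _ _ int_f).
  - intros P [M below_M]; exists (M - k); intros x x_lt; apply below_M; lra.
  - intros P [M above_M]; exists (M - k); intros x x_gt; apply above_M; lra.
  - apply filter_forall; intros ab x _; split; [apply f_cont | split; [| apply continuous_const]].
    auto_derive; auto; ring.
Qed.

Lemma is_RInt_line_scale (f : R -> V) (k : R) (l : V) :
  0 < k -> (forall x, continuous f x) -> is_RInt_line f l ->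
  is_RInt_line (fun x => scal k (f (k * x))) l.
Proof.
  intros k_pos f_cont int_f.
  refine (is_RInt_gen_comp f (fun x => k * x) (fun _ => k) l _ _ _ int_f).
  - intros P [M below_M]; exists (M / k); intros x x_lt; apply below_M.
    rewrite Rmult_comm; now apply Rlt_div_r.
  - intros P [M above_M]; exists (M / k); intros x x_gt; apply above_M.
    rewrite Rmult_comm; now apply Rlt_div_l.
  - apply filter_forall; intros ab x _; split; [apply f_cont | split; [| apply continuous_const]].
    auto_derive; auto; ring.
Qed.

Lemma filterlim_RInt_line (f : R -> V) (l : V) (T : nat -> R) :
  is_RInt_line f l -> is_lim_seq T p_infty ->
  filterlim (fun n => RInt f (- T n) (T n)) eventually (locally l).
Proof.
  intros int_f lim_T.
  refine (filterlim_comp _ _ _ (fun n => (- T n, T n)) _ _ _ _ _ (filterlim_RInt_gen f l int_f)).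
  apply filterlim_pair; [| exact lim_T].
  exact (filterlim_comp _ _ _ _ _ _ _ _ lim_T (filterlim_Rbar_opp p_infty)).
Qed.

Lemma norm_RInt_exp_decay_le (f : R -> V) (K c a b : R) :
  0 < c -> a <= b -> ex_RInt f a b -> (forall x, a <= x <= b -> norm (f x) <= K * exp (- (c * x))) ->
  norm (RInt f a b) <= K / c * exp (- (c * a)).
Proof.
  intros c_pos a_le_b f_int f_le.
  assert (K_nonneg : 0 <= K).
  { pose proof (f_le a ltac:(lra)); pose proof (norm_ge_0 (f a)); pose proof (exp_pos (- (c * a))); nra. }
  eapply Rle_trans.
  - apply (norm_RInt_le f (fun x => K * exp (- (c * x))) a b); trivial;
      [now apply RInt_correct | now apply is_RInt_exp_decay].
  - pose proof (exp_pos (- (c * b))); assert (0 <= K / c) by (apply Rdiv_le_0_compat; lra); nra.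
Qed.

Lemma ex_RInt_gen_exp_decay_right (f : R -> V) (K c : R) :
  0 < c -> (forall x, continuous f x) -> (forall x, 0 <= x -> norm (f x) <= K * exp (- (c * x))) ->
  ex_RInt_gen f (at_point 0) (Rbar_locally p_infty).
Proof.
  intros c_pos f_cont f_le.
  assert (f_int : forall a b, ex_RInt f a b) by (intros; apply (ex_RInt_continuous f); auto).
  destruct (proj1 (filterlim_locally_cauchy (F := Rbar_locally p_infty) (RInt f 0))) as [l lim].
  { intros eps.
    destruct (proj1 (filterlim_R_iff _ _) (filterlim_exp_decay c (K / c) c_pos) eps (cond_pos eps))
      as [M small].
    assert (tail : forall u v, Rmax 0 M < u <= v -> norm (RInt f u v) < eps).
    { intros u v [u_gt u_le_v]; apply Rmax_Rlt in u_gt as [u_pos u_gt_M].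
      apply Rle_lt_trans with (K / c * exp (- (c * u))).
      - apply norm_RInt_exp_decay_le; trivial; intros; apply f_le; lra.
      - specialize (small u u_gt_M); rewrite Rminus_0_r in small.
        pose proof (Rle_abs (K / c * exp (- (c * u)))); lra. }
    exists (fun x => Rmax 0 M < x); split; [now exists (Rmax 0 M) |]; intros u v u_gt v_gt.
    apply (norm_compat1 (V := V)).
    apply Rle_lt_trans with (norm (RInt f u v)).
    { right; f_equal; rewrite <- (RInt_Chasles f 0 u v), plus_comm by trivial; apply (plus_minus_r (G := V)). }
    destruct (Rle_dec u v) as [u_le_v | v_lt_u]; [now apply tail |].
    apply Rle_lt_trans with (norm (RInt f v u)); [right | apply tail; lra].
    rewrite <- (opp_RInt_swap f v u) by trivial; apply (norm_opp (V := V)). }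
  exists l; intros P near; specialize (lim P near).
  destruct lim as [M beyond_M].
  apply Filter_prod with (fun x => x = 0) (fun x => M < x); [reflexivity | now exists M |].
  intros a b -> b_gt; exists (RInt f 0 b); split; [now apply RInt_correct | now apply beyond_M].
Qed.

Lemma ex_RInt_line_exp_decay (f : R -> V) (K c : R) :
  0 < c -> (forall x, continuous f x) -> (forall x, norm (f x) <= K * exp (- (c * Rabs x))) ->
  ex_RInt_gen f (Rbar_locally m_infty) (Rbar_locally p_infty).
Proof.
  intros c_pos f_cont f_le.
  assert (reflected_cont : forall x, continuous (fun x => f (- x)) x).
  { intros x; apply continuous_comp; [| apply f_cont].
    apply (continuous_opp (V := R_NormedModule)), continuous_id. }
  apply (ex_RInt_gen_Chasles f 0).
  - destruct (ex_RInt_gen_exp_decay_right (fun x => f (- x)) K c) as [l int_l]; trivial.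
    { intros x x_pos; rewrite <- (Rabs_pos_eq x) at 2 by trivial; rewrite <- (Rabs_Ropp x); apply f_le. }
    exists l; apply (is_RInt_gen_ext (fun x => f (- - x))).
    { apply filter_forall; intros ab x _; now rewrite Ropp_involutive. }
    apply (is_RInt_gen_comp_opp (Fa := at_point 0) (Fb := Rbar_locally p_infty) (fun x => f (- x)));
      trivial.
    + exact (filterlim_Rbar_opp m_infty).
    + intros P P_0; unfold filtermap, at_point; now rewrite Ropp_0.
  - apply (ex_RInt_gen_exp_decay_right f K c); trivial.
    intros x x_pos; rewrite <- (Rabs_pos_eq x) at 2 by trivial; apply f_le.
Qed.

End LineIntegrals.

Notation is_CInt := (is_RInt (V := C_R_CompleteNormedModule)).
Notation ex_CInt := (ex_RInt (V := C_R_CompleteNormedModule)).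
Notation CInt := (RInt (V := C_R_CompleteNormedModule)).
Notation is_CInt_gen := (is_RInt_gen (V := C_R_CompleteNormedModule)).
Notation is_CInt_line f l := (is_CInt_gen f (Rbar_locally m_infty) (Rbar_locally p_infty) l).

Lemma norm_C_R (z : C) : norm (V := C_R_CompleteNormedModule) z = Cmod z.
Proof.
  change (sqrt (Rabs (fst z) ^ 2 + Rabs (snd z) ^ 2) = Cmod z).
  unfold Cmod; now rewrite !pow2_abs.
Qed.

Lemma is_linear_Cmult (c : C) :
  is_linear (U := C_R_CompleteNormedModule) (V := C_R_CompleteNormedModule) (Cmult c).
Proof.
  split.
  - intros z w; apply Cmult_plus_distr_l.
  - intros k z; rewrite !scal_R_Cmult; change (c * (RtoC k * z) = RtoC k * (c * z))%C; ring.
  - exists (Cmod c + 1); pose proof (Cmod_ge_0 c); split; [lra |]; intros z.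
    rewrite !norm_C_R, Cmod_mult; pose proof (Cmod_ge_0 z); nra.
Qed.

Lemma is_linear_Cconj :
  is_linear (U := C_R_CompleteNormedModule) (V := C_R_CompleteNormedModule) Cconj.
Proof.
  split.
  - exact Cplus_conj.
  - intros k z; now rewrite !scal_R_Cmult, Cmult_conj, Cconj_RtoC.
  - exists 1; split; [lra |]; intros z; rewrite !norm_C_R, Cmod_conj; lra.
Qed.

Lemma is_linear_RtoC :
  is_linear (U := R_CompleteNormedModule) (V := C_R_CompleteNormedModule) RtoC.
Proof. exact (is_linear_prod (fun x => x) (fun _ => 0) is_linear_id is_linear_zero). Qed.

Lemma is_CInt_Cmult (c : C) (f : R -> C) (a b : R) (l : C) :
  is_CInt f a b l -> is_CInt (fun x => c * f x)%C a b (c * l)%C.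
Proof. exact (is_RInt_linear (Cmult c) (is_linear_Cmult c) f a b l). Qed.

Lemma is_CInt_RtoC (f : R -> R) (a b l : R) :
  is_RInt f a b l -> is_CInt (fun x => RtoC (f x)) a b (RtoC l).
Proof. exact (is_RInt_linear RtoC is_linear_RtoC f a b l). Qed.

Lemma is_CInt_minus (f g : R -> C) (a b : R) (l m : C) :
  is_CInt f a b l -> is_CInt g a b m -> is_CInt (fun x => f x - g x)%C a b (l - m)%C.
Proof. apply (is_RInt_minus (V := C_R_CompleteNormedModule)). Qed.

Lemma is_CInt_const (c : C) (a b : R) : is_CInt (fun _ => c) a b (RtoC (b - a) * c)%C.
Proof. rewrite <- scal_R_Cmult; apply (is_RInt_const (V := C_R_CompleteNormedModule)). Qed.

Lemma CInt_correct (f : R -> C) (a b : R) : ex_CInt f a b -> is_CInt f a b (CInt f a b).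
Proof. apply (RInt_correct (V := C_R_CompleteNormedModule)). Qed.

Lemma CInt_unique (f : R -> C) (a b : R) (l : C) : is_CInt f a b l -> CInt f a b = l.
Proof. apply (is_RInt_unique (V := C_R_CompleteNormedModule)). Qed.

Lemma CInt_Cmult (c : C) (f : R -> C) (a b : R) :
  ex_CInt f a b -> CInt (fun x => c * f x)%C a b = (c * CInt f a b)%C.
Proof. intros f_int; now apply CInt_unique, is_CInt_Cmult, CInt_correct. Qed.

Lemma CInt_minus (f g : R -> C) (a b : R) : ex_CInt f a b -> ex_CInt g a b ->
  CInt (fun x => f x - g x)%C a b = (CInt f a b - CInt g a b)%C.
Proof. intros; apply CInt_unique, is_CInt_minus; now apply CInt_correct. Qed.

Lemma CInt_Chasles (f : R -> C) (a b c : R) : ex_CInt f a b -> ex_CInt f b c ->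
  (CInt f a b + CInt f b c)%C = CInt f a c.
Proof. apply (RInt_Chasles (V := C_R_CompleteNormedModule)). Qed.

Lemma ex_CInt_continuous (f : R -> C) (a b : R) :
  (forall x, Rmin a b <= x <= Rmax a b -> Ccontinuous f x) -> ex_CInt f a b.
Proof. apply (ex_RInt_continuous (V := C_R_CompleteNormedModule)). Qed.

Lemma is_CInt_Cmod_le (f : R -> C) (g : R -> R) (a b : R) (l : C) (m : R) : a <= b ->
  (forall x, a <= x <= b -> Cmod (f x) <= g x) -> is_CInt f a b l -> is_RInt g a b m -> Cmod l <= m.
Proof.
  intros a_le_b f_le f_int g_int; rewrite <- norm_C_R.
  apply (norm_RInt_le (V := C_R_CompleteNormedModule) f g a b); trivial.
  intros x x_in; rewrite norm_C_R; auto.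
Qed.

Lemma is_CInt_Cmod_le_const (f : R -> C) (M a b : R) (l : C) : a <= b ->
  (forall x, a <= x <= b -> Cmod (f x) <= M) -> is_CInt f a b l -> Cmod l <= (b - a) * M.
Proof.
  intros a_le_b f_le f_int.
  apply (is_CInt_Cmod_le f (fun _ => M) a b); trivial.
  apply (is_RInt_const (V := R_NormedModule)).
Qed.

Lemma is_CInt_Cmod_le_exp_decay (f : R -> C) (K c a b : R) (l : C) : 0 < c -> a <= b ->
  (forall x, a <= x <= b -> Cmod (f x) <= K * exp (- (c * x))) -> is_CInt f a b l ->
  Cmod l <= K / c * exp (- (c * a)) - K / c * exp (- (c * b)).
Proof.
  intros c_pos a_le_b f_le f_int.
  apply (is_CInt_Cmod_le f (fun x => K * exp (- (c * x))) a b); trivial; now apply is_RInt_exp_decay.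
Qed.

Lemma is_CInt_line_Cmult (c : C) (f : R -> C) (l : C) :
  is_CInt_line f l -> is_CInt_line (fun x => c * f x)%C (c * l)%C.
Proof. exact (is_RInt_gen_linear (Cmult c) (is_linear_Cmult c) f l). Qed.

Lemma is_CInt_line_Cconj (f : R -> C) (l : C) :
  is_CInt_line f l -> is_CInt_line (fun x => Cconj (f x)) (Cconj l).
Proof. exact (is_RInt_gen_linear Cconj is_linear_Cconj f l). Qed.

Lemma is_RInt_line_Re (f : R -> C) (l : C) : is_CInt_line f l ->
  is_RInt_gen (fun x => Re (f x)) (Rbar_locally m_infty) (Rbar_locally p_infty) (Re l).
Proof. exact (is_RInt_gen_linear (V := C_R_CompleteNormedModule) (W := R_NormedModule) Re is_linear_fst f l). Qed.

Lemma is_CInt_line_ext (f g : R -> C) (l : C) :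
  (forall x, f x = g x) -> is_CInt_line f l -> is_CInt_line g l.
Proof.
  intros f_eq; apply (is_RInt_gen_ext (V := C_R_CompleteNormedModule)).
  apply filter_forall; auto.
Qed.

Lemma is_CInt_line_plus (f g : R -> C) (l m : C) :
  is_CInt_line f l -> is_CInt_line g m -> is_CInt_line (fun x => f x + g x)%C (l + m)%C.
Proof. exact (is_RInt_gen_plus (V := C_R_CompleteNormedModule) f g l m). Qed.

Lemma is_CInt_line_minus (f g : R -> C) (l m : C) :
  is_CInt_line f l -> is_CInt_line g m -> is_CInt_line (fun x => f x - g x)%C (l - m)%C.
Proof. exact (is_RInt_gen_minus (V := C_R_CompleteNormedModule) f g l m). Qed.

Lemma is_CInt_line_unique (f : R -> C) (l m : C) : is_CInt_line f l -> is_CInt_line f m -> l = m.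
Proof.
  intros int_l int_m.
  rewrite <- (is_RInt_gen_unique (V := C_R_CompleteNormedModule) f l int_l).
  now rewrite <- (is_RInt_gen_unique (V := C_R_CompleteNormedModule) f m int_m).
Qed.

Lemma is_CInt_line_opp (f : R -> C) (l : C) :
  (forall x, Ccontinuous f x) -> is_CInt_line f l -> is_CInt_line (fun x => f (- x)) l.
Proof.
  apply (is_RInt_gen_comp_opp (V := C_R_CompleteNormedModule)).
  - exact (filterlim_Rbar_opp m_infty).
  - exact (filterlim_Rbar_opp p_infty).
Qed.

Lemma is_CInt_line_translate (f : R -> C) (k : R) (l : C) :
  (forall x, Ccontinuous f x) -> is_CInt_line f l -> is_CInt_line (fun x => f (x + k)) l.
Proof. exact (is_RInt_line_translate (V := C_R_CompleteNormedModule) f k l). Qed.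

Lemma is_CInt_line_Cmod_le (f : R -> C) (g : R -> R) (l : C) (m : R) :
  (forall x, Cmod (f x) <= g x) -> is_CInt_line f l ->
  is_RInt_gen g (Rbar_locally m_infty) (Rbar_locally p_infty) m -> Cmod l <= m.
Proof.
  intros f_le f_int g_int; rewrite <- norm_C_R.
  apply (RInt_gen_norm (V := C_R_CompleteNormedModule) (Fa := Rbar_locally m_infty)
           (Fb := Rbar_locally p_infty) f g); trivial.
  - apply Filter_prod with (fun a => a < 0) (fun b => 0 < b); [now exists 0 | now exists 0 |].
    intros a b a_neg b_pos; simpl; lra.
  - apply filter_forall; intros ab x _; rewrite norm_C_R; apply f_le.
Qed.

Lemma ex_CInt_line_exp_decay (f : R -> C) (K c : R) :
  0 < c -> (forall x, Ccontinuous f x) -> (forall x, Cmod (f x) <= K * exp (- (c * Rabs x))) ->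
  exists l, is_CInt_line f l.
Proof.
  intros c_pos f_cont f_le.
  apply (ex_RInt_line_exp_decay (V := C_R_CompleteNormedModule) f K c c_pos f_cont).
  intros x; rewrite norm_C_R; apply f_le.
Qed.

Lemma is_CInt_line_sum_n (f : nat -> R -> C) (l : nat -> C) (n : nat) :
  (forall k, is_CInt_line (f k) (l k)) -> is_CInt_line (fun x => Csum_n (fun k => f k x) n) (Csum_n l n).
Proof.
  intros f_int; induction n as [| n IH].
  - rewrite sum_O; apply (is_CInt_line_ext (f 0%nat)); [intros x; now rewrite sum_O | apply f_int].
  - rewrite Csum_n_S; apply (is_CInt_line_ext (fun x => Csum_n (fun k => f k x) n + f (S n) x)%C);
      [intros x; now rewrite Csum_n_S | now apply is_CInt_line_plus].
Qed.

(** * The complex exponential *)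

Lemma cexp_plus (z w : C) : cexp (z + w) = (cexp z * cexp w)%C.
Proof.
  destruct z as [a b], w as [c d]; unfold cexp; simpl.
  rewrite exp_plus, cos_plus, sin_plus; apply injective_projections; simpl; ring.
Qed.

Lemma cexp_RtoC (x : R) : cexp (RtoC x) = RtoC (exp x).
Proof.
  unfold cexp; simpl; rewrite cos_0, sin_0; apply injective_projections; simpl; ring.
Qed.

Lemma cexp_0 : cexp (RtoC 0) = RtoC 1.
Proof. now rewrite cexp_RtoC, exp_0. Qed.

Lemma Cmod_cexp (z : C) : Cmod (cexp z) = exp (Re z).
Proof.
  replace (cexp z) with (RtoC (exp (Re z)) * (cos (Im z), sin (Im z)))%C
    by (unfold cexp; apply injective_projections; simpl; ring).
  rewrite Cmod_mult, Cmod_R, Rabs_pos_eq by (left; apply exp_pos).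
  unfold Cmod; simpl.
  replace (cos (Im z) * (cos (Im z) * 1) + sin (Im z) * (sin (Im z) * 1)) with 1.
  - rewrite sqrt_1; ring.
  - pose proof (sin2_cos2 (Im z)) as pythagoras; unfold Rsqr in pythagoras; lra.
Qed.

Lemma cexp_neq_0 (z : C) : cexp z <> RtoC 0.
Proof. apply Cmod_gt_0; rewrite Cmod_cexp; apply exp_pos. Qed.

Lemma cexp_opp (z : C) : cexp (- z) = (/ cexp z)%C.
Proof.
  assert (inverse : (cexp z * cexp (- z) = 1)%C).
  { rewrite <- cexp_plus; replace (z + - z)%C with (RtoC 0) by ring; apply cexp_0. }
  replace (cexp (- z)) with (/ cexp z * (cexp z * cexp (- z)))%C by (field; apply cexp_neq_0).
  rewrite inverse; ring.
Qed.

Lemma cexp_minus (z w : C) : cexp (z - w) = (cexp z / cexp w)%C.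
Proof. unfold Cminus; now rewrite cexp_plus, cexp_opp. Qed.

Lemma cexp_INR_mult (n : nat) (z : C) : cexp (RtoC (INR n) * z) = (cexp z ^ n)%C.
Proof.
  induction n as [| n IH]; [simpl; rewrite Cmult_0_l; apply cexp_0 |].
  rewrite S_INR, RtoC_plus; replace ((RtoC (INR n) + 1) * z)%C with (z + RtoC (INR n) * z)%C by ring.
  now rewrite cexp_plus, IH.
Qed.

Lemma cexp_conj (z : C) : cexp (Cconj z) = Cconj (cexp z).
Proof.
  unfold cexp; rewrite re_conj, im_conj, cos_neg, sin_neg.
  apply injective_projections; simpl; ring.
Qed.

Lemma Cmod_cexp_mult_RtoC (z : C) (v : R) : Cmod (cexp (z * RtoC v)) = exp (Re z * v).
Proof. now rewrite Cmod_cexp, re_scal_r. Qed.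

Lemma cexp_mult_RtoC (z : C) (v : R) :
  cexp (z * RtoC v) = (exp (Re z * v) * cos (Im z * v), exp (Re z * v) * sin (Im z * v)).
Proof.
  unfold cexp; destruct z as [x y]; simpl.
  replace (x * v - y * 0) with (x * v) by ring; now replace (x * 0 + y * v) with (y * v) by ring.
Qed.

Lemma sin_eq_0_small (x : R) : Rabs x < PI -> sin x = 0 -> x = 0.
Proof.
  intros x_small sin_0; apply Rabs_lt_between in x_small.
  destruct (Rtotal_order x 0) as [x_neg | [x_0 | x_pos]]; trivial; exfalso.
  - pose proof (sin_gt_0 (- x) ltac:(lra) ltac:(lra)) as sin_pos; rewrite sin_neg in sin_pos; lra.
  - pose proof (sin_gt_0 x ltac:(lra) ltac:(lra)); lra.
Qed.

Lemma cexp_eq_1_small (z : C) : Rabs (Im z) <= PI -> cexp z = RtoC 1 -> z = RtoC 0.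
Proof.
  intros Im_small cexp_1; pose proof PI_RGT_0.
  assert (Re_0 : Re z = 0).
  { apply exp_inv; rewrite exp_0, <- Cmod_cexp, cexp_1; apply Cmod_1. }
  assert (cos_1 : cos (Im z) = 1).
  { apply (f_equal Re) in cexp_1; unfold cexp in cexp_1; simpl in cexp_1.
    rewrite Re_0, exp_0, Rmult_1_l in cexp_1; exact cexp_1. }
  assert (half_0 : Im z / 2 = 0).
  { apply sin_eq_0_small.
    - unfold Rdiv; rewrite Rabs_mult, (Rabs_pos_eq (/ 2)); lra.
    - replace (Im z) with (2 * (Im z / 2)) in cos_1 by field; rewrite cos_2a_sin in cos_1; nra. }
  apply injective_projections; [exact Re_0 | change (Im z = 0); lra].
Qed.

Lemma is_CInt_cexp (z : C) (a b : R) :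
  is_CInt (fun v => z * cexp (z * RtoC v))%C a b (cexp (z * RtoC b) - cexp (z * RtoC a))%C.
Proof.
  rewrite !cexp_mult_RtoC.
  apply (is_RInt_ext (V := C_R_CompleteNormedModule)
    (fun v => (Re z * (exp (Re z * v) * cos (Im z * v)) - Im z * (exp (Re z * v) * sin (Im z * v)),
               Re z * (exp (Re z * v) * sin (Im z * v)) + Im z * (exp (Re z * v) * cos (Im z * v))))).
  { intros v _; now rewrite cexp_mult_RtoC. }
  apply (is_RInt_fct_extend_pair (U := R_NormedModule) (V := R_NormedModule)); simpl.
  - apply (is_RInt_derive (V := R_CompleteNormedModule) (fun v => exp (Re z * v) * cos (Im z * v)));
      intros v _; [auto_derive; auto; ring |].
    apply (ex_derive_continuous (V := R_NormedModule)); auto_derive; auto.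
  - apply (is_RInt_derive (V := R_CompleteNormedModule) (fun v => exp (Re z * v) * sin (Im z * v)));
      intros v _; [auto_derive; auto; ring |].
    apply (ex_derive_continuous (V := R_NormedModule)); auto_derive; auto.
Qed.

Lemma Cmod_cexp_minus_1_le (z : C) : Cmod (cexp z - 1) <= Cmod z * exp (Cmod z).
Proof.
  assert (int := is_CInt_cexp z 0 1).
  rewrite Cmult_0_r, cexp_0, Cmult_1_r in int.
  replace (Cmod z * exp (Cmod z)) with ((1 - 0) * (Cmod z * exp (Cmod z))) by ring.
  revert int; apply is_CInt_Cmod_le_const; [lra |]; intros v v_in.
  rewrite Cmod_mult, Cmod_cexp; apply Rmult_le_compat_l; [apply Cmod_ge_0 |].
  apply exp_le; rewrite re_scal_r.
  pose proof (re_le_Cmod z); pose proof (Rle_abs (Re z)); pose proof (Cmod_ge_0 z); nra.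
Qed.

Lemma Cmod_cexp_minus_linear_le (z : C) : Cmod (cexp z - 1 - z) <= Cmod z * Cmod z * exp (Cmod z).
Proof.
  assert (int := is_CInt_minus _ _ _ _ _ _ (is_CInt_cexp z 0 1) (is_CInt_const z 0 1)).
  rewrite Cmult_0_r, cexp_0, Cmult_1_r, Rminus_0_r, Cmult_1_l in int.
  replace (Cmod z * Cmod z * exp (Cmod z)) with ((1 - 0) * (Cmod z * (Cmod z * exp (Cmod z)))) by ring.
  revert int; apply is_CInt_Cmod_le_const; [lra |]; intros v v_in.
  replace (z * cexp (z * RtoC v) - z)%C with (z * (cexp (z * RtoC v) - 1))%C by ring.
  rewrite Cmod_mult; apply Rmult_le_compat_l; [apply Cmod_ge_0 |].
  eapply Rle_trans; [apply Cmod_cexp_minus_1_le |].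
  pose proof (Cmod_ge_0 z).
  assert (Cmod (z * RtoC v) <= Cmod z) by (rewrite Cmod_mult, Cmod_R, Rabs_pos_eq; nra).
  apply Rmult_le_compat; [apply Cmod_ge_0 | left; apply exp_pos | trivial | now apply exp_le].
Qed.

Lemma is_Cderive_cexp (z : C) : is_Cderive cexp z (cexp z).
Proof.
  apply is_Cderive_iff; intros eps eps_pos.
  assert (cexp_pos : 0 < Cmod (cexp z)) by apply Cmod_gt_0, cexp_neq_0.
  set (delta := Rmin 1 (eps / (3 * Cmod (cexp z)))); exists delta.
  assert (delta_le_1 : delta <= 1) by apply Rmin_l.
  assert (delta_le : delta <= eps / (3 * Cmod (cexp z))) by apply Rmin_r.
  split; [apply Rmin_pos; [lra | apply Rdiv_lt_0_compat; lra] |]; intros w close.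
  replace (cexp w - cexp z - cexp z * (w - z))%C with (cexp z * (cexp (w - z) - 1 - (w - z)))%C
    by (rewrite cexp_minus; field; apply cexp_neq_0).
  rewrite Cmod_mult; pose proof (Cmod_ge_0 (w - z)).
  eapply Rle_trans; [apply Rmult_le_compat_l, Cmod_cexp_minus_linear_le; lra |].
  apply Rle_div_r in delta_le; [| lra].
  assert (exp_le_3' : exp (Cmod (w - z)) <= 3).
  { eapply Rle_trans; [apply (exp_le _ 1); lra | apply exp_le_3]. }
  assert (Cmod (w - z) * exp (Cmod (w - z)) <= delta * 3).
  { apply Rmult_le_compat; trivial; [left; apply exp_pos | lra]. }
  replace (Cmod (cexp z) * (Cmod (w - z) * Cmod (w - z) * exp (Cmod (w - z))))
    with (Cmod (cexp z) * (Cmod (w - z) * exp (Cmod (w - z))) * Cmod (w - z)) by ring.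
  apply Rmult_le_compat_r; nra.
Qed.

Lemma ex_Cderive_cexp (f : C -> C) (z : C) : ex_Cderive f z -> ex_Cderive (fun w => cexp (f w)) z.
Proof. apply (ex_Cderive_comp cexp f); eexists; apply is_Cderive_cexp. Qed.

Lemma is_Cderive_cexp_linear (k z : C) :
  is_Cderive (fun w => cexp (k * w)) z (k * cexp (k * z))%C.
Proof.
  assert (linear : is_Cderive (fun w => k * w)%C z (0 * z + k * 1)%C).
  { apply (is_Cderive_mult (fun _ => k) (fun w => w));
      [apply (is_derive_const (V := AbsRing_NormedModule C_AbsRing)) | apply (is_derive_id (K := C_AbsRing))]. }
  replace (0 * z + k * 1)%C with k in linear by ring.
  exact (is_derive_comp (V := AbsRing_NormedModule C_AbsRing) cexp _ z _ k (is_Cderive_cexp _) linear).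
Qed.

Lemma Cmod_Rcpow (b : R) (z : C) : Cmod (Rcpow b z) = exp (Re z * ln b).
Proof. unfold Rcpow; rewrite Cmod_cexp; f_equal; destruct z; simpl; ring. Qed.

Lemma ex_Cderive_Rcpow (b : R) (f : C -> C) (z : C) : ex_Cderive f z -> ex_Cderive (fun w => Rcpow b (f w)) z.
Proof.
  intros diff_f; apply ex_Cderive_cexp, ex_Cderive_mult; [exact diff_f | apply ex_derive_const].
Qed.

Lemma Rcpow_conj (b : R) (z : C) : Rcpow b (Cconj z) = Cconj (Rcpow b z).
Proof. unfold Rcpow; now rewrite <- cexp_conj, Cmult_conj, Cconj_RtoC. Qed.

(** * Cauchy's theorem on rectangles *)

Definition in_rect (a b c d : R) (z : C) : Prop := a <= Re z <= b /\ c <= Im z <= d.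

Definition rect_boundary (a b c d : R) (z : C) : Prop :=
  in_rect a b c d z /\ (Re z = a \/ Re z = b \/ Im z = c \/ Im z = d).

Definition rect_int (f : C -> C) (a b c d : R) : C :=
  (CInt (fun s => f (s, c)) a b - CInt (fun s => f (s, d)) a b
   + Ci * (CInt (fun y => f (b, y)) c d - CInt (fun y => f (a, y)) c d))%C.

Definition ex_rect_int (f : C -> C) (a b c d : R) : Prop :=
  ex_CInt (fun s => f (s, c)) a b /\ ex_CInt (fun s => f (s, d)) a b /\
  ex_CInt (fun y => f (b, y)) c d /\ ex_CInt (fun y => f (a, y)) c d.

Lemma rect_boundary_horizontal (a b c d s y : R) : c <= d -> a <= s <= b -> y = c \/ y = d ->
  rect_boundary a b c d (s, y).
Proof. intros c_le_d s_in y_side; repeat split; simpl; lra. Qed.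

Lemma rect_boundary_vertical (a b c d s y : R) : a <= b -> c <= y <= d -> s = a \/ s = b ->
  rect_boundary a b c d (s, y).
Proof. intros a_le_b y_in s_side; repeat split; simpl; lra. Qed.

Lemma continuous_horizontal (f : C -> C) (s y : R) :
  Ccontinuous f (s, y) -> Ccontinuous (fun s : R => f (s, y)) s.
Proof.
  intros f_cont; refine (filterlim_comp _ _ _ (fun s : R => (s, y)) _ _ _ _ _ f_cont).
  apply filterlim_Cpair; [apply filterlim_id | apply filterlim_const].
Qed.

Lemma continuous_vertical (f : C -> C) (s y : R) :
  Ccontinuous f (s, y) -> Ccontinuous (fun y : R => f (s, y)) y.
Proof.
  intros f_cont; refine (filterlim_comp _ _ _ (fun y : R => (s, y)) _ _ _ _ _ f_cont).
  apply filterlim_Cpair; [apply filterlim_const | apply filterlim_id].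
Qed.

Lemma ex_CInt_horizontal (f : C -> C) (a b y : R) : a <= b ->
  (forall s, a <= s <= b -> Ccontinuous f (s, y)) -> ex_CInt (fun s => f (s, y)) a b.
Proof.
  intros a_le_b f_cont; apply ex_CInt_continuous; rewrite Rmin_left, Rmax_right by trivial.
  intros s s_in; now apply continuous_horizontal, f_cont.
Qed.

Lemma ex_CInt_vertical (f : C -> C) (c d s : R) : c <= d ->
  (forall y, c <= y <= d -> Ccontinuous f (s, y)) -> ex_CInt (fun y => f (s, y)) c d.
Proof.
  intros c_le_d f_cont; apply ex_CInt_continuous; rewrite Rmin_left, Rmax_right by trivial.
  intros y y_in; now apply continuous_vertical, f_cont.
Qed.

Lemma ex_rect_int_continuous (f : C -> C) (a b c d : R) : a <= b -> c <= d ->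
  (forall z, rect_boundary a b c d z -> Ccontinuous f z) -> ex_rect_int f a b c d.
Proof.
  intros a_le_b c_le_d f_cont; unfold ex_rect_int.
  split; [| split; [| split]].
  - apply ex_CInt_horizontal; auto using rect_boundary_horizontal.
  - apply ex_CInt_horizontal; auto using rect_boundary_horizontal.
  - apply ex_CInt_vertical; auto using rect_boundary_vertical.
  - apply ex_CInt_vertical; auto using rect_boundary_vertical.
Qed.

Lemma rect_int_ext (f g : C -> C) (a b c d : R) :
  (forall z, f z = g z) -> rect_int f a b c d = rect_int g a b c d.
Proof.
  intros f_eq; unfold rect_int.
  rewrite (RInt_ext (V := C_R_CompleteNormedModule) (fun s => f (s, c)) (fun s => g (s, c))),
    (RInt_ext (V := C_R_CompleteNormedModule) (fun s => f (s, d)) (fun s => g (s, d))),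
    (RInt_ext (V := C_R_CompleteNormedModule) (fun y => f (a, y)) (fun y => g (a, y))),
    (RInt_ext (V := C_R_CompleteNormedModule) (fun y => f (b, y)) (fun y => g (b, y))); auto.
Qed.

Lemma ex_rect_int_minus (f g : C -> C) (a b c d : R) :
  ex_rect_int f a b c d -> ex_rect_int g a b c d -> ex_rect_int (fun z => f z - g z)%C a b c d.
Proof.
  intros (? & ? & ? & ?) (? & ? & ? & ?).
  repeat split; eexists; apply is_CInt_minus; apply CInt_correct; assumption.
Qed.

Lemma rect_int_minus (f g : C -> C) (a b c d : R) :
  ex_rect_int f a b c d -> ex_rect_int g a b c d ->
  rect_int (fun z => f z - g z)%C a b c d = (rect_int f a b c d - rect_int g a b c d)%C.
Proof.
  intros (f_c & f_d & f_b & f_a) (g_c & g_d & g_b & g_a); unfold rect_int.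
  rewrite (CInt_minus (fun s => f (s, c))), (CInt_minus (fun s => f (s, d))),
    (CInt_minus (fun y => f (b, y))), (CInt_minus (fun y => f (a, y))) by trivial.
  ring.
Qed.

Lemma rect_int_Cmult (k : C) (f : C -> C) (a b c d : R) :
  ex_rect_int f a b c d -> rect_int (fun z => k * f z)%C a b c d = (k * rect_int f a b c d)%C.
Proof.
  intros (f_c & f_d & f_b & f_a); unfold rect_int.
  rewrite (CInt_Cmult k (fun s => f (s, c))), (CInt_Cmult k (fun s => f (s, d))),
    (CInt_Cmult k (fun y => f (b, y))), (CInt_Cmult k (fun y => f (a, y))) by trivial.
  ring.
Qed.

Lemma Cmod_rect_int_le (f : C -> C) (a b c d M : R) : a <= b -> c <= d ->
  ex_rect_int f a b c d -> (forall z, rect_boundary a b c d z -> Cmod (f z) <= M) ->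
  Cmod (rect_int f a b c d) <= 2 * ((b - a) + (d - c)) * M.
Proof.
  intros a_le_b c_le_d (f_c & f_d & f_b & f_a) f_le; unfold rect_int.
  assert (horizontal_le : forall y, y = c \/ y = d -> ex_CInt (fun s => f (s, y)) a b ->
    Cmod (CInt (fun s => f (s, y)) a b) <= (b - a) * M).
  { intros y y_eq f_int; apply is_CInt_Cmod_le_const with (fun s => f (s, y)); trivial;
      [| now apply CInt_correct].
    auto using rect_boundary_horizontal. }
  assert (vertical_le : forall s, s = a \/ s = b -> ex_CInt (fun y => f (s, y)) c d ->
    Cmod (CInt (fun y => f (s, y)) c d) <= (d - c) * M).
  { intros s s_eq f_int; apply is_CInt_Cmod_le_const with (fun y => f (s, y)); trivial;
      [| now apply CInt_correct].
    auto using rect_boundary_vertical. }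
  eapply Rle_trans; [apply Cmod_triangle |]; rewrite Cmod_mult, Cmod_Ci, Rmult_1_l.
  eapply Rle_trans; [apply Rplus_le_compat; apply Cmod_minus_le |].
  pose proof (horizontal_le c (or_introl eq_refl) f_c).
  pose proof (horizontal_le d (or_intror eq_refl) f_d).
  pose proof (vertical_le b (or_intror eq_refl) f_b).
  pose proof (vertical_le a (or_introl eq_refl) f_a); lra.
Qed.

Lemma CInt_split (f : R -> C) (a m b : R) : a <= m <= b -> ex_CInt f a b ->
  CInt f a b = (CInt f a m + CInt f m b)%C.
Proof.
  intros m_in f_int; symmetry; apply CInt_Chasles.
  - now apply (ex_RInt_Chasles_1 (V := C_R_CompleteNormedModule) f a m b).
  - now apply (ex_RInt_Chasles_2 (V := C_R_CompleteNormedModule) f a m b).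
Qed.

Lemma rect_int_split_Re (f : C -> C) (a m b c d : R) : a <= m <= b ->
  ex_CInt (fun s => f (s, c)) a b -> ex_CInt (fun s => f (s, d)) a b ->
  rect_int f a b c d = (rect_int f a m c d + rect_int f m b c d)%C.
Proof.
  intros m_in f_c f_d; unfold rect_int.
  rewrite (CInt_split (fun s => f (s, c)) a m b), (CInt_split (fun s => f (s, d)) a m b) by trivial.
  ring.
Qed.

Lemma rect_int_split_Im (f : C -> C) (a b c m d : R) : c <= m <= d ->
  ex_CInt (fun y => f (a, y)) c d -> ex_CInt (fun y => f (b, y)) c d ->
  rect_int f a b c d = (rect_int f a b c m + rect_int f a b m d)%C.
Proof.
  intros m_in f_a f_b; unfold rect_int.
  rewrite (CInt_split (fun y => f (a, y)) c m d), (CInt_split (fun y => f (b, y)) c m d) by trivial.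
  ring.
Qed.

Lemma rect_int_pair_sides (f : C -> C) (a b c d : R) : ex_rect_int f a b c d ->
  rect_int f a b c d =
  (CInt (fun s => f (s, c) - f (s, d)) a b + Ci * CInt (fun y => f (b, y) - f (a, y)) c d)%C.
Proof.
  intros (f_c & f_d & f_b & f_a); unfold rect_int.
  now rewrite (CInt_minus (fun s => f (s, c))), (CInt_minus (fun y => f (b, y))) by trivial.
Qed.

Lemma ex_Cderive_affine (k l z : C) : ex_Cderive (fun w => k + l * w)%C z.
Proof.
  apply ex_Cderive_plus; [apply ex_derive_const |].
  apply ex_Cderive_mult; [apply ex_derive_const | apply ex_derive_id].
Qed.

Lemma rect_int_affine (k l : C) (a b c d : R) : a <= b -> c <= d ->
  rect_int (fun z => k + l * z)%C a b c d = RtoC 0.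
Proof.
  intros a_le_b c_le_d.
  rewrite rect_int_pair_sides
    by (apply ex_rect_int_continuous; trivial; intros; apply ex_Cderive_continuous, ex_Cderive_affine).
  rewrite (CInt_unique (fun s => k + l * (s, c) - (k + l * (s, d)))%C a b
             (RtoC (b - a) * (l * Ci * RtoC (c - d)))%C).
  - rewrite (CInt_unique (fun y => k + l * (b, y) - (k + l * (a, y)))%C c d
               (RtoC (d - c) * (l * RtoC (b - a)))%C).
    + rewrite !RtoC_minus; ring.
    + eapply (is_RInt_ext (V := C_R_CompleteNormedModule)); [| apply is_CInt_const].
      intros y _; apply injective_projections; simpl; ring.
  - eapply (is_RInt_ext (V := C_R_CompleteNormedModule)); [| apply is_CInt_const].
    intros s _; apply injective_projections; simpl; ring.
Qed.

Definition is_half (I J : R * R) : Prop :=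
  J = (fst I, (fst I + snd I) / 2) \/ J = ((fst I + snd I) / 2, snd I).

Lemma is_lim_seq_halving (w : R) : is_lim_seq (fun n => w / 2 ^ n) 0.
Proof.
  apply (is_lim_seq_ext (fun n => w * (/ 2) ^ n)).
  - intros n; now rewrite pow_inv.
  - rewrite <- (Rmult_0_r w); apply (is_lim_seq_scal_l _ w 0), is_lim_seq_geom.
    rewrite Rabs_pos_eq; lra.
Qed.

Lemma nested_halves (I : nat -> R * R) : fst (I 0%nat) <= snd (I 0%nat) ->
  (forall n, is_half (I n) (I (S n))) ->
  exists x, forall n, fst (I n) <= x <= snd (I n) /\
    fst (I 0%nat) <= fst (I n) /\ snd (I n) <= snd (I 0%nat) /\
    snd (I n) - fst (I n) = (snd (I 0%nat) - fst (I 0%nat)) / 2 ^ n.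
Proof.
  intros I0_le halves.
  assert (width : forall n, snd (I n) - fst (I n) = (snd (I 0%nat) - fst (I 0%nat)) / 2 ^ n).
  { induction n as [| n IH]; [simpl; field |].
    assert (pow_pos : 0 < 2 ^ n) by (apply pow_lt; lra).
    replace ((snd (I 0%nat) - fst (I 0%nat)) / 2 ^ S n) with ((snd (I n) - fst (I n)) / 2)
      by (rewrite IH; simpl; field; lra).
    destruct (halves n) as [-> | ->]; simpl; field. }
  assert (I_le : forall n, fst (I n) <= snd (I n)).
  { intros n; assert (0 <= (snd (I 0%nat) - fst (I 0%nat)) / 2 ^ n)
      by (apply Rdiv_le_0_compat; [lra | apply pow_lt; lra]).
    pose proof (width n); lra. }
  assert (monotone : forall n, fst (I n) <= fst (I (S n)) /\ snd (I (S n)) <= snd (I n)).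
  { intros n; pose proof (I_le n); destruct (halves n) as [-> | ->]; simpl; lra. }
  destruct (ex_lim_seq_adj (fun n => fst (I n)) (fun n => snd (I n))) as [[x x_lim] [[y y_lim] x_eq_y]];
    try apply monotone.
  { apply (is_lim_seq_ext (fun n => (snd (I 0%nat) - fst (I 0%nat)) / 2 ^ n));
      [intros n; symmetry; apply width | apply is_lim_seq_halving]. }
  rewrite (is_lim_seq_unique _ _ x_lim), (is_lim_seq_unique _ _ y_lim) in x_eq_y.
  injection x_eq_y as <-; exists x; intros n.
  assert (lower := is_lim_seq_incr_compare _ x x_lim (fun m => proj1 (monotone m))).
  assert (upper := is_lim_seq_decr_compare _ x y_lim (fun m => proj2 (monotone m))).
  split; [now split |]; split; [| split; [| apply width]].
  - induction n as [| n IH]; [lra | pose proof (monotone n); lra].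
  - induction n as [| n IH]; [lra | pose proof (monotone n); lra].
Qed.

Lemma dependent_choice {A : Type} (P : A -> Prop) (next : A -> A -> Prop) (x0 : A) :
  P x0 -> (forall x, P x -> exists y, P y /\ next x y) ->
  exists u : nat -> A, u 0%nat = x0 /\ forall n, P (u n) /\ next (u n) (u (S n)).
Proof.
  intros P_x0 step.
  destruct (functional_choice_imp_functional_dependent_choice choice
              (fun x y : {x | P x} => next (proj1_sig x) (proj1_sig y))) with (x0 := exist P x0 P_x0)
    as [u [u_0 u_step]].
  { intros [x P_x]; destruct (step x P_x) as [y [P_y next_xy]]; now exists (exist P y P_y). }
  exists (fun n => proj1_sig (u n)); split; [now rewrite u_0 |].
  intros n; split; [apply proj2_sig | apply u_step].
Qed.

(* A two-dimensional Cousin lemma: a property of rectangles that is inherited from the four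
   quarters and holds for all small rectangles around each point holds everywhere. *)
Lemma rect_bisection (P : R -> R -> R -> R -> Prop) (a b c d : R) : a <= b -> c <= d ->
  (forall a b c d, a <= b -> c <= d ->
    (forall I J, is_half (a, b) I -> is_half (c, d) J -> P (fst I) (snd I) (fst J) (snd J)) ->
    P a b c d) ->
  (forall z, in_rect a b c d z -> exists delta, 0 < delta /\ forall a' b' c' d',
    in_rect a' b' c' d' z -> a <= a' -> b' <= b -> c <= c' -> d' <= d ->
    b' - a' < delta -> d' - c' < delta -> P a' b' c' d') ->
  P a b c d.
Proof.
  intros a_le_b c_le_d from_quarters small; apply NNPP; intros not_P.
  set (bad := fun IJ : (R * R) * (R * R) => let (I, J) := IJ in
    fst I <= snd I /\ fst J <= snd J /\ ~ P (fst I) (snd I) (fst J) (snd J)).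
  destruct (dependent_choice bad (fun IJ IJ' => is_half (fst IJ) (fst IJ') /\ is_half (snd IJ) (snd IJ'))
              ((a, b), (c, d))) as [IJ [IJ_0 IJ_step]]; [now repeat split | |].
  { intros [[a' b'] [c' d']] (a'_le & c'_le & not_P'); simpl in *.
    apply NNPP; intros no_bad_quarter; apply not_P', from_quarters; trivial.
    intros I J half_I half_J; apply NNPP; intros not_P_IJ; apply no_bad_quarter.
    exists (I, J); split; [| now split]; split; [| split; [| trivial]].
    - destruct half_I as [-> | ->]; simpl; lra.
    - destruct half_J as [-> | ->]; simpl; lra. }
  destruct (nested_halves (fun n => fst (IJ n))) as [x x_in];
    [now rewrite IJ_0 | apply IJ_step |].
  destruct (nested_halves (fun n => snd (IJ n))) as [y y_in];
    [now rewrite IJ_0 | apply IJ_step |].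
  rewrite IJ_0 in x_in, y_in; simpl in x_in, y_in.
  destruct (small (x, y)) as [delta [delta_pos small_xy]].
  { pose proof (x_in 0%nat); pose proof (y_in 0%nat); rewrite IJ_0 in *; split; tauto. }
  assert (small_width : forall w, eventually (fun n => w / 2 ^ n < delta)).
  { intros w; destruct (proj1 (filterlim_R_iff _ _) (is_lim_seq_halving w) delta delta_pos) as [N near].
    exists N; intros n N_le; specialize (near n N_le); rewrite Rminus_0_r in near.
    eapply Rle_lt_trans; [apply Rle_abs | exact near]. }
  destruct (filter_ex _ (filter_and _ _ (small_width (b - a)) (small_width (d - c)))) as [n [small_I small_J]].
  destruct (x_in n) as (x_in_n & ? & ? & width_I), (y_in n) as (y_in_n & ? & ? & width_J).
  destruct (IJ_step n) as [bad_n _]; unfold bad in bad_n; destruct (IJ n) as [I J]; simpl in *.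
  apply bad_n, small_xy; trivial; [now split | now rewrite width_I | now rewrite width_J].
Qed.

Lemma Cmod_le_eps_eq_0 (z : C) (M : R) : (forall eps, 0 < eps -> Cmod z <= eps * M) -> z = RtoC 0.
Proof.
  intros z_le; apply Cmod_eq_0, Rle_antisym; [| apply Cmod_ge_0]; apply le_epsilon; intros eps eps_pos.
  assert (abs_pos : 0 < Rabs M + 1) by (pose proof (Rabs_pos M); lra).
  rewrite Rplus_0_l; eapply Rle_trans; [apply (z_le (eps / (Rabs M + 1))), Rdiv_lt_0_compat; lra |].
  apply Rle_trans with (eps / (Rabs M + 1) * (Rabs M + 1)); [| right; field; lra].
  apply Rmult_le_compat_l; [apply Rdiv_le_0_compat; lra | pose proof (Rle_abs M); lra].
Qed.

Lemma ex_rect_int_holomorphic (f : C -> C) (a b c d : R) : a <= b -> c <= d ->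
  (forall z, rect_boundary a b c d z -> ex_Cderive f z) -> ex_rect_int f a b c d.
Proof.
  intros a_le_b c_le_d f_holo; apply ex_rect_int_continuous; trivial.
  intros z z_in; now apply ex_Cderive_continuous, f_holo.
Qed.

Lemma rect_int_quarters (f : C -> C) (a b c d : R) : a <= b -> c <= d ->
  (forall z, in_rect a b c d z -> ex_Cderive f z) ->
  rect_int f a b c d =
  (rect_int f a ((a + b) / 2) c ((c + d) / 2) + rect_int f a ((a + b) / 2) ((c + d) / 2) d +
   (rect_int f ((a + b) / 2) b c ((c + d) / 2) + rect_int f ((a + b) / 2) b ((c + d) / 2) d))%C.
Proof.
  intros a_le_b c_le_d f_holo.
  assert (f_horizontal : forall y, c <= y <= d -> ex_CInt (fun s => f (s, y)) a b).
  { intros y y_in; apply ex_CInt_horizontal; trivial.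
    intros s s_in; apply ex_Cderive_continuous, f_holo; now split. }
  assert (f_vertical : forall s, a <= s <= b -> ex_CInt (fun y => f (s, y)) c d).
  { intros s s_in; apply ex_CInt_vertical; trivial.
    intros y y_in; apply ex_Cderive_continuous, f_holo; now split. }
  rewrite (rect_int_split_Re f a ((a + b) / 2)) by (try apply f_horizontal; lra).
  rewrite (rect_int_split_Im f a _ c ((c + d) / 2)) by (try apply f_vertical; lra).
  now rewrite (rect_int_split_Im f _ b c ((c + d) / 2)) by (try apply f_vertical; lra).
Qed.

Lemma Cmod_rect_int_near_le (f : C -> C) (z : C) (eps : R) : ex_Cderive f z -> 0 < eps ->
  exists delta, 0 < delta /\ forall a b c d, a <= b -> c <= d -> in_rect a b c d z ->
    b - a < delta -> d - c < delta -> ex_rect_int f a b c d ->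
    Cmod (rect_int f a b c d) <= eps * (((b - a) + (d - c)) * ((b - a) + (d - c))).
Proof.
  intros [l diff] eps_pos; rewrite is_Cderive_iff in diff.
  destruct (diff (eps / 2)) as [delta [delta_pos near]]; [lra |].
  exists (delta / 2); split; [lra |]; intros a b c d a_le_b c_le_d z_in small_ab small_cd f_int.
  set (g := fun w => (f z - l * z + l * w)%C).
  assert (g_int : ex_rect_int g a b c d).
  { apply ex_rect_int_holomorphic; trivial; intros; apply ex_Cderive_affine. }
  replace (rect_int f a b c d) with (rect_int (fun w => f w - g w)%C a b c d)
    by (rewrite rect_int_minus by trivial; unfold g; rewrite rect_int_affine by trivial; ring).
  set (p := (b - a) + (d - c)).
  replace (eps * (p * p)) with (2 * p * (eps / 2 * p)) by field.
  apply Cmod_rect_int_le; trivial; [now apply ex_rect_int_minus |].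
  intros w [[Re_w Im_w] _]; destruct z_in as [Re_z Im_z]; unfold g.
  replace (f w - (f z - l * z + l * w))%C with (f w - f z - l * (w - z))%C by ring.
  assert (w_close : Cmod (w - z) <= p).
  { eapply Rle_trans; [apply Cmod_le_Rabs |].
    change (Rabs (Re w - Re z) + Rabs (Im w - Im z) <= p).
    apply Rplus_le_compat; apply Rabs_le; lra. }
  eapply Rle_trans; [apply near; unfold p in w_close; lra |].
  apply Rmult_le_compat_l; lra.
Qed.

Lemma Cmod_rect_int_holomorphic_le (f : C -> C) (a b c d eps : R) : a <= b -> c <= d -> 0 < eps ->
  (forall z, in_rect a b c d z -> ex_Cderive f z) ->
  Cmod (rect_int f a b c d) <= eps * (((b - a) + (d - c)) * ((b - a) + (d - c))).
Proof.
  intros a_le_b c_le_d eps_pos f_holo.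
  apply (rect_bisection (fun a b c d => a <= b -> c <= d ->
    (forall z, in_rect a b c d z -> ex_Cderive f z) ->
    Cmod (rect_int f a b c d) <= eps * (((b - a) + (d - c)) * ((b - a) + (d - c))))); trivial.
  - clear a b c d a_le_b c_le_d f_holo.
    intros a b c d a_le_b c_le_d quarters_le _ _ f_holo.
    assert (quarter_le : forall I J, is_half (a, b) I -> is_half (c, d) J ->
      Cmod (rect_int f (fst I) (snd I) (fst J) (snd J)) <=
      eps * (((b - a) + (d - c)) * ((b - a) + (d - c))) / 4).
    { intros I J half_I half_J; eapply Rle_trans; [apply quarters_le; trivial |].
      - destruct half_I as [-> | ->]; simpl; lra.
      - destruct half_J as [-> | ->]; simpl; lra.
      - intros z [Re_in Im_in]; apply f_holo; split;
          [destruct half_I as [-> | ->] | destruct half_J as [-> | ->]]; simpl in *; lra.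
      - right; destruct half_I as [-> | ->], half_J as [-> | ->]; simpl; field. }
    rewrite rect_int_quarters by trivial.
    pose proof (quarter_le _ _ (or_introl eq_refl) (or_introl eq_refl)).
    pose proof (quarter_le _ _ (or_introl eq_refl) (or_intror eq_refl)).
    pose proof (quarter_le _ _ (or_intror eq_refl) (or_introl eq_refl)).
    pose proof (quarter_le _ _ (or_intror eq_refl) (or_intror eq_refl)); simpl in *.
    eapply Rle_trans; [apply Cmod_triangle |].
    eapply Rle_trans; [apply Rplus_le_compat; apply Cmod_triangle | lra].
  - intros z z_in.
    destruct (Cmod_rect_int_near_le f z eps (f_holo z z_in) eps_pos) as [delta [delta_pos near]].
    exists delta; split; [exact delta_pos |].
    intros a' b' c' d' z_in' _ _ _ _ small_ab small_cd a'_le_b' c'_le_d' f_holo'.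
    apply near; trivial; apply ex_rect_int_holomorphic; trivial.
    intros w [w_in _]; now apply f_holo'.
Qed.

Theorem Cauchy_Goursat (f : C -> C) (a b c d : R) : a <= b -> c <= d ->
  (forall z, in_rect a b c d z -> ex_Cderive f z) -> rect_int f a b c d = RtoC 0.
Proof.
  intros a_le_b c_le_d f_holo.
  apply (Cmod_le_eps_eq_0 _ (((b - a) + (d - c)) * ((b - a) + (d - c)))).
  intros eps eps_pos; now apply Cmod_rect_int_holomorphic_le.
Qed.

(** * Residues *)

Definition is_simple_pole (f : C -> C) (z0 A : C) : Prop :=
  Climit (fun z => (z - z0) * f z)%C (locally' (T := C_UniformSpace) z0) A.

Lemma is_simple_pole_div (f g : C -> C) (z0 g' : C) :
  Ccontinuous f z0 -> is_Cderive g z0 g' -> g z0 = RtoC 0 -> g' <> RtoC 0 ->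
  is_simple_pole (fun z => f z / g z)%C z0 (f z0 / g')%C.
Proof.
  intros f_cont g_diff g_zero g'_neq_0.
  assert (lim := filterlim_Cmult _ _ _ _ (Climit_locally' f z0 f_cont)
                   (filterlim_Cinv _ _ g'_neq_0 (proj1 (is_Cderive_quotient _ _ _) g_diff))).
  revert lim; apply filterlim_ext_loc.
  apply locally_C_iff; exists 1; split; [lra |]; intros z _ z_neq_z0.
  rewrite g_zero; destruct (classic (g z = RtoC 0)) as [-> | g_neq_0].
  - unfold Cdiv, Cminus; rewrite Copp_0, Cplus_0_l, Cmult_0_l, Cinv_0; ring.
  - field; split; trivial; now apply Cminus_eq_contra.
Qed.

Lemma is_simple_pole_mult (f k : C -> C) (z0 A : C) :
  Ccontinuous f z0 -> is_simple_pole k z0 A -> is_simple_pole (fun z => f z * k z)%C z0 (f z0 * A)%C.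
Proof.
  intros f_cont pole.
  generalize (filterlim_Cmult _ _ _ _ (Climit_locally' f z0 f_cont) pole); apply filterlim_ext.
  intros z; ring.
Qed.

Lemma is_RInt_Cauchy_kernel (r u0 : R) : 0 < r ->
  is_RInt (fun u => 2 * r / ((u - u0) * (u - u0) + r * r)) (u0 - r) (u0 + r) PI.
Proof.
  intros r_pos.
  replace PI with (minus (2 * atan ((u0 + r - u0) / r)) (2 * atan ((u0 - r - u0) / r))).
  - apply (is_RInt_derive (V := R_CompleteNormedModule) (fun u => 2 * atan ((u - u0) / r)));
      intros u _; pose proof (Rle_0_sqr (u - u0)); unfold Rsqr in *;
      assert (0 < (u - u0) * (u - u0) + r * r) by nra.
    + auto_derive; [lra | field; split; nra].
    + apply (ex_derive_continuous (V := R_NormedModule)); auto_derive; lra.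
  - replace ((u0 + r - u0) / r) with 1 by (field; lra).
    replace ((u0 - r - u0) / r) with (Ropp 1) by (field; lra).
    rewrite atan_opp, atan_1; unfold minus, plus, opp; simpl; field.
Qed.

Lemma Cmod_rect_boundary_square_ge (x0 y0 r : R) (z : C) : 0 < r ->
  rect_boundary (x0 - r) (x0 + r) (y0 - r) (y0 + r) z -> r <= Cmod (z - (x0, y0)).
Proof.
  intros r_pos [_ on_side].
  pose proof (re_le_Cmod (z - (x0, y0))) as Re_le; pose proof (im_le_Cmod (z - (x0, y0))) as Im_le.
  change (Re (z - (x0, y0))) with (Re z - x0) in Re_le.
  change (Im (z - (x0, y0))) with (Im z - y0) in Im_le.
  destruct on_side as [side | [side | [side | side]]].
  - rewrite side, Rabs_left in Re_le; lra.
  - rewrite side, Rabs_right in Re_le; lra.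
  - rewrite side, Rabs_left in Im_le; lra.
  - rewrite side, Rabs_right in Im_le; lra.
Qed.

Lemma ex_Cderive_Cauchy_kernel (z0 z : C) : z <> z0 -> ex_Cderive (fun z => / (z - z0))%C z.
Proof.
  intros z_neq_z0; apply ex_Cderive_inv; [| now apply Cminus_eq_contra].
  apply ex_Cderive_minus; [apply ex_derive_id | apply ex_derive_const].
Qed.

Lemma rect_int_Cauchy_kernel (x0 y0 r : R) : 0 < r ->
  ex_rect_int (fun z => / (z - (x0, y0)))%C (x0 - r) (x0 + r) (y0 - r) (y0 + r) /\
  rect_int (fun z => / (z - (x0, y0)))%C (x0 - r) (x0 + r) (y0 - r) (y0 + r) = (RtoC (2 * PI) * Ci)%C.
Proof.
  intros r_pos.
  assert (kernel_int : ex_rect_int (fun z => / (z - (x0, y0)))%C (x0 - r) (x0 + r) (y0 - r) (y0 + r)).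
  { apply ex_rect_int_holomorphic; try lra; intros z on_boundary.
    apply ex_Cderive_Cauchy_kernel; intros ->.
    apply Cmod_rect_boundary_square_ge in on_boundary; [| exact r_pos].
    replace ((x0, y0) - (x0, y0))%C with (RtoC 0) in on_boundary by ring.
    rewrite Cmod_0 in on_boundary; lra. }
  split; [exact kernel_int |]; rewrite rect_int_pair_sides by exact kernel_int.
  rewrite (CInt_unique _ (x0 - r) (x0 + r) (Ci * RtoC PI)%C).
  - rewrite (CInt_unique _ (y0 - r) (y0 + r) (RtoC PI)).
    + replace (2 * PI) with (PI + PI) by ring; rewrite RtoC_plus; ring.
    + eapply (is_RInt_ext (V := C_R_CompleteNormedModule));
        [| apply is_CInt_RtoC, is_RInt_Cauchy_kernel, r_pos].
      intros u _; pose proof (Rle_0_sqr (u - y0)); unfold Rsqr in *.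
      apply injective_projections; simpl; field; repeat split; nra.
  - eapply (is_RInt_ext (V := C_R_CompleteNormedModule));
      [| apply is_CInt_Cmult, is_CInt_RtoC, is_RInt_Cauchy_kernel, r_pos].
    intros u _; pose proof (Rle_0_sqr (u - x0)); unfold Rsqr in *.
    apply injective_projections; simpl; field; repeat split; nra.
Qed.

Lemma rect_int_shrink (f : C -> C) (a a' b' b c c' d' d : R) :
  a <= a' -> a' <= b' -> b' <= b -> c <= c' -> c' <= d' -> d' <= d ->
  (forall z, in_rect a b c d z -> ~ (a' < Re z < b' /\ c' < Im z < d') -> ex_Cderive f z) ->
  rect_int f a b c d = rect_int f a' b' c' d'.
Proof.
  intros a_le a'_le_b' b'_le c_le c'_le_d' d'_le f_holo.
  assert (outside : forall s t, a <= s <= b -> c <= t <= d -> ~ (a' < s < b' /\ c' < t < d') ->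
    ex_Cderive f (s, t)) by (intros; apply f_holo; [split |]; trivial).
  assert (horizontal : forall s1 s2 t, a <= s1 -> s1 <= s2 -> s2 <= b -> c <= t <= d ->
    ~ (c' < t < d') -> ex_CInt (fun s => f (s, t)) s1 s2).
  { intros s1 s2 t ? ? ? ? ?; apply ex_CInt_horizontal; trivial; intros s s_in.
    apply ex_Cderive_continuous, outside; lra. }
  assert (vertical : forall s t1 t2, a <= s <= b -> c <= t1 -> t1 <= t2 -> t2 <= d ->
    ~ (a' < s < b') -> ex_CInt (fun t => f (s, t)) t1 t2).
  { intros s t1 t2 ? ? ? ? ?; apply ex_CInt_vertical; trivial; intros t t_in.
    apply ex_Cderive_continuous, outside; lra. }
  rewrite (rect_int_split_Re f a a' b) by (try apply horizontal; lra).
  rewrite (rect_int_split_Re f a' b' b) by (try apply horizontal; lra).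
  rewrite (rect_int_split_Im f a' b' c c' d) by (try apply vertical; lra).
  rewrite (rect_int_split_Im f a' b' c' d' d) by (try apply vertical; lra).
  rewrite (Cauchy_Goursat f a a'), (Cauchy_Goursat f b' b), (Cauchy_Goursat f a' b' c c'),
    (Cauchy_Goursat f a' b' d' d)
    by (try (intros z [Re_z Im_z]; apply f_holo; [split |]); lra).
  ring.
Qed.

Lemma small_square_in_rect (x0 y0 a b c d delta : R) :
  a < x0 < b -> c < y0 < d -> 0 < delta -> exists r, 0 < r < delta /\
  a <= x0 - r /\ x0 + r <= b /\ c <= y0 - r /\ y0 + r <= d.
Proof.
  intros x0_in y0_in delta_pos.
  set (r := Rmin (delta / 2) (Rmin (Rmin (x0 - a) (b - x0)) (Rmin (y0 - c) (d - y0)))).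
  assert (r_pos : 0 < r) by (unfold r; repeat apply Rmin_pos; lra).
  assert (r_le : r <= delta / 2 /\ (r <= x0 - a /\ r <= b - x0) /\ (r <= y0 - c /\ r <= d - y0)).
  { unfold r; repeat split; eauto using Rle_trans, Rmin_l, Rmin_r. }
  exists r; lra.
Qed.

Theorem residue_theorem (f : C -> C) (z0 A : C) (a b c d : R) :
  a < Re z0 < b -> c < Im z0 < d -> is_simple_pole f z0 A ->
  (forall z, in_rect a b c d z -> z <> z0 -> ex_Cderive f z) ->
  rect_int f a b c d = (RtoC (2 * PI) * Ci * A)%C.
Proof.
  destruct z0 as [x0 y0]; simpl; intros x0_in y0_in pole f_holo.
  apply Ceq_minus, (Cmod_le_eps_eq_0 _ 8); intros eps eps_pos.
  destruct (proj1 (locally_C_iff _ _) (proj1 (filterlim_C_iff _ _) pole eps eps_pos))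
    as [delta [delta_pos near]].
  destruct (small_square_in_rect x0 y0 a b c d (delta / 2)) as [r (r_in & ? & ? & ? & ?)]; try lra.
  rewrite (rect_int_shrink f a (x0 - r) (x0 + r) b c (y0 - r) (y0 + r) d); try lra.
  2: { intros z z_in outside; apply f_holo; trivial; intros ->; simpl in outside; lra. }
  destruct (rect_int_Cauchy_kernel x0 y0 r) as [kernel_int kernel_eq]; [lra |].
  assert (boundary_neq : forall z, rect_boundary (x0 - r) (x0 + r) (y0 - r) (y0 + r) z -> z <> (x0, y0)).
  { intros z [_ on_side] ->; simpl in on_side; lra. }
  assert (f_int : ex_rect_int f (x0 - r) (x0 + r) (y0 - r) (y0 + r)).
  { apply ex_rect_int_holomorphic; try lra; intros z on_boundary; apply f_holo.
    - destruct on_boundary as [[Re_z Im_z] _]; split; lra.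
    - now apply boundary_neq. }
  assert (A_kernel_int : ex_rect_int (fun z => A * / (z - (x0, y0)))%C (x0 - r) (x0 + r) (y0 - r) (y0 + r)).
  { destruct kernel_int as (? & ? & ? & ?).
    repeat split; eexists; apply is_CInt_Cmult, CInt_correct; assumption. }
  replace (rect_int f (x0 - r) (x0 + r) (y0 - r) (y0 + r) - RtoC (2 * PI) * Ci * A)%C
    with (rect_int (fun z => f z - A * / (z - (x0, y0)))%C (x0 - r) (x0 + r) (y0 - r) (y0 + r))
    by (rewrite rect_int_minus, rect_int_Cmult, kernel_eq by trivial; ring).
  replace (eps * 8) with (2 * ((x0 + r - (x0 - r)) + (y0 + r - (y0 - r))) * (eps / r)) by (field; lra).
  apply Cmod_rect_int_le; try lra; [now apply ex_rect_int_minus |]; intros z on_boundary.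
  assert (z_neq := Cminus_eq_contra _ _ (boundary_neq z on_boundary)).
  replace (f z - A * / (z - (x0, y0)))%C
    with (((z - (x0, y0)) * f z - A) / (z - (x0, y0)))%C by (field; trivial).
  rewrite Cmod_div by trivial; apply Rmult_le_compat; [apply Cmod_ge_0 | | |].
  - left; now apply Rinv_0_lt_compat, Cmod_gt_0.
  - left; apply near; [| now apply boundary_neq].
    destruct on_boundary as [[Re_z Im_z] _].
    eapply Rle_lt_trans; [apply Cmod_le_Rabs |].
    change (Rabs (Re z - x0) + Rabs (Im z - y0) < delta).
    apply Rle_lt_trans with (r + r); [apply Rplus_le_compat; apply Rabs_le; lra | lra].
  - apply Rinv_le_contravar; [lra | apply Cmod_rect_boundary_square_ge; trivial; lra].
Qed.

(** * Limits of contour integrals *)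

Lemma continuous_bounded (f : R -> C) (a b : R) : (forall x, a <= x <= b -> Ccontinuous f x) ->
  exists M, forall x, a <= x <= b -> Cmod (f x) <= M.
Proof.
  intros f_cont; destruct (bounded_continuity (V := C_R_NormedModule) f a b f_cont) as [M f_le].
  exists M; intros x x_in; rewrite <- norm_C_R; left; now apply f_le.
Qed.

Lemma continuous_bounded_on_rect_boundary (f : C -> C) (a b c d : R) : a <= b -> c <= d ->
  (forall z, rect_boundary a b c d z -> Ccontinuous f z) ->
  exists M, forall z, rect_boundary a b c d z -> Cmod (f z) <= M.
Proof.
  intros a_le_b c_le_d f_cont.
  assert (horizontal : forall y, y = c \/ y = d ->
    exists M, forall s, a <= s <= b -> Cmod (f (s, y)) <= M).
  { intros y y_side; apply (continuous_bounded (fun s => f (s, y))); intros s s_in.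
    now apply continuous_horizontal, f_cont, rect_boundary_horizontal. }
  assert (vertical : forall s, s = a \/ s = b ->
    exists M, forall y, c <= y <= d -> Cmod (f (s, y)) <= M).
  { intros s s_side; apply (continuous_bounded (fun y => f (s, y))); intros y y_in.
    now apply continuous_vertical, f_cont, rect_boundary_vertical. }
  destruct (horizontal c) as [M_c bound_c], (horizontal d) as [M_d bound_d],
    (vertical a) as [M_a bound_a], (vertical b) as [M_b bound_b]; auto.
  exists (Rmax (Rmax M_a M_b) (Rmax M_c M_d)).
  intros [s y] [[Re_z Im_z] side]; simpl in *.
  pose proof (Rmax_l (Rmax M_a M_b) (Rmax M_c M_d)); pose proof (Rmax_r (Rmax M_a M_b) (Rmax M_c M_d)).
  pose proof (Rmax_l M_a M_b); pose proof (Rmax_r M_a M_b); pose proof (Rmax_l M_c M_d); pose proof (Rmax_r M_c M_d).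
  destruct side as [-> | [-> | [-> | ->]]].
  - pose proof (bound_a y Im_z); lra.
  - pose proof (bound_b y Im_z); lra.
  - pose proof (bound_c s Re_z); lra.
  - pose proof (bound_d s Re_z); lra.
Qed.

Definition uniform_limit_on (D : C -> Prop) (fN : nat -> C -> C) (f : C -> C) : Prop :=
  forall eps, 0 < eps -> eventually (fun n => forall z, D z -> Cmod (fN n z - f z) <= eps).

Lemma uniform_limit_on_Climit (D : C -> Prop) (fN : nat -> C -> C) (f : C -> C) (z : C) :
  uniform_limit_on D fN f -> D z -> Climit (fun n => fN n z) eventually (f z).
Proof.
  intros lim z_in; apply filterlim_C_iff; intros eps eps_pos.
  generalize (lim (eps / 2) ltac:(lra)); apply filter_imp; intros n close.
  specialize (close z z_in); lra.
Qed.

Lemma rect_int_uniform_limit (fN : nat -> C -> C) (f : C -> C) (a b c d : R) : a <= b -> c <= d ->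
  (forall n, ex_rect_int (fN n) a b c d) -> ex_rect_int f a b c d ->
  uniform_limit_on (rect_boundary a b c d) fN f ->
  Climit (fun n => rect_int (fN n) a b c d) eventually (rect_int f a b c d).
Proof.
  intros a_le_b c_le_d fN_int f_int lim; apply filterlim_C_iff; intros eps eps_pos.
  set (length := 2 * ((b - a) + (d - c)) + 1).
  assert (length_pos : 0 < length) by (unfold length; lra).
  assert (eps'_pos : 0 < eps / length) by now apply Rdiv_lt_0_compat.
  generalize (lim _ eps'_pos); apply filter_imp; intros n close.
  rewrite <- rect_int_minus by auto.
  eapply Rle_lt_trans;
    [apply Cmod_rect_int_le with (M := eps / length); trivial; now apply ex_rect_int_minus |].
  apply Rlt_le_trans with (length * (eps / length)); [| right; field; lra].
  apply Rmult_lt_compat_r; [trivial | unfold length; lra].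
Qed.

Lemma rect_int_line_limit (f : C -> C) (c d : R) (A B : C) (T M : nat -> R) : c <= d ->
  is_CInt_line (fun s => f (s, c)) A -> is_CInt_line (fun s => f (s, d)) B ->
  is_lim_seq T p_infty -> is_lim_seq M 0 ->
  (forall n s y, Rabs s = Rabs (T n) -> c <= y <= d -> Ccontinuous f (s, y) /\ Cmod (f (s, y)) <= M n) ->
  Climit (fun n => rect_int f (- T n) (T n) c d) eventually (A - B)%C.
Proof.
  intros c_le_d int_c int_d T_lim M_lim f_sides; unfold rect_int.
  replace (A - B)%C with (A - B + Ci * RtoC 0)%C by ring.
  apply filterlim_Cplus; [apply filterlim_Cminus |].
  - exact (filterlim_RInt_line (V := C_R_CompleteNormedModule) _ A T int_c T_lim).
  - exact (filterlim_RInt_line (V := C_R_CompleteNormedModule) _ B T int_d T_lim).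
  - apply filterlim_Cmult; [apply filterlim_const |].
    assert (side_le : forall n s, Rabs s = Rabs (T n) ->
      Cmod (CInt (fun y => f (s, y)) c d) <= (d - c) * M n).
    { intros n s s_eq; apply is_CInt_Cmod_le_const with (fun y => f (s, y)); trivial.
      - intros y y_in; now apply f_sides.
      - apply CInt_correct, ex_CInt_vertical; trivial; intros y y_in; now apply (f_sides n). }
    apply filterlim_Cmod_0 with (fun n => 2 * (d - c) * M n).
    + apply filter_forall; intros n.
      pose proof (side_le n (T n) eq_refl); pose proof (side_le n (- T n) (Rabs_Ropp _)).
      replace (CInt (fun y => f (T n, y)) c d - CInt (fun y => f ((- T n)%R, y)) c d - RtoC 0)%C
        with (CInt (fun y => f (T n, y)) c d - CInt (fun y => f ((- T n)%R, y)) c d)%C by ring.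
      eapply Rle_trans; [apply Cmod_minus_le | lra].
    + rewrite <- (Rmult_0_r (2 * (d - c))); exact (is_lim_seq_scal_l M _ 0 M_lim).
Qed.

Lemma uniform_limit_on_subset (D D' : C -> Prop) (fN : nat -> C -> C) (f : C -> C) :
  (forall z, D' z -> D z) -> uniform_limit_on D fN f -> uniform_limit_on D' fN f.
Proof. intros D'_le lim eps eps_pos; generalize (lim eps eps_pos); apply filter_imp; auto. Qed.

Lemma uniform_limit_on_mult (D : C -> Prop) (fN : nat -> C -> C) (f k : C -> C) (M : R) :
  uniform_limit_on D fN f -> (forall z, D z -> Cmod (k z) <= M) ->
  uniform_limit_on D (fun n z => fN n z * k z)%C (fun z => f z * k z)%C.
Proof.
  intros lim k_le eps eps_pos; pose proof (Rabs_pos M).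
  assert (eps'_pos : 0 < eps / (Rabs M + 1)) by (apply Rdiv_lt_0_compat; lra).
  generalize (lim _ eps'_pos); apply filter_imp; intros n close z z_in.
  rewrite <- Cmult_minus_distr_r, Cmod_mult.
  replace eps with (eps / (Rabs M + 1) * (Rabs M + 1)) by (field; lra).
  apply Rmult_le_compat; try apply Cmod_ge_0; [now apply close |].
  pose proof (k_le z z_in); pose proof (Rle_abs M); lra.
Qed.

Lemma continuous_uniform_limit {U : UniformSpace} {V : UniformSpace}
  (fN : nat -> U -> V) (f : U -> V) (x : U) :
  (forall n, continuous (fN n) x) ->
  (forall eps : posreal, exists n, locally x (fun y => ball (f y) eps (fN n y))) ->
  continuous f x.
Proof.
  intros fN_cont approx; apply filterlim_locally; intros eps.
  assert (third_pos : 0 < eps / 3) by (pose proof (cond_pos eps); lra).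
  set (third := mkposreal _ third_pos).
  destruct (approx third) as [n near].
  generalize (filter_and _ _ near (proj1 (filterlim_locally _ _) (fN_cont n) third)).
  apply filter_imp; intros y [near_y cont_y].
  replace (pos eps) with (pos third + third + third) by (simpl; lra).
  apply ball_triangle with (fN n y); [| apply ball_sym, near_y].
  apply ball_triangle with (fN n x); [exact (locally_singleton _ _ near) | exact cont_y].
Qed.

Lemma continuous_uniform_limit_on (D : C -> Prop) (fN : nat -> C -> C) (f : C -> C) (z : C) :
  locally (T := C_UniformSpace) z D -> (forall n, Ccontinuous (fN n) z) -> uniform_limit_on D fN f ->
  Ccontinuous f z.
Proof.
  intros near_D fN_cont lim; apply continuous_uniform_limit with fN; [exact fN_cont |].
  intros eps; destruct (lim (eps / 2)) as [N close]; [pose proof (cond_pos eps); lra |].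
  exists N; revert near_D; apply filter_imp; intros w w_in.
  specialize (close N (Nat.le_refl N) w w_in).
  pose proof (cond_pos eps); pose proof (re_le_Cmod (fN N w - f w)); pose proof (im_le_Cmod (fN N w - f w)).
  split.
  - change (Rabs (Re (fN N w - f w)) < eps); lra.
  - change (Rabs (Im (fN N w - f w)) < eps); lra.
Qed.

Theorem residue_theorem_uniform_limit (fN : nat -> C -> C) (f k : C -> C) (z0 A : C) (a b c d : R) :
  a < Re z0 < b -> c < Im z0 < d -> is_simple_pole k z0 A ->
  (forall z, in_rect a b c d z -> z <> z0 -> ex_Cderive k z) ->
  (forall n z, in_rect a b c d z -> ex_Cderive (fN n) z) ->
  (forall z, in_rect a b c d z -> Ccontinuous f z) ->
  uniform_limit_on (in_rect a b c d) fN f ->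
  rect_int (fun z => f z * k z)%C a b c d = (RtoC (2 * PI) * Ci * (f z0 * A))%C.
Proof.
  intros Re_z0 Im_z0 pole k_holo fN_holo f_cont lim.
  assert (z0_in : in_rect a b c d z0) by (split; lra).
  assert (boundary_neq : forall z, rect_boundary a b c d z -> z <> z0).
  { intros z [_ on_side] ->; lra. }
  assert (k_cont : forall z, rect_boundary a b c d z -> Ccontinuous k z).
  { intros z on_boundary; apply ex_Cderive_continuous, k_holo; [apply on_boundary | now apply boundary_neq]. }
  destruct (continuous_bounded_on_rect_boundary k a b c d ltac:(lra) ltac:(lra) k_cont) as [M k_le].
  apply (Climit_unique (F := eventually) (fun n => rect_int (fun z => fN n z * k z)%C a b c d)).
  - apply (rect_int_uniform_limit (fun n z => fN n z * k z)%C); try lra.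
    + intros n; apply ex_rect_int_continuous; try lra; intros z on_boundary.
      apply filterlim_Cmult; [apply ex_Cderive_continuous, fN_holo, on_boundary | now apply k_cont].
    + apply ex_rect_int_continuous; try lra; intros z on_boundary.
      apply filterlim_Cmult; [apply f_cont, on_boundary | now apply k_cont].
    + apply uniform_limit_on_mult with M; [| exact k_le].
      apply uniform_limit_on_subset with (in_rect a b c d); [intros z on_boundary; apply on_boundary | exact lim].
  - apply (filterlim_ext (fun n => RtoC (2 * PI) * Ci * (fN n z0 * A))%C).
    + intros n; symmetry; apply (residue_theorem _ z0); trivial.
      * apply is_simple_pole_mult; [now apply ex_Cderive_continuous, fN_holo | exact pole].
      * intros z z_in z_neq; apply ex_Cderive_mult; auto.
    + apply filterlim_Cmult; [apply filterlim_const |].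
      apply filterlim_Cmult; [| apply filterlim_const].
      now apply uniform_limit_on_Climit with (in_rect a b c d).
Qed.

(** * Jacobi's theta function *)

Definition cexp2pi (z : C) : C := cexp (RtoC (2 * PI) * Ci * z)%C.

Lemma Cmod_cexp2pi (z : C) : Cmod (cexp2pi z) = exp (- (2 * PI * Im z)).
Proof. unfold cexp2pi; rewrite Cmod_cexp; f_equal; destruct z; simpl; ring. Qed.

Lemma cexp2pi_plus (z w : C) : cexp2pi (z + w) = (cexp2pi z * cexp2pi w)%C.
Proof. unfold cexp2pi; rewrite <- cexp_plus; f_equal; ring. Qed.

Lemma cexp2pi_opp (z : C) : cexp2pi (- z) = (/ cexp2pi z)%C.
Proof. unfold cexp2pi; rewrite <- cexp_opp; f_equal; ring. Qed.

Lemma cexp2pi_IZR (k : Z) : cexp2pi (RtoC (IZR k)) = RtoC 1.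
Proof.
  assert (sin_0 : sin (PI * IZR k) = 0) by (apply sin_eq_0_1; exists k; ring).
  unfold cexp2pi, cexp; simpl.
  replace ((2 * PI * 0 - 0 * 1) * IZR k - (2 * PI * 1 + 0 * 0) * 0) with 0 by ring.
  replace ((2 * PI * 0 - 0 * 1) * 0 + (2 * PI * 1 + 0 * 0) * IZR k) with (2 * (PI * IZR k)) by ring.
  rewrite exp_0, cos_2a_sin, sin_2a, sin_0; apply injective_projections; simpl; ring.
Qed.

Lemma cexp2pi_eq_1 (k : Z) (z : C) :
  IZR k - / 2 <= Re z <= IZR k + / 2 -> cexp2pi z = RtoC 1 -> z = RtoC (IZR k).
Proof.
  intros Re_in eq_1; pose proof PI_RGT_0.
  assert (diff_0 : (RtoC (2 * PI) * Ci * (z - RtoC (IZR k)))%C = RtoC 0).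
  { apply cexp_eq_1_small.
    - replace (Im (RtoC (2 * PI) * Ci * (z - RtoC (IZR k)))) with (2 * PI * (Re z - IZR k))
        by (destruct z; simpl; ring).
      rewrite Rabs_mult, (Rabs_pos_eq (2 * PI)) by lra.
      assert (Rabs (Re z - IZR k) <= / 2) by (apply Rabs_le; lra); nra.
    - change (cexp2pi (z + - RtoC (IZR k)) = RtoC 1).
      rewrite cexp2pi_plus, cexp2pi_opp, cexp2pi_IZR, eq_1; field. }
  apply Ceq_minus.
  replace (z - RtoC (IZR k))%C
    with (RtoC (2 * PI) * Ci * (z - RtoC (IZR k)) / (RtoC (2 * PI) * Ci))%C
    by (field; split; [apply Ci_nz | apply RtoC_neq_0; lra]).
  rewrite diff_0; unfold Cdiv; ring.
Qed.

Lemma Cmod_cexp2pi_half_minus_1_ge (k : Z) (y : R) : 1 <= Cmod (cexp2pi ((IZR k + / 2)%R, y) - 1).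
Proof.
  replace (cexp2pi ((IZR k + / 2)%R, y)) with (- RtoC (exp (- (2 * PI * y))))%C.
  - rewrite <- RtoC_opp, <- RtoC_minus, Cmod_R, Rabs_left1; pose proof (exp_pos (- (2 * PI * y))); lra.
  - replace (((IZR k + / 2)%R, y) : C) with (RtoC (IZR k) + ((/ 2)%R, y))%C
      by (apply injective_projections; simpl; ring).
    rewrite cexp2pi_plus, cexp2pi_IZR, Cmult_1_l; unfold cexp2pi, cexp; simpl.
    replace ((2 * PI * 0 - 0 * 1) * / 2 - (2 * PI * 1 + 0 * 0) * y) with (- (2 * PI * y)) by ring.
    replace ((2 * PI * 0 - 0 * 1) * y + (2 * PI * 1 + 0 * 0) * / 2) with PI by field.
    rewrite cos_PI, sin_PI; apply injective_projections; simpl; ring.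
Qed.

Lemma is_Cderive_cexp2pi (z : C) : is_Cderive cexp2pi z (RtoC (2 * PI) * Ci * cexp2pi z)%C.
Proof. apply is_Cderive_cexp_linear. Qed.

Definition theta_term (x : R) (n : nat) : R := exp (- (PI * x * (INR (S n) * INR (S n)))).

Definition theta_tail (x : R) : R := Series (theta_term x).

Definition jacobi_theta (x : R) : R := 1 + 2 * theta_tail x.

Lemma PI_mult_pos (x : R) : 0 < x -> 0 < PI * x.
Proof. intros x_pos; apply Rmult_lt_0_compat; [apply PI_RGT_0 | exact x_pos]. Qed.

Lemma theta_term_le (x : R) (n : nat) : 0 < x -> theta_term x n <= exp (- (PI * x)) ^ S n.
Proof.
  intros x_pos; assert (PIx_pos := PI_mult_pos x x_pos).
  unfold theta_term; rewrite exp_pow; apply exp_le.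
  assert (1 <= INR (S n)) by (apply (le_INR 1); lia).
  assert (0 <= PI * x * (INR (S n) * INR (S n) - INR (S n))) by (apply Rmult_le_pos; nra); lra.
Qed.

Lemma is_series_geom_S (q : R) : Rabs q < 1 -> is_series (fun n => q ^ S n) (q / (1 - q)).
Proof. intros q_small; exact (is_series_scal_l q _ _ (is_series_geom q q_small)). Qed.

Lemma is_series_theta_tail (x : R) : 0 < x -> is_series (theta_term x) (theta_tail x).
Proof.
  intros x_pos; apply Series_correct.
  apply (ex_series_le (V := R_CompleteNormedModule)) with (fun n => exp (- (PI * x)) ^ S n).
  - intros n; change (Rabs (theta_term x n) <= exp (- (PI * x)) ^ S n).
    rewrite Rabs_pos_eq by (left; apply exp_pos); now apply theta_term_le.
  - eexists; apply is_series_geom_S; rewrite Rabs_pos_eq by (left; apply exp_pos).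
    now apply exp_neg_lt_1, PI_mult_pos.
Qed.

Lemma theta_tail_bounds (x : R) : 0 < x ->
  0 <= theta_tail x <= exp (- (PI * x)) / (1 - exp (- (PI * x))).
Proof.
  intros x_pos.
  assert (geom := is_series_geom_S (exp (- (PI * x)))).
  rewrite Rabs_pos_eq in geom by (left; apply exp_pos).
  specialize (geom (exp_neg_lt_1 _ (PI_mult_pos x x_pos))).
  split.
  - replace 0 with (Series (fun _ => 0 * 0)) by (rewrite Series_scal_l; ring).
    apply Series_le; [intros n; rewrite Rmult_0_l; split; [lra | left; apply exp_pos] |].
    eexists; now apply is_series_theta_tail.
  - rewrite <- (is_series_unique _ _ geom); apply Series_le; [| eexists; exact geom].
    intros n; split; [left; apply exp_pos | now apply theta_term_le].
Qed.

Definition gauss (x : R) (z : C) : C := cexp (RtoC (- (PI * x)) * (z * z))%C.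

Definition gauss_integral (x : R) : C :=
  RInt_gen (V := C_R_CompleteNormedModule) (fun s => gauss x (s, 0))
    (Rbar_locally m_infty) (Rbar_locally p_infty).

Definition theta_quotient (x : R) (z : C) : C := (gauss x z / (cexp2pi z - 1))%C.

Lemma ex_Cderive_gauss (x : R) (z : C) : ex_Cderive (gauss x) z.
Proof.
  apply ex_Cderive_cexp, ex_Cderive_mult; [apply ex_derive_const |].
  apply ex_Cderive_mult; apply ex_derive_id.
Qed.

Lemma continuous_gauss_line (x y s : R) : Ccontinuous (fun s : R => gauss x (s, y)) s.
Proof. apply continuous_horizontal, ex_Cderive_continuous, ex_Cderive_gauss. Qed.

Lemma gauss_opp (x : R) (z : C) : gauss x (- z) = gauss x z.
Proof. unfold gauss; f_equal; ring. Qed.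

Lemma gauss_RtoC (x s : R) : gauss x (RtoC s) = RtoC (exp (- (PI * x * (s * s)))).
Proof. unfold gauss; rewrite <- !RtoC_mult, cexp_RtoC; do 2 f_equal; ring. Qed.

Lemma Cmod_gauss (x : R) (z : C) :
  Cmod (gauss x z) = exp (PI * x * (Im z * Im z)) * exp (- (PI * x * (Re z * Re z))).
Proof. unfold gauss; rewrite Cmod_cexp, <- exp_plus; f_equal; destruct z; simpl; ring. Qed.

Lemma Cmod_gauss_le (x Y : R) (z : C) : 0 < x -> Rabs (Im z) <= Y ->
  Cmod (gauss x z) <= exp (PI * x * (1 + Y * Y)) * exp (- (PI * x * Rabs (Re z))).
Proof.
  intros x_pos Im_le; assert (PIx_pos := PI_mult_pos x x_pos).
  rewrite Cmod_gauss, <- !exp_plus; apply exp_le.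
  assert (Im_sq : Im z * Im z <= Y * Y) by (apply Rabs_le_between in Im_le; nra).
  assert (Re_sq : Rabs (Re z) <= 1 + Re z * Re z).
  { pose proof (Rsqr_abs (Re z)) as Rsqr_eq; unfold Rsqr in Rsqr_eq; rewrite Rsqr_eq; nra. }
  assert (0 <= PI * x * ((Y * Y - Im z * Im z) + (1 + Re z * Re z - Rabs (Re z))))
    by (apply Rmult_le_pos; lra).
  lra.
Qed.

Lemma ex_gauss_line (x y : R) : 0 < x -> exists l, is_CInt_line (fun s => gauss x (s, y)) l.
Proof.
  intros x_pos.
  apply ex_CInt_line_exp_decay with (exp (PI * x * (1 + Rabs y * Rabs y))) (PI * x).
  - now apply PI_mult_pos.
  - intros s; apply continuous_gauss_line.
  - intros s; now apply (Cmod_gauss_le x (Rabs y) (s, y)).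
Qed.

Lemma gauss_line_translate (x c d : R) (A B : C) : 0 < x -> c <= d ->
  is_CInt_line (fun s => gauss x (s, c)) A -> is_CInt_line (fun s => gauss x (s, d)) B -> A = B.
Proof.
  intros x_pos c_le_d int_c int_d; apply Ceq_minus.
  set (Y := Rmax (Rabs c) (Rabs d)).
  assert (lim := rect_int_line_limit (gauss x) c d A B (fun n => INR n + 0)
    (fun n => exp (PI * x * (1 + Y * Y)) * exp (- (PI * x * (INR n + 0))))
    c_le_d int_c int_d (is_lim_seq_INR_plus 0)
    (is_lim_seq_exp_decay _ _ _ (PI_mult_pos x x_pos) (is_lim_seq_INR_plus 0))).
  refine (Climit_unique _ _ _ (lim _) _).
  - intros n s y s_eq y_in; split; [apply ex_Cderive_continuous, ex_Cderive_gauss |].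
    rewrite (Rabs_pos_eq (INR n + 0)) in s_eq by (pose proof (pos_INR n); lra); rewrite <- s_eq.
    apply (Cmod_gauss_le x Y (s, y)); [exact x_pos |].
    apply Rabs_le; split; unfold Y.
    + pose proof (Rle_abs (- c)) as c_le; rewrite Rabs_Ropp in c_le.
      pose proof (Rmax_l (Rabs c) (Rabs d)); simpl; lra.
    + pose proof (Rle_abs d); pose proof (Rmax_r (Rabs c) (Rabs d)); simpl; lra.
  - apply (filterlim_ext (fun _ => RtoC 0)); [| apply filterlim_const].
    intros n; symmetry; apply Cauchy_Goursat; [pose proof (pos_INR n); lra | exact c_le_d |].
    intros z _; apply ex_Cderive_gauss.
Qed.

Lemma is_CInt_line_gauss (x y : R) : 0 < x ->
  is_CInt_line (fun s => gauss x (s, y)) (gauss_integral x).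
Proof.
  intros x_pos.
  destruct (ex_gauss_line x 0 x_pos) as [l int_0]; destruct (ex_gauss_line x y x_pos) as [m int_y].
  unfold gauss_integral; rewrite (is_RInt_gen_unique (V := C_R_CompleteNormedModule) _ l int_0).
  replace l with m; [exact int_y |].
  destruct (Rle_dec 0 y); [symmetry |]; eapply (gauss_line_translate x); eauto; lra.
Qed.

Lemma gauss_integral_scale (x : R) : 0 < x -> (RtoC (sqrt x) * gauss_integral x)%C = gauss_integral 1.
Proof.
  intros x_pos; assert (sqrt_pos := sqrt_lt_R0 x x_pos).
  apply is_CInt_line_unique with (fun s => RtoC (sqrt x) * gauss x (s, 0%R))%C.
  - now apply is_CInt_line_Cmult, is_CInt_line_gauss.
  - assert (scaled := is_RInt_line_scale (V := C_R_CompleteNormedModule) (fun s => gauss 1 (s, 0)) (sqrt x)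
      _ sqrt_pos (continuous_gauss_line 1 0) (is_CInt_line_gauss 1 0 Rlt_0_1)).
    revert scaled; apply is_CInt_line_ext; intros s; rewrite scal_R_Cmult; f_equal.
    change (gauss 1 (RtoC (sqrt x * s)) = gauss x (RtoC s)); rewrite !gauss_RtoC.
    do 3 f_equal; rewrite <- (sqrt_sqrt x) at 3 by lra; ring.
Qed.

Lemma two_PI_neq_0 : RtoC (2 * PI) <> RtoC 0.
Proof. apply RtoC_neq_0; pose proof PI_RGT_0; lra. Qed.

Lemma two_PI_Ci_neq_0 : (RtoC (2 * PI) * Ci)%C <> RtoC 0.
Proof. apply Cmult_neq_0; [apply two_PI_neq_0 | apply Ci_nz]. Qed.

Lemma ex_Cderive_theta_quotient (x : R) (z : C) :
  cexp2pi z <> RtoC 1 -> ex_Cderive (theta_quotient x) z.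
Proof.
  intros neq_1; apply ex_Cderive_div; [apply ex_Cderive_gauss | | now apply Cminus_eq_contra].
  apply ex_Cderive_minus; [| apply ex_derive_const].
  eexists; apply is_Cderive_cexp2pi.
Qed.

Lemma is_simple_pole_theta_quotient (x : R) (k : Z) :
  is_simple_pole (theta_quotient x) (RtoC (IZR k)) (gauss x (RtoC (IZR k)) / (RtoC (2 * PI) * Ci))%C.
Proof.
  apply (is_simple_pole_div (gauss x) (fun z => cexp2pi z - 1)%C).
  - apply ex_Cderive_continuous, ex_Cderive_gauss.
  - replace (RtoC (2 * PI) * Ci)%C with (RtoC (2 * PI) * Ci * cexp2pi (RtoC (IZR k)) - 0)%C
      by (rewrite cexp2pi_IZR; ring).
    apply (is_derive_minus (V := AbsRing_NormedModule C_AbsRing) cexp2pi (fun _ => RtoC 1));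
      [apply is_Cderive_cexp2pi | apply (is_derive_const (V := AbsRing_NormedModule C_AbsRing))].
  - rewrite cexp2pi_IZR; ring.
  - apply two_PI_Ci_neq_0.
Qed.

Lemma rect_int_theta_quotient_unit (x : R) (k : Z) :
  rect_int (theta_quotient x) (IZR k - / 2) (IZR k + / 2) (-1) 1 = gauss x (RtoC (IZR k)).
Proof.
  rewrite (residue_theorem _ (RtoC (IZR k)) (gauss x (RtoC (IZR k)) / (RtoC (2 * PI) * Ci))%C);
    [field; split; [apply Ci_nz | apply two_PI_neq_0] | simpl; lra | simpl; lra
    | apply is_simple_pole_theta_quotient |].
  intros z [Re_in _] z_neq; apply ex_Cderive_theta_quotient.
  intros eq_1; now apply z_neq, cexp2pi_eq_1.
Qed.

Lemma cexp2pi_horizontal_neq_1 (s y : R) : y <> 0 -> cexp2pi (s, y) <> RtoC 1.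
Proof.
  intros y_neq_0 eq_1; apply (f_equal Cmod) in eq_1; pose proof PI_RGT_0.
  rewrite Cmod_cexp2pi, Cmod_1, <- exp_0 in eq_1; apply exp_inv in eq_1; simpl in eq_1; nra.
Qed.

Lemma continuous_theta_quotient_line (x y s : R) : y <> 0 ->
  Ccontinuous (fun s : R => theta_quotient x (s, y)) s.
Proof.
  intros y_neq_0.
  now apply continuous_horizontal, ex_Cderive_continuous, ex_Cderive_theta_quotient, cexp2pi_horizontal_neq_1.
Qed.

Lemma rect_int_theta_quotient_step (x : R) (n : nat) :
  rect_int (theta_quotient x) (- (INR (S n) + / 2)) (INR (S n) + / 2) (-1) 1 =
  (rect_int (theta_quotient x) (- (INR n + / 2)) (INR n + / 2) (-1) 1 + RtoC (2 * theta_term x n))%C.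
Proof.
  assert (n_nonneg := pos_INR n); assert (S_n := S_INR n).
  assert (horizontal : forall a b y, y <> 0 -> ex_CInt (fun s => theta_quotient x (s, y)) a b).
  { intros a b y y_neq_0; apply ex_CInt_continuous; intros s _.
    now apply continuous_theta_quotient_line. }
  rewrite (rect_int_split_Re _ _ (- (INR n + / 2)) (INR (S n) + / 2)) by (try apply horizontal; lra).
  rewrite (rect_int_split_Re _ (- (INR n + / 2)) (INR n + / 2)) by (try apply horizontal; lra).
  assert (right := rect_int_theta_quotient_unit x (Z.of_nat (S n))).
  assert (left := rect_int_theta_quotient_unit x (- Z.of_nat (S n))).
  rewrite opp_IZR, RtoC_opp, gauss_opp in left.
  rewrite <- INR_IZR_INZ, gauss_RtoC in left, right.
  replace (- INR (S n) - / 2) with (- (INR (S n) + / 2)) in left by lra.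
  replace (- INR (S n) + / 2) with (- (INR n + / 2)) in left by lra.
  replace (INR (S n) - / 2) with (INR n + / 2) in right by lra.
  rewrite left, right, RtoC_mult; fold (theta_term x n); ring.
Qed.

Lemma rect_int_theta_quotient (x : R) (n : nat) :
  rect_int (theta_quotient x) (- (INR (S n) + / 2)) (INR (S n) + / 2) (-1) 1 =
  RtoC (1 + 2 * sum_n (theta_term x) n).
Proof.
  induction n as [| n IH]; rewrite rect_int_theta_quotient_step.
  - assert (center := rect_int_theta_quotient_unit x 0); rewrite gauss_RtoC in center.
    replace (- (PI * x * (0 * 0))) with 0 in center by ring; rewrite exp_0 in center.
    replace (- (INR 0 + / 2)) with (0 - / 2) by (simpl; ring); change (INR 0) with 0.
    rewrite center, sum_O, RtoC_plus; ring.
  - rewrite IH, sum_Sn, <- RtoC_plus; f_equal; unfold plus; simpl; ring.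
Qed.

Lemma theta_quotient_opp (x : R) (z : C) : cexp2pi z <> RtoC 1 ->
  theta_quotient x (- z) = (- gauss x z - theta_quotient x z)%C.
Proof.
  intros neq_1; unfold theta_quotient; rewrite gauss_opp, cexp2pi_opp.
  assert (cexp2pi_neq_0 : cexp2pi z <> RtoC 0) by apply cexp_neq_0.
  assert (minus_1 := Cminus_eq_contra _ _ neq_1).
  assert (one_minus := Cminus_eq_contra _ _ (not_eq_sym neq_1)).
  field; repeat split; trivial.
Qed.

Lemma Cmod_theta_quotient_le (x : R) (z : C) :
  1 <= Cmod (cexp2pi z - 1) -> Cmod (theta_quotient x z) <= Cmod (gauss x z).
Proof.
  intros ge_1; unfold theta_quotient.
  rewrite Cmod_div by (apply Cmod_gt_0; lra).
  apply Rle_div_l; [lra |]; pose proof (Cmod_ge_0 (gauss x z)); nra.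
Qed.

Lemma Cmod_cexp2pi_bottom_minus_1_ge (s : R) : 1 <= Cmod (cexp2pi (s, -1) - 1).
Proof.
  eapply Rle_trans; [| apply Cmod_minus_ge]; rewrite Cmod_cexp2pi, Cmod_1; simpl.
  pose proof (exp_ineq1_le (- (2 * PI * -1))); pose proof PI2_1; lra.
Qed.

Lemma ex_theta_quotient_bottom (x : R) : 0 < x ->
  exists l, is_CInt_line (fun s => theta_quotient x (s, -1)) l.
Proof.
  intros x_pos.
  apply ex_CInt_line_exp_decay with (exp (PI * x * (1 + 1 * 1))) (PI * x).
  - now apply PI_mult_pos.
  - intros s; apply continuous_theta_quotient_line; lra.
  - intros s; eapply Rle_trans; [apply Cmod_theta_quotient_le, Cmod_cexp2pi_bottom_minus_1_ge |].
    apply (Cmod_gauss_le x 1 (s, -1)); [exact x_pos | simpl; rewrite Rabs_left; lra].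
Qed.

Lemma theta_quotient_top (x : R) (l : C) : 0 < x ->
  is_CInt_line (fun s => theta_quotient x (s, -1)) l ->
  is_CInt_line (fun s => theta_quotient x (s, 1)) (- gauss_integral x - l)%C.
Proof.
  intros x_pos int_bottom.
  apply (is_CInt_line_ext (fun s => (- RtoC 1) * gauss x (- s, -1)%R - theta_quotient x (- s, -1)%R)%C).
  - intros s; replace ((s, 1) : C) with (- (- s, -1)%R)%C by (apply injective_projections; simpl; ring).
    rewrite theta_quotient_opp by (apply cexp2pi_horizontal_neq_1; lra); ring.
  - replace (- gauss_integral x - l)%C with ((- RtoC 1) * gauss_integral x - l)%C by ring.
    apply is_CInt_line_minus; [apply is_CInt_line_Cmult |].
    + apply (is_CInt_line_opp (fun s => gauss x (s, -1))); [apply continuous_gauss_line |].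
      now apply is_CInt_line_gauss.
    + apply (is_CInt_line_opp (fun s => theta_quotient x (s, -1))); [| exact int_bottom].
      intros s; apply continuous_theta_quotient_line; lra.
Qed.

Lemma Cmod_cexp2pi_half_integer_minus_1_ge (n : nat) (s y : R) :
  Rabs s = INR n + / 2 -> 1 <= Cmod (cexp2pi (s, y) - 1).
Proof.
  intros s_eq; destruct (Rle_dec 0 s) as [s_pos | s_neg].
  - rewrite Rabs_pos_eq in s_eq by trivial.
    replace s with (IZR (Z.of_nat n) + / 2) by (rewrite <- INR_IZR_INZ; lra).
    apply Cmod_cexp2pi_half_minus_1_ge.
  - rewrite Rabs_left in s_eq by lra.
    replace s with (IZR (- Z.of_nat (S n)) + / 2) by (rewrite opp_IZR, <- INR_IZR_INZ, S_INR; lra).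
    apply Cmod_cexp2pi_half_minus_1_ge.
Qed.

Lemma jacobi_theta_residues (x : R) (l : C) : 0 < x ->
  is_CInt_line (fun s => theta_quotient x (s, -1)) l ->
  RtoC (jacobi_theta x) = (gauss_integral x + 2 * l)%C.
Proof.
  intros x_pos int_bottom.
  replace (gauss_integral x + 2 * l)%C with (l - (- gauss_integral x - l))%C by ring.
  assert (T_lim := is_lim_seq_INR_plus (3 / 2)).
  apply (Climit_unique (F := eventually) (fun n => RtoC (1 + 2 * sum_n (theta_term x) n))).
  - apply filterlim_RtoC, (is_lim_seq_plus' _ _ 1 (2 * theta_tail x)); [apply is_lim_seq_const |].
    apply (is_lim_seq_scal_l _ 2 (theta_tail x)); now apply is_series_theta_tail.
  - apply (filterlim_ext (fun n => rect_int (theta_quotient x) (- (INR n + 3 / 2)) (INR n + 3 / 2) (-1) 1)).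
    { intros n; rewrite <- rect_int_theta_quotient, S_INR; f_equal; lra. }
    apply (rect_int_line_limit _ _ _ _ _ (fun n => INR n + 3 / 2)
             (fun n => exp (PI * x * (1 + 1 * 1)) * exp (- (PI * x * (INR n + 3 / 2))))); trivial; [lra | | |].
    + now apply theta_quotient_top.
    + exact (is_lim_seq_exp_decay _ _ _ (PI_mult_pos x x_pos) T_lim).
    + intros n s y s_eq y_in; rewrite (Rabs_pos_eq (INR n + 3 / 2)) in s_eq by (pose proof (pos_INR n); lra).
      assert (ge_1 : 1 <= Cmod (cexp2pi (s, y) - 1)).
      { apply (Cmod_cexp2pi_half_integer_minus_1_ge (S n)); rewrite S_INR; lra. }
      split.
      * apply ex_Cderive_continuous, ex_Cderive_theta_quotient; intros eq_1.
        rewrite eq_1 in ge_1; replace (1 - 1)%C with (RtoC 0) in ge_1 by ring; rewrite Cmod_0 in ge_1; lra.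
      * eapply Rle_trans; [now apply Cmod_theta_quotient_le |]; rewrite <- s_eq.
        apply (Cmod_gauss_le x 1 (s, y)); [exact x_pos | apply Rabs_le; exact y_in].
Qed.

Lemma Cinv_minus_1_geometric (w : C) (n : nat) : w <> RtoC 0 -> (w - 1)%C <> RtoC 0 ->
  (/ (w - 1) = Csum_n (fun k => (/ w) ^ S k) n + (/ w) ^ S n / (w - 1))%C.
Proof.
  intros w_neq_0 w_neq_1; induction n as [| n IH].
  - rewrite sum_O; simpl; field; now split.
  - rewrite Csum_n_S, IH at 1; simpl; field; now split.
Qed.

(* Completing the square: [-pi x z^2 - 2 pi i m z = -pi x (z + i m / x)^2 - pi m^2 / x]. *)
Lemma gauss_mult_cexp2pi_inv_pow (x s y : R) (k : nat) : 0 < x ->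
  (gauss x (s, y) * (/ cexp2pi (s, y)) ^ S k)%C =
  (RtoC (theta_term (/ x) k) * gauss x (s, (y + INR (S k) / x)%R))%C.
Proof.
  intros x_pos; rewrite <- cexp2pi_opp; unfold cexp2pi.
  rewrite <- cexp_INR_mult; unfold gauss, theta_term; rewrite <- cexp_RtoC, <- !cexp_plus; f_equal.
  apply injective_projections; simpl; field; lra.
Qed.

Lemma theta_quotient_expansion (x s : R) (n : nat) : 0 < x ->
  (theta_quotient x (s, -1) -
   Csum_n (fun k => RtoC (theta_term (/ x) k) * gauss x (s, (-1 + INR (S k) / x)%R)) n)%C =
  ((/ cexp2pi (s, -1)) ^ S n * theta_quotient x (s, -1))%C.
Proof.
  intros x_pos; unfold theta_quotient.
  assert (minus_1_neq_0 := Cminus_eq_contra _ _ (cexp2pi_horizontal_neq_1 s (-1) ltac:(lra))).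
  assert (w_neq_0 : cexp2pi (s, -1) <> RtoC 0) by apply cexp_neq_0.
  assert (sum_eq : Csum_n (fun k => RtoC (theta_term (/ x) k) * gauss x (s, (-1 + INR (S k) / x)%R))%C n =
    (gauss x (s, -1) * Csum_n (fun k => (/ cexp2pi (s, -1)) ^ S k)%C n)%C).
  { rewrite <- Csum_n_Cmult_l; apply Csum_n_ext; intros k; symmetry; now apply gauss_mult_cexp2pi_inv_pow. }
  rewrite sum_eq; unfold Cdiv.
  rewrite (Cinv_minus_1_geometric (cexp2pi (s, -1)) n w_neq_0 minus_1_neq_0) at 1; unfold Cdiv; ring.
Qed.

Lemma is_RInt_line_gauss (x : R) : 0 < x ->
  is_RInt_gen (fun s => exp (- (PI * x * (s * s)))) (Rbar_locally m_infty) (Rbar_locally p_infty)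
    (Re (gauss_integral x)).
Proof.
  intros x_pos.
  assert (Re_int := is_RInt_line_Re _ _ (is_CInt_line_gauss x 0 x_pos)).
  revert Re_int; apply (is_RInt_gen_ext (V := R_NormedModule)); apply filter_forall; intros ab s _.
  change (Re (gauss x (RtoC s)) = exp (- (PI * x * (s * s)))); now rewrite gauss_RtoC.
Qed.

Lemma theta_quotient_bottom_series (x : R) (l : C) (n : nat) : 0 < x ->
  is_CInt_line (fun s => theta_quotient x (s, -1)) l ->
  Cmod (RtoC (sum_n (theta_term (/ x)) n) * gauss_integral x - l) <=
  exp (PI * x) * Re (gauss_integral x) * exp (- (2 * PI * INR (S n))).
Proof.
  intros x_pos int_bottom.
  assert (int_sum : is_CInt_line
    (fun s => Csum_n (fun k => RtoC (theta_term (/ x) k) * gauss x (s, (-1 + INR (S k) / x)%R))%C n)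
    (RtoC (sum_n (theta_term (/ x)) n) * gauss_integral x)%C).
  { rewrite Cmult_comm, <- Csum_n_RtoC, <- Csum_n_Cmult_l.
    apply (is_CInt_line_sum_n (fun k s => RtoC (theta_term (/ x) k) * gauss x (s, (-1 + INR (S k) / x)%R))%C).
    intros k; rewrite Cmult_comm; now apply is_CInt_line_Cmult, is_CInt_line_gauss. }
  rewrite Cmod_minus_sym.
  apply (is_CInt_line_Cmod_le _ (fun s => exp (- (2 * PI * INR (S n))) * exp (PI * x) * exp (- (PI * x * (s * s))))
           _ _) with (2 := is_CInt_line_minus _ _ _ _ int_bottom int_sum).
  - intros s; rewrite theta_quotient_expansion by trivial.
    rewrite Cmod_mult, Cmod_pow, Cmod_inv, Cmod_cexp2pi by apply cexp_neq_0.
    rewrite (Rmult_assoc (exp (- (2 * PI * INR (S n))))).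
    apply Rmult_le_compat; [apply pow_le; left; apply Rinv_0_lt_compat, exp_pos | apply Cmod_ge_0 | |].
    + rewrite <- exp_Ropp, exp_pow; right; f_equal; simpl Im; ring.
    + eapply Rle_trans; [apply Cmod_theta_quotient_le, Cmod_cexp2pi_bottom_minus_1_ge |].
      rewrite Cmod_gauss; simpl; right; f_equal; f_equal; ring.
  - replace (exp (PI * x) * Re (gauss_integral x) * exp (- (2 * PI * INR (S n))))
      with (exp (- (2 * PI * INR (S n))) * exp (PI * x) * Re (gauss_integral x)) by ring.
    exact (is_RInt_gen_scal (V := R_NormedModule) _ _ _ (is_RInt_line_gauss x x_pos)).
Qed.

Lemma jacobi_theta_inv (x : R) : 0 < x ->
  RtoC (jacobi_theta x) = (gauss_integral x * RtoC (jacobi_theta (/ x)))%C.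
Proof.
  intros x_pos; destruct (ex_theta_quotient_bottom x x_pos) as [l int_bottom].
  assert (l_eq : l = (RtoC (theta_tail (/ x)) * gauss_integral x)%C).
  { apply (Climit_unique (F := eventually) (fun n => RtoC (sum_n (theta_term (/ x)) n) * gauss_integral x)%C).
    - apply filterlim_Cmod_0 with
        (fun n => exp (PI * x) * Re (gauss_integral x) * exp (- (2 * PI * (INR n + 1)))).
      + apply filter_forall; intros n; rewrite <- S_INR; now apply theta_quotient_bottom_series.
      + apply is_lim_seq_exp_decay; [pose proof PI_RGT_0; lra | apply is_lim_seq_INR_plus].
    - apply filterlim_Cmult; [| apply filterlim_const].
      now apply filterlim_RtoC, is_series_theta_tail, Rinv_0_lt_compat. }
  rewrite (jacobi_theta_residues x l x_pos int_bottom), l_eq; unfold jacobi_theta.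
  rewrite RtoC_plus, RtoC_mult; ring.
Qed.

Lemma gauss_integral_1 : gauss_integral 1 = RtoC 1.
Proof.
  assert (theta_1 := jacobi_theta_inv 1 Rlt_0_1); rewrite Rinv_1 in theta_1.
  assert (theta_neq_0 : RtoC (jacobi_theta 1) <> RtoC 0).
  { apply RtoC_neq_0; unfold jacobi_theta; pose proof (theta_tail_bounds 1 Rlt_0_1); lra. }
  replace (gauss_integral 1) with (gauss_integral 1 * RtoC (jacobi_theta 1) / RtoC (jacobi_theta 1))%C
    by (field; exact theta_neq_0).
  rewrite <- theta_1; field; exact theta_neq_0.
Qed.

Theorem jacobi_theta_modular (x : R) : 0 < x -> sqrt x * jacobi_theta x = jacobi_theta (/ x).
Proof.
  intros x_pos; apply RtoC_inj.
  rewrite RtoC_mult, jacobi_theta_inv, Cmult_assoc, gauss_integral_scale, gauss_integral_1 by trivial; ring.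
Qed.

Lemma theta_tail_remainder_le (x t : R) (n : nat) : 0 < x <= t ->
  Rabs (theta_tail t - sum_n (theta_term t) n) <=
  exp (- (PI * x)) ^ S (S n) / (1 - exp (- (PI * x))).
Proof.
  intros [x_pos x_le_t]; assert (PI_pos := PI_RGT_0).
  set (q := exp (- (PI * x))).
  assert (q_pos : 0 < q) by apply exp_pos.
  assert (q_lt_1 : q < 1) by now apply exp_neg_lt_1, PI_mult_pos.
  apply (telescoping_series_remainder_le (V := R_NormedModule) (theta_term t) (fun k => q ^ S k / (1 - q))).
  - intros k; change (Rabs (theta_term t k) <= q ^ S k / (1 - q) - q ^ S (S k) / (1 - q)).
    replace (q ^ S k / (1 - q) - q ^ S (S k) / (1 - q)) with (q ^ S k) by (simpl; field; lra).
    rewrite Rabs_pos_eq by (left; apply exp_pos).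
    eapply Rle_trans; [apply theta_term_le; lra |].
    apply pow_incr; split; [left; apply exp_pos | apply exp_le; nra].
  - apply (is_lim_seq_ext (fun k => q / (1 - q) * q ^ k)); [intros k; simpl; field; lra |].
    rewrite <- (Rmult_0_r (q / (1 - q))); apply (is_lim_seq_scal_l _ _ 0).
    apply is_lim_seq_geom; rewrite Rabs_pos_eq; lra.
  - apply is_series_theta_tail; lra.
Qed.

Lemma continuous_theta_tail (x : R) : 0 < x -> continuous theta_tail x.
Proof.
  intros x_pos; apply continuous_uniform_limit with (fun n t => sum_n (theta_term t) n).
  - intros n; induction n as [| n IH].
    + apply (continuous_ext (fun t => theta_term t 0)); [intros t; now rewrite sum_O |].
      apply (ex_derive_continuous (V := R_NormedModule)); unfold theta_term; auto_derive; auto.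
    + apply (continuous_ext (fun t => sum_n (theta_term t) n + theta_term t (S n)));
        [intros t; now rewrite sum_Sn |].
      apply (continuous_plus (V := R_NormedModule)); [exact IH |].
      apply (ex_derive_continuous (V := R_NormedModule)); unfold theta_term; auto_derive; auto.
  - intros eps; set (q := exp (- (PI * (x / 2)))).
    assert (q_lt_1 : q < 1) by (apply exp_neg_lt_1, PI_mult_pos; lra).
    assert (q_pos : 0 < q) by apply exp_pos.
    destruct (pow_lt_1_zero q) with (y := eps * (1 - q)) as [N small].
    + rewrite Rabs_pos_eq; lra.
    + pose proof (cond_pos eps); apply Rmult_lt_0_compat; lra.
    + exists N; exists (mkposreal (x / 2) ltac:(lra)); intros t close.
      change (Rabs (t - x) < x / 2) in close; apply Rabs_lt_between in close.
      change (Rabs (sum_n (theta_term t) N - theta_tail t) < eps); rewrite Rabs_minus_sym.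
      eapply Rle_lt_trans; [apply (theta_tail_remainder_le (x / 2)); lra |]; fold q.
      apply Rlt_div_l; [lra |]; specialize (small (S (S N)) ltac:(lia)).
      now rewrite Rabs_pos_eq in small by (apply pow_le; lra).
Qed.

Definition alternating_theta (x : R) : R := theta_tail x - 2 * theta_tail (4 * x).

Lemma theta_term_4 (x : R) (n : nat) : theta_term (4 * x) n = theta_term x (S (2 * n)).
Proof. unfold theta_term; f_equal; rewrite !S_INR, mult_INR; simpl; ring. Qed.

Lemma is_lim_seq_theta_term (x : R) : 0 < x -> is_lim_seq (theta_term x) 0.
Proof. intros x_pos; apply ex_series_lim_0; eexists; now apply is_series_theta_tail. Qed.

Lemma is_series_alternating_theta (x : R) : 0 < x ->
  is_series (fun k => (-1) ^ k * theta_term x k) (alternating_theta x).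
Proof.
  intros x_pos; apply (is_series_of_pairs (V := R_NormedModule)).
  - apply (is_lim_seq_abs_0 (fun k => (-1) ^ k * theta_term x k)).
    apply (is_lim_seq_ext (theta_term x)); [| now apply is_lim_seq_theta_term].
    intros n; rewrite Rabs_mult, pow_1_abs, Rmult_1_l; symmetry; apply Rabs_pos_eq; left; apply exp_pos.
  - assert (pairs := is_series_pairs (V := R_NormedModule) _ _ (is_series_theta_tail x x_pos)).
    assert (odd := is_series_scal_l (-2) _ _ (is_series_theta_tail (4 * x) ltac:(lra))).
    replace (alternating_theta x) with (theta_tail x + -2 * theta_tail (4 * x))
      by (unfold alternating_theta; ring).
    generalize (is_series_plus (V := R_NormedModule) _ _ _ _ pairs odd); apply is_series_ext; intros m.
    rewrite pow_1_even, pow_1_odd, theta_term_4; unfold scal, mult; simpl; unfold mult, plus; simpl; ring.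
Qed.

Lemma alternating_theta_remainder_le (x : R) (n : nat) : 0 < x ->
  Rabs (alternating_theta x - sum_n (fun k => (-1) ^ k * theta_term x k) n) <= theta_term x (S n).
Proof.
  intros x_pos; apply alternating_series_remainder_le.
  - intros k; unfold theta_term; apply exp_le, Ropp_le_contravar.
    assert (PIx_pos := PI_mult_pos x x_pos); pose proof (pos_INR k); rewrite !S_INR.
    apply Rmult_le_compat_l; nra.
  - now apply is_lim_seq_theta_term.
  - now apply is_series_alternating_theta.
Qed.

(* [/ (2 * sqrt x)] is the asymptotic value of [theta_tail x] at [0]; once it is removed,
   the Mellin transform converges exactly in the critical strip. *)
Definition theta_reg (x : R) : R := theta_tail x - / (2 * sqrt x).

Lemma theta_reg_inv (x : R) : 0 < x -> theta_reg (/ x) = sqrt x * theta_reg x.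
Proof.
  intros x_pos; assert (sqrt_pos := sqrt_lt_R0 x x_pos).
  assert (modular := jacobi_theta_modular x x_pos); unfold jacobi_theta in modular.
  unfold theta_reg; rewrite sqrt_inv.
  replace (/ (2 * / sqrt x)) with (sqrt x / 2) by (field; lra).
  replace (sqrt x * (theta_tail x - / (2 * sqrt x))) with (sqrt x * theta_tail x - / 2) by (field; lra); lra.
Qed.

Lemma alternating_theta_reg (x : R) : 0 < x -> alternating_theta x = theta_reg x - 2 * theta_reg (4 * x).
Proof.
  intros x_pos; assert (sqrt_pos := sqrt_lt_R0 x x_pos).
  assert (sqrt_4 : sqrt 4 = 2) by (replace 4 with (2 * 2) by ring; apply sqrt_square; lra).
  unfold alternating_theta, theta_reg; rewrite sqrt_mult, sqrt_4 by lra; field; lra.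
Qed.

Lemma theta_tail_le_inv_sqrt (x : R) : 1 <= x -> theta_tail x <= / sqrt x.
Proof.
  intros x_ge_1; assert (PI_ge_2 := PI2_1).
  assert (PIx_pos := PI_mult_pos x ltac:(lra)).
  eapply Rle_trans; [apply theta_tail_bounds; lra |].
  assert (exp_gt := exp_ineq1 (PI * x) ltac:(lra)).
  replace (exp (- (PI * x)) / (1 - exp (- (PI * x)))) with (/ (exp (PI * x) - 1))
    by (rewrite exp_Ropp; field; lra).
  apply Rinv_le_contravar; [apply sqrt_lt_R0; lra |].
  apply Rle_trans with x; [| nra].
  rewrite <- (sqrt_square x) at 2 by lra; apply sqrt_le_1; nra.
Qed.

Lemma Rabs_theta_reg_le_inv_sqrt (x : R) : 1 <= x -> Rabs (theta_reg x) <= / sqrt x.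
Proof.
  intros x_ge_1; assert (sqrt_pos := sqrt_lt_R0 x ltac:(lra)).
  pose proof (theta_tail_le_inv_sqrt x x_ge_1); pose proof (theta_tail_bounds x ltac:(lra)).
  unfold theta_reg; replace (/ (2 * sqrt x)) with (/ sqrt x / 2) by (field; lra).
  apply Rabs_le; lra.
Qed.

Lemma Rabs_theta_reg_le_1 (x : R) : 0 < x <= 1 -> Rabs (theta_reg x) <= 1.
Proof.
  intros [x_pos x_le_1].
  assert (inv_ge_1 : 1 <= / x) by (rewrite <- Rinv_1; now apply Rinv_le_contravar).
  assert (sqrt_pos := sqrt_lt_R0 (/ x) ltac:(lra)).
  rewrite <- (Rinv_inv x), theta_reg_inv, Rabs_mult, Rabs_pos_eq by lra.
  apply Rle_trans with (sqrt (/ x) * / sqrt (/ x)); [| right; field; lra].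
  apply Rmult_le_compat_l; [lra | now apply Rabs_theta_reg_le_inv_sqrt].
Qed.

Lemma continuous_theta_reg (x : R) : 0 < x -> continuous theta_reg x.
Proof.
  intros x_pos; assert (sqrt_pos := sqrt_lt_R0 x x_pos).
  apply (continuous_minus (V := R_NormedModule) theta_tail (fun t => / (2 * sqrt t)));
    [now apply continuous_theta_tail |].
  apply (ex_derive_continuous (V := R_NormedModule)); auto_derive; repeat split; trivial; lra.
Qed.

(** * The eta and zeta functions on the critical strip *)

Lemma ln_INR_S_nonneg (n : nat) : 0 <= ln (INR (S n)).
Proof. rewrite <- ln_1; apply ln_le; [lra |]; rewrite S_INR; pose proof (pos_INR n); lra. Qed.

Lemma ln_INR_S_le (m n : nat) : (m <= n)%nat -> ln (INR (S m)) <= ln (INR (S n)).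
Proof. intros m_le_n; apply ln_le; [apply lt_0_INR; lia | apply le_INR; lia]. Qed.

Lemma is_lim_seq_ln_INR_S : is_lim_seq (fun n => ln (INR (S n))) p_infty.
Proof.
  apply (is_lim_seq_incr_1 (fun n => ln (INR n))).
  exact (filterlim_comp _ _ _ _ _ _ _ _ is_lim_seq_INR is_lim_ln_p).
Qed.

Definition eta_term (s : C) (n : nat) : C := (RtoC ((-1) ^ n) * Rcpow (INR (S n)) (- s))%C.

Definition eta_partial (n : nat) (s : C) : C := Csum_n (eta_term s) (S (2 * n)).

Definition eta_pair (s : C) (m : nat) : C := (eta_term s (2 * m) + eta_term s (S (2 * m)))%C.

Definition eta_majorant (s : C) (d : R) (m : nat) : R := Cmod s / d * exp (- (d * ln (INR (S (2 * m))))).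

Lemma Cmod_eta_term (s : C) (n : nat) : Cmod (eta_term s n) = exp (- (Re s * ln (INR (S n)))).
Proof.
  unfold eta_term; rewrite Cmod_mult, Cmod_R, pow_1_abs, Rmult_1_l, Cmod_Rcpow; f_equal.
  change (Re (- s)) with (- Re s); ring.
Qed.

Lemma eta_pair_eq (s : C) (m : nat) :
  eta_pair s m = (Rcpow (INR (S (2 * m))) (- s) - Rcpow (INR (S (S (2 * m)))) (- s))%C.
Proof.
  unfold eta_pair, eta_term; rewrite pow_1_even, pow_1_odd.
  change (RtoC (-1)) with (RtoC (Ropp 1)); rewrite RtoC_opp; ring.
Qed.

Lemma Cmod_eta_pair_le (s : C) (d : R) (m : nat) : 0 < d <= Re s ->
  Cmod (eta_pair s m) <= eta_majorant s d m - eta_majorant s d (S m).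
Proof.
  intros d_bounds.
  assert (ln_step := ln_INR_S_le (2 * m) (S (2 * m)) ltac:(lia)).
  rewrite eta_pair_eq, Cmod_minus_sym; unfold Rcpow.
  (* The pair is the integral of [s e^(-s v)] between two consecutive logarithms. *)
  eapply Rle_trans.
  - apply (is_CInt_Cmod_le_exp_decay _ (Cmod s) d _ _ _) with (4 := is_CInt_cexp (- s) _ _); [lra | exact ln_step |].
    intros v v_in; rewrite Cmod_mult, Cmod_opp, Cmod_cexp; apply Rmult_le_compat_l; [apply Cmod_ge_0 |].
    apply exp_le; rewrite re_scal_r; change (Re (- s)) with (- Re s); pose proof (ln_INR_S_nonneg (2 * m)); nra.
  - unfold eta_majorant; apply Rplus_le_compat_l, Ropp_le_contravar, Rmult_le_compat_l.
    + apply Rdiv_le_0_compat; [apply Cmod_ge_0 | lra].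
    + apply exp_le, Ropp_le_contravar, Rmult_le_compat_l; [lra |]; apply ln_INR_S_le; lia.
Qed.

Lemma is_lim_seq_eta_majorant (s : C) (d : R) : 0 < d -> is_lim_seq (eta_majorant s d) 0.
Proof.
  intros d_pos; apply is_lim_seq_exp_decay; [exact d_pos |].
  apply (is_lim_seq_subseq (fun n => ln (INR (S n))) _ (fun m => (2 * m)%nat)); [| apply is_lim_seq_ln_INR_S].
  apply eventually_subseq; intros m; lia.
Qed.

Lemma is_series_eta (s : C) : 0 < Re s -> is_Cseries (eta_term s) (eta s).
Proof.
  intros Re_pos.
  destruct (ex_series_le (V := C_R_CompleteNormedModule) (eta_pair s)
    (fun m => eta_majorant s (Re s) m - eta_majorant s (Re s) (S m))) as [l pairs_sum].
  - intros m; rewrite norm_C_R; apply Cmod_eta_pair_le; lra.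
  - eexists; now apply is_series_telescope, is_lim_seq_eta_majorant.
  - assert (eta_sum : is_Cseries (eta_term s) l).
    { apply is_series_of_pairs; [| exact pairs_sum].
      apply filterlim_Cmod_0 with (fun n => 1 * exp (- (Re s * ln (INR (S n))))).
      - apply filter_forall; intros n; change (zero : C_R_NormedModule) with (RtoC 0).
        replace (eta_term s n - 0)%C with (eta_term s n) by ring; rewrite Cmod_eta_term; lra.
      - apply is_lim_seq_exp_decay; [exact Re_pos | apply is_lim_seq_ln_INR_S]. }
    unfold eta; fold (eta_term s); now rewrite (CSeries_unique _ _ eta_sum).
Qed.

Lemma Cmod_eta_partial_minus_le (s : C) (d : R) (n : nat) : 0 < d <= Re s ->
  Cmod (eta_partial n s - eta s) <= eta_majorant s d (S n).
Proof.
  intros d_bounds; rewrite Cmod_minus_sym, <- norm_C_R; unfold eta_partial.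
  replace (Csum_n (eta_term s) (S (2 * n))) with (Csum_n (eta_pair s) n)
    by (symmetry; apply (sum_n_pairs (G := C_AbelianMonoid))).
  apply (telescoping_series_remainder_le (V := C_R_CompleteNormedModule) (eta_pair s) (eta_majorant s d)).
  - intros m; rewrite norm_C_R; now apply Cmod_eta_pair_le.
  - now apply is_lim_seq_eta_majorant.
  - apply (is_series_pairs (V := C_R_NormedModule)), is_series_eta; lra.
Qed.

Lemma Cmod_eta_le (s : C) (d : R) : 0 < d <= Re s -> Cmod (eta s) <= Cmod s / d.
Proof.
  intros d_bounds; rewrite <- norm_C_R.
  replace (Cmod s / d) with (eta_majorant s d 0)
    by (unfold eta_majorant; simpl; rewrite ln_1, Rmult_0_r, Ropp_0, exp_0; ring).
  apply (telescoping_series_le (V := C_R_CompleteNormedModule) (eta_pair s) (eta_majorant s d)).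
  - intros m; rewrite norm_C_R; now apply Cmod_eta_pair_le.
  - now apply is_lim_seq_eta_majorant.
  - apply (is_series_pairs (V := C_R_NormedModule)), is_series_eta; lra.
Qed.

Lemma eta_uniform_limit (D : C -> Prop) (d M : R) : 0 < d ->
  (forall s, D s -> d <= Re s /\ Cmod s <= M) -> uniform_limit_on D eta_partial eta.
Proof.
  intros d_pos D_bounds eps eps_pos.
  assert (lim := is_lim_seq_eta_majorant (RtoC M) d d_pos); apply is_lim_seq_incr_1 in lim.
  generalize (proj1 (filterlim_R_iff _ _) lim eps eps_pos); apply filter_imp; intros n small s s_in.
  destruct (D_bounds s s_in) as [Re_ge Cmod_le].
  eapply Rle_trans; [apply (Cmod_eta_partial_minus_le s d); lra |].
  apply Rle_trans with (eta_majorant (RtoC M) d (S n)).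
  - unfold eta_majorant; apply Rmult_le_compat_r; [left; apply exp_pos |].
    apply Rmult_le_compat_r; [left; now apply Rinv_0_lt_compat |].
    rewrite Cmod_R; pose proof (Rle_abs M); lra.
  - rewrite Rminus_0_r in small; pose proof (Rle_abs (eta_majorant (RtoC M) d (S n))); lra.
Qed.

Lemma ex_Cderive_eta_partial (n : nat) (s : C) : ex_Cderive (eta_partial n) s.
Proof.
  apply (ex_Cderive_Csum_n (fun k w => eta_term w k)); intros k.
  apply ex_Cderive_mult; [apply ex_derive_const |].
  apply ex_Cderive_Rcpow, ex_Cderive_opp, ex_derive_id.
Qed.

Lemma continuous_eta (s : C) : 0 < Re s -> Ccontinuous eta s.
Proof.
  intros Re_pos.
  apply continuous_uniform_limit_on with (fun w => Cmod (w - s) < Re s / 2) eta_partial.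
  - apply locally_C_iff; exists (Re s / 2); split; [lra | trivial].
  - intros n; apply ex_Cderive_continuous, ex_Cderive_eta_partial.
  - apply eta_uniform_limit with (Re s / 2) (Cmod s + Re s / 2); [lra |]; intros w close.
    split.
    + pose proof (re_le_Cmod (w - s)) as Re_close; change (Rabs (Re w - Re s) <= Cmod (w - s)) in Re_close.
      assert (near : Rabs (Re w - Re s) < Re s / 2) by lra; apply Rabs_lt_between in near; lra.
    + pose proof (Cmod_triangle s (w - s)) as triangle.
      replace (s + (w - s))%C with w in triangle by ring; lra.
Qed.

Lemma Cmod_zeta_denominator_ge (s : C) (d : R) : Re s <= 1 - d ->
  exp (d * ln 2) - 1 <= Cmod (1 - Rcpow 2 (1 - s)).
Proof.
  intros Re_le; rewrite Cmod_minus_sym.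
  eapply Rle_trans; [| apply Cmod_minus_ge]; rewrite Cmod_1, Cmod_Rcpow.
  apply Rplus_le_compat_r, exp_le, Rmult_le_compat_r; [left; rewrite <- ln_1; apply ln_increasing; lra |].
  destruct s; simpl in *; lra.
Qed.

Lemma exp_mult_ln2_minus_1_pos (d : R) : 0 < d -> 0 < exp (d * ln 2) - 1.
Proof.
  intros d_pos.
  assert (0 < d * ln 2) by (apply Rmult_lt_0_compat; [trivial | rewrite <- ln_1; apply ln_increasing; lra]).
  pose proof (exp_ineq1 (d * ln 2) ltac:(lra)); lra.
Qed.

Lemma zeta_denominator_neq_0 (s : C) : Re s < 1 -> (1 - Rcpow 2 (1 - s))%C <> RtoC 0.
Proof.
  intros Re_lt_1; apply Cmod_gt_0.
  eapply Rlt_le_trans; [| apply (Cmod_zeta_denominator_ge s (1 - Re s)); lra].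
  apply exp_mult_ln2_minus_1_pos; lra.
Qed.

Lemma Cmod_zeta_le (s : C) (d : R) : 0 < d <= Re s -> Re s <= 1 - d ->
  Cmod (zeta s) <= Cmod s / d / (exp (d * ln 2) - 1).
Proof.
  intros d_bounds Re_le; assert (den_pos := exp_mult_ln2_minus_1_pos d ltac:(lra)).
  unfold zeta; rewrite Cmod_div by (apply zeta_denominator_neq_0; lra).
  apply Rmult_le_compat; [apply Cmod_ge_0 | | now apply Cmod_eta_le |].
  - left; apply Rinv_0_lt_compat, Cmod_gt_0, zeta_denominator_neq_0; lra.
  - apply Rinv_le_contravar; [exact den_pos | now apply Cmod_zeta_denominator_ge].
Qed.

Lemma eta_conj (s : C) : eta (Cconj s) = Cconj (eta s).
Proof.
  assert (conj_term : forall n, eta_term (Cconj s) n = Cconj (eta_term s n)).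
  { intros n; unfold eta_term; now rewrite Cmult_conj, Cconj_RtoC, <- Rcpow_conj, Copp_conj. }
  transitivity (CSeries (fun n => Cconj (eta_term s n))).
  - apply injective_projections; apply Series_ext; intros n; exact (f_equal _ (conj_term n)).
  - apply injective_projections; [reflexivity | apply Series_opp].
Qed.

Lemma zeta_conj (s : C) : Re s < 1 -> zeta (Cconj s) = Cconj (zeta s).
Proof.
  intros Re_lt_1; unfold zeta; rewrite Cdiv_conj by now apply zeta_denominator_neq_0.
  now rewrite eta_conj, Cminus_conj, <- Rcpow_conj, Cminus_conj, !Cconj_RtoC.
Qed.

(** * Mellin transforms and the functional equation *)

Lemma continuous_cexp_mult_RtoC (z : C) (v : R) : Ccontinuous (fun v => cexp (z * RtoC v)) v.
Proof.
  apply (continuous_horizontal (fun w => cexp (z * w)%C) v 0), ex_Cderive_continuous.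
  eexists; apply is_Cderive_cexp_linear.
Qed.

(* Euler's integrand after the substitution [u = exp v]: in the variable [v], scaling becomes
   translation and inversion becomes reflection. *)
Definition gamma_integrand (z : C) (v : R) : C := (cexp (z * RtoC v) * RtoC (exp (- exp v)))%C.

Lemma continuous_gamma_integrand (z : C) (v : R) : Ccontinuous (gamma_integrand z) v.
Proof.
  apply continuous_Cmult; [apply continuous_cexp_mult_RtoC | apply continuous_RtoC].
  apply (ex_derive_continuous (V := R_NormedModule)); auto_derive; auto.
Qed.

Lemma exp_ge_square (v : R) : 0 <= v -> v * v / 4 <= exp v.
Proof.
  intros v_nonneg; replace v with (v / 2 + v / 2) at 3 by field; rewrite exp_plus.
  pose proof (exp_ineq1_le (v / 2)); nra.
Qed.

Lemma ex_gamma_integral (z : C) : 0 < Re z -> exists l, is_CInt_line (gamma_integrand z) l.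
Proof.
  intros Re_pos.
  apply ex_CInt_line_exp_decay with (exp (4 * (Re z * Re z))) (Re z);
    [exact Re_pos | apply continuous_gamma_integrand |].
  intros v; unfold gamma_integrand.
  rewrite Cmod_mult, Cmod_cexp_mult_RtoC, Cmod_R, Rabs_pos_eq by (left; apply exp_pos).
  rewrite <- !exp_plus; apply exp_le.
  destruct (Rle_dec 0 v) as [v_nonneg | v_neg].
  - rewrite Rabs_pos_eq by trivial; pose proof (exp_ge_square v v_nonneg).
    pose proof (Rle_0_sqr (v / 2 - 2 * Re z)) as square; unfold Rsqr in square; nra.
  - rewrite Rabs_left by lra; pose proof (exp_pos v); nra.
Qed.

Lemma CGamma_of_gamma_integral (z l : C) : is_CInt_line (gamma_integrand z) l -> CGamma z = l.
Proof.
  intros int_l; unfold CGamma; apply (is_RInt_gen_unique (V := C_R_CompleteNormedModule)).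
  assert (positive : filter_prod (at_right 0) (Rbar_locally p_infty) (fun ab => 0 < fst ab /\ 0 < snd ab)).
  { apply Filter_prod with (fun a => 0 < a) (fun b => 0 < b); [| now exists 0 | now intros].
    exists (mkposreal 1 Rlt_0_1); intros a _ a_pos; exact a_pos. }
  apply (is_RInt_gen_ext (V := C_R_CompleteNormedModule)
    (fun u => scal (V := C_R_CompleteNormedModule) (/ u) (gamma_integrand z (ln u)))).
  - revert positive; apply filter_imp; intros [a b] [a_pos b_pos] u [u_gt _]; simpl in *.
    assert (u_pos : 0 < u) by (eapply Rlt_trans; [now apply (Rmin_pos a b) | exact u_gt]).
    rewrite scal_R_Cmult; unfold gamma_integrand, Rcpow; rewrite exp_ln by trivial.
    rewrite <- (exp_ln u u_pos) at 1; rewrite <- exp_Ropp, <- cexp_RtoC, Cmult_assoc, <- cexp_plus.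
    do 2 f_equal; rewrite RtoC_opp; ring.
  - refine (is_RInt_gen_comp (V := C_R_CompleteNormedModule) (gamma_integrand z) ln Rinv l
              is_lim_ln_0 is_lim_ln_p _ int_l).
    revert positive; apply filter_imp; intros [a b] [a_pos b_pos] u [u_ge _]; simpl in *.
    assert (u_pos : 0 < u) by (eapply Rlt_le_trans; [now apply (Rmin_pos a b) | exact u_ge]).
    split; [apply continuous_gamma_integrand | split; [now apply is_derive_ln |]].
    apply (ex_derive_continuous (V := R_NormedModule)); auto_derive; lra.
Qed.

Lemma is_CInt_line_gamma_integrand (z : C) : 0 < Re z -> is_CInt_line (gamma_integrand z) (CGamma z).
Proof.
  intros Re_pos; destruct (ex_gamma_integral z Re_pos) as [l int_l].
  now rewrite (CGamma_of_gamma_integral z l int_l).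
Qed.

Lemma CGamma_conj (z : C) : 0 < Re z -> CGamma (Cconj z) = Cconj (CGamma z).
Proof.
  intros Re_pos; apply CGamma_of_gamma_integral.
  apply (is_CInt_line_ext (fun v => Cconj (gamma_integrand z v))).
  - intros v; unfold gamma_integrand.
    now rewrite Cmult_conj, <- cexp_conj, Cmult_conj, !Cconj_RtoC.
  - now apply is_CInt_line_Cconj, is_CInt_line_gamma_integrand.
Qed.

Definition gamma_factor (s : C) : C := (Rcpow PI (- (s / 2)) * CGamma (s / 2))%C.

Lemma theta_term_mellin (s : C) (n : nat) : 0 < Re s ->
  is_CInt_line (fun v => RtoC (theta_term (exp v) n) * cexp (s / 2 * RtoC v))%C
    (gamma_factor s * Rcpow (INR (S n)) (- s))%C.
Proof.
  intros Re_pos; assert (n_pos : 0 < INR (S n)) by (apply lt_0_INR; lia).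
  assert (PI_pos := PI_RGT_0).
  set (w := ln PI + (ln (INR (S n)) + ln (INR (S n)))).
  assert (exp_w : exp w = PI * (INR (S n) * INR (S n))) by (unfold w; now rewrite !exp_plus, !exp_ln).
  assert (cexp_w : cexp (- (s / 2) * RtoC w) = (Rcpow PI (- (s / 2)) * Rcpow (INR (S n)) (- s))%C).
  { unfold Rcpow; rewrite <- cexp_plus; f_equal; unfold w; rewrite !RtoC_plus; field. }
  replace (gamma_factor s * Rcpow (INR (S n)) (- s))%C with (cexp (- (s / 2) * RtoC w) * CGamma (s / 2))%C
    by (rewrite cexp_w; unfold gamma_factor; ring).
  apply (is_CInt_line_ext (fun v => cexp (- (s / 2) * RtoC w) * gamma_integrand (s / 2) (v + w))%C).
  - intros v; unfold gamma_integrand, theta_term; rewrite exp_plus, exp_w, Cmult_assoc, <- cexp_plus, Cmult_comm.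
    f_equal; [do 3 f_equal; ring | f_equal; rewrite RtoC_plus; ring].
  - apply is_CInt_line_Cmult, is_CInt_line_translate; [apply continuous_gamma_integrand |].
    apply is_CInt_line_gamma_integrand.
    rewrite Re_div_2; lra.
Qed.

Lemma alternating_sum_mellin (s : C) (n : nat) : 0 < Re s ->
  is_CInt_line (fun v => RtoC (sum_n (fun k => (-1) ^ k * theta_term (exp v) k) n)%R * cexp (s / 2 * RtoC v))%C
    (gamma_factor s * Csum_n (eta_term s) n)%C.
Proof.
  intros Re_pos; rewrite <- Csum_n_Cmult_l.
  apply (is_CInt_line_ext
    (fun v => Csum_n (fun k => RtoC ((-1) ^ k) * (RtoC (theta_term (exp v) k) * cexp (s / 2 * RtoC v)))%C n)).
  - intros v; rewrite <- Csum_n_RtoC, (Cmult_comm (Csum_n _ n)), <- Csum_n_Cmult_l.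
    apply Csum_n_ext; intros k; rewrite RtoC_mult; ring.
  - apply (is_CInt_line_sum_n
      (fun k v => RtoC ((-1) ^ k) * (RtoC (theta_term (exp v) k) * cexp (s / 2 * RtoC v)))%C); intros k.
    unfold eta_term; rewrite Cmult_assoc, (Cmult_comm (gamma_factor s)), <- Cmult_assoc.
    now apply is_CInt_line_Cmult, theta_term_mellin.
Qed.

Lemma alternating_mellin_remainder_le (s l : C) (n : nat) : 0 < Re s ->
  is_CInt_line (fun v => RtoC (alternating_theta (exp v)) * cexp (s / 2 * RtoC v))%C l ->
  Cmod (gamma_factor s * Csum_n (eta_term s) n - l) <=
  Cmod (gamma_factor (RtoC (Re s))) * exp (- (Re s * ln (INR (S (S n))))).
Proof.
  intros Re_pos int_l; set (r := RtoC (Re s)).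
  assert (dominating := is_RInt_line_Re _ _ (theta_term_mellin r (S n) Re_pos)).
  rewrite Cmod_minus_sym; eapply Rle_trans.
  - eapply is_CInt_line_Cmod_le;
      [| exact (is_CInt_line_minus _ _ _ _ int_l (alternating_sum_mellin s n Re_pos)) | exact dominating].
    intros v; cbv beta.
    rewrite <- Cmult_minus_distr_r, <- RtoC_minus, Cmod_mult, Cmod_R, Cmod_cexp_mult_RtoC, Re_div_2.
    replace (r / 2 * RtoC v)%C with (RtoC (Re s / 2 * v))
      by (unfold r; rewrite RtoC_mult, RtoC_div by lra; reflexivity).
    rewrite cexp_RtoC, <- RtoC_mult; simpl Re.
    apply Rmult_le_compat_r; [left; apply exp_pos | apply alternating_theta_remainder_le, exp_pos].
  - eapply Rle_trans; [apply Rle_abs | eapply Rle_trans; [apply re_le_Cmod |]].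
    rewrite Cmod_mult, Cmod_Rcpow; right; do 2 f_equal.
    change (Re (- r)) with (- Re s); ring.
Qed.

Lemma eta_mellin (s l : C) : 0 < Re s ->
  is_CInt_line (fun v => RtoC (alternating_theta (exp v)) * cexp (s / 2 * RtoC v))%C l ->
  (gamma_factor s * eta s)%C = l.
Proof.
  intros Re_pos int_l.
  apply (Climit_unique (F := eventually) (fun n => gamma_factor s * Csum_n (eta_term s) n)%C).
  - apply filterlim_Cmult; [apply filterlim_const | now apply is_series_eta].
  - apply filterlim_Cmod_0
      with (fun n => Cmod (gamma_factor (RtoC (Re s))) * exp (- (Re s * ln (INR (S (S n)))))).
    + apply filter_forall; intros n; now apply alternating_mellin_remainder_le.
    + apply is_lim_seq_exp_decay; [exact Re_pos |].
      apply (is_lim_seq_incr_1 (fun n => ln (INR (S n)))), is_lim_seq_ln_INR_S.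
Qed.

Lemma sqrt_exp (v : R) : sqrt (exp v) = exp (v / 2).
Proof.
  replace v with (v / 2 + v / 2) at 1 by field.
  rewrite exp_plus; apply sqrt_square; left; apply exp_pos.
Qed.

Definition theta_mellin (s : C) (v : R) : C := (RtoC (theta_reg (exp v)) * cexp (s / 2 * RtoC v))%C.

Lemma continuous_theta_mellin (s : C) (v : R) : Ccontinuous (theta_mellin s) v.
Proof.
  apply continuous_Cmult; [| apply continuous_cexp_mult_RtoC].
  apply continuous_RtoC, (continuous_comp exp theta_reg); [| apply continuous_theta_reg, exp_pos].
  apply (ex_derive_continuous (V := R_NormedModule)); auto_derive; auto.
Qed.

Lemma ex_theta_mellin (s : C) : 0 < Re s < 1 -> exists l, is_CInt_line (theta_mellin s) l.
Proof.
  intros Re_bounds; set (c := Rmin (Re s) (1 - Re s) / 2).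
  assert (c_le : c <= Re s / 2) by (unfold c; pose proof (Rmin_l (Re s) (1 - Re s)); lra).
  assert (c_le' : c <= (1 - Re s) / 2) by (unfold c; pose proof (Rmin_r (Re s) (1 - Re s)); lra).
  apply ex_CInt_line_exp_decay with 1 c; [| apply continuous_theta_mellin |].
  - assert (0 < Rmin (Re s) (1 - Re s)) by (apply Rmin_pos; lra); unfold c; lra.
  - intros v; unfold theta_mellin; rewrite Cmod_mult, Cmod_R, Cmod_cexp_mult_RtoC, Re_div_2.
    destruct (Rle_dec 0 v) as [v_nonneg | v_neg].
    + apply Rle_trans with (exp (- (v / 2)) * exp (Re s / 2 * v)).
      * apply Rmult_le_compat_r; [left; apply exp_pos |].
        rewrite exp_Ropp, <- sqrt_exp; apply Rabs_theta_reg_le_inv_sqrt.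
        rewrite <- exp_0; now apply exp_le.
      * rewrite <- exp_plus, Rmult_1_l, Rabs_pos_eq by trivial; apply exp_le; nra.
    + rewrite (Rabs_left v) by lra; apply Rmult_le_compat; [apply Rabs_pos | left; apply exp_pos | |].
      * apply Rabs_theta_reg_le_1; split; [apply exp_pos | rewrite <- exp_0; apply exp_le; lra].
      * apply exp_le; nra.
Qed.

Lemma theta_mellin_reflect (s : C) (v : R) : theta_mellin s (- v) = theta_mellin (1 - s) v.
Proof.
  unfold theta_mellin; rewrite exp_Ropp, theta_reg_inv, sqrt_exp, RtoC_mult, <- cexp_RtoC by apply exp_pos.
  rewrite (Cmult_comm (cexp _)), <- Cmult_assoc, <- cexp_plus; do 2 f_equal.
  rewrite RtoC_opp, RtoC_div by lra; field.
Qed.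

Lemma zeta_mellin (s l : C) : 0 < Re s < 1 -> is_CInt_line (theta_mellin s) l ->
  (gamma_factor s * zeta s)%C = l.
Proof.
  intros Re_bounds int_l; assert (den_neq_0 := zeta_denominator_neq_0 s ltac:(lra)).
  assert (scaling : (2 * cexp (- (s / 2) * RtoC (ln 4)))%C = Rcpow 2 (1 - s)).
  { unfold Rcpow; rewrite <- (exp_ln 2) at 1 by lra; rewrite <- cexp_RtoC, <- cexp_plus; f_equal.
    replace (ln 4) with (ln 2 + ln 2) by (rewrite <- ln_mult by lra; f_equal; ring).
    rewrite RtoC_plus; field. }
  assert (int_alternating : is_CInt_line
    (fun v => RtoC (alternating_theta (exp v)) * cexp (s / 2 * RtoC v))%C (l - Rcpow 2 (1 - s) * l)%C).
  { apply (is_CInt_line_ext (fun v => theta_mellin s v - Rcpow 2 (1 - s) * theta_mellin s (v + ln 4))%C).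
    - intros v; unfold theta_mellin; rewrite alternating_theta_reg by apply exp_pos.
      rewrite exp_plus, exp_ln, (Rmult_comm (exp v)), <- scaling, RtoC_plus, RtoC_minus, RtoC_mult by lra.
      replace (s / 2 * (RtoC v + RtoC (ln 4)))%C with (s / 2 * RtoC v + s / 2 * RtoC (ln 4))%C by ring.
      replace (- (s / 2) * RtoC (ln 4))%C with (- (s / 2 * RtoC (ln 4)))%C by ring.
      rewrite cexp_plus, cexp_opp; field; apply cexp_neq_0.
    - apply is_CInt_line_minus; [exact int_l |].
      apply is_CInt_line_Cmult, is_CInt_line_translate; [apply continuous_theta_mellin | exact int_l]. }
  apply eta_mellin in int_alternating; [| lra].
  unfold zeta.
  replace (gamma_factor s * (eta s / (1 - Rcpow 2 (1 - s))))%C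
    with (gamma_factor s * eta s / (1 - Rcpow 2 (1 - s)))%C by (field; trivial).
  rewrite int_alternating; field; trivial.
Qed.

Theorem zeta_functional_equation (s : C) : 0 < Re s < 1 ->
  (gamma_factor s * zeta s)%C = (gamma_factor (1 - s) * zeta (1 - s))%C.
Proof.
  intros Re_bounds; destruct (ex_theta_mellin s Re_bounds) as [l int_l].
  rewrite (zeta_mellin s l Re_bounds int_l); symmetry; apply zeta_mellin.
  - change (Re (1 - s)) with (1 - Re s); lra.
  - apply (is_CInt_line_ext (fun v => theta_mellin s (- v))); [intros v; apply theta_mellin_reflect |].
    apply is_CInt_line_opp; [apply continuous_theta_mellin | exact int_l].
Qed.

(** * The Riemann-Siegel theta function *)

Lemma strip_Im (z : C) : strip z -> - / 2 < Im z < / 2.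
Proof. intros z_in; now apply Rabs_lt_between. Qed.

Lemma strip_Cconj (z : C) : strip z -> strip (Cconj z).
Proof. unfold strip; now rewrite im_conj, Rabs_Ropp. Qed.

Lemma strip_opp (z : C) : strip z -> strip (- z).
Proof. unfold strip; change (Im (- z)) with (- Im z); now rewrite Rabs_Ropp. Qed.

(* The point [s = 1/2 + i z], so that [critical_arg (- z)] is [1 - s]. *)
Definition critical_arg (z : C) : C := (RtoC (/ 2) + Ci * z)%C.

Lemma Re_critical_arg (z : C) : Re (critical_arg z) = / 2 - Im z.
Proof. destruct z; simpl; ring. Qed.

Lemma critical_arg_opp (z : C) : critical_arg (- z) = (1 - critical_arg z)%C.
Proof. destruct z; apply injective_projections; simpl; field. Qed.

Lemma critical_arg_conj (z : C) : Cconj (critical_arg z) = critical_arg (- Cconj z).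
Proof. destruct z; apply injective_projections; simpl; field. Qed.

Lemma ex_Cderive_critical_arg (z : C) : ex_Cderive critical_arg z.
Proof. apply (ex_Cderive_affine (RtoC (/ 2)) Ci). Qed.

Lemma gamma_factor_conj (s : C) : 0 < Re s -> gamma_factor (Cconj s) = Cconj (gamma_factor s).
Proof.
  intros Re_pos; unfold gamma_factor.
  assert (half_conj : (Cconj s / 2)%C = Cconj (s / 2)) by (destruct s; apply injective_projections; simpl; field).
  rewrite half_conj, Cmult_conj, CGamma_conj by (rewrite Re_div_2; lra).
  now rewrite <- Copp_conj, Rcpow_conj.
Qed.

Lemma continuous_unit_sign_constant (f : R -> R) (a b : R) : a < b ->
  (forall x, a <= x <= b -> continuous f x) -> (forall x, a <= x <= b -> f x = 1 \/ f x = -1) ->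
  f a = 1 -> f b = 1.
Proof.
  intros a_lt_b f_cont f_values f_a; destruct (f_values b) as [f_b | f_b]; [lra | exact f_b |]; exfalso.
  destruct (Ranalysis5.IVT_interv (fun x => - f x) a b) as [x [x_in f_x]]; [| exact a_lt_b | lra | lra |].
  - intros x x_in; apply continuity_pt_filterlim, (continuous_opp (V := R_NormedModule)); now apply f_cont.
  - destruct (f_values x x_in); lra.
Qed.

Section RiemannSiegelTheta.

Variable th : C -> C.
Hypothesis th_RS : is_RS_theta th.

Definition exp_itheta (z : C) : C := cexp (Ci * th z).

Lemma ex_Cderive_exp_itheta (z : C) : strip z -> ex_Cderive exp_itheta z.
Proof.
  intros z_in; apply ex_Cderive_cexp, ex_Cderive_mult; [apply ex_derive_const |].
  now apply ex_Cderive_of_C_NormedModule, th_RS.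
Qed.

Lemma exp_itheta_square_CGamma (z : C) : strip z ->
  (exp_itheta z * exp_itheta z)%C =
  (Rcpow PI (- (Ci * z)) * (CGamma (critical_arg z / 2) / CGamma (critical_arg (- z) / 2)))%C.
Proof.
  intros z_in; destruct th_RS as (_ & _ & square); unfold exp_itheta; rewrite square by trivial.
  do 3 f_equal; unfold critical_arg; destruct z; apply injective_projections; simpl; field.
Qed.

(* The left-hand side of the equation defining theta is an exponential. *)
Lemma CGamma_critical_arg_neq_0 (z : C) : strip z -> CGamma (critical_arg z / 2) <> RtoC 0.
Proof.
  intros z_in Gamma_0; assert (square := exp_itheta_square_CGamma z z_in).
  rewrite Gamma_0 in square; unfold Cdiv in square; rewrite Cmult_0_l, Cmult_0_r in square.
  destruct (Cmult_integral _ _ square) as [eq | eq]; exact (cexp_neq_0 _ eq).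
Qed.

Lemma gamma_factor_critical_arg_neq_0 (z : C) : strip z -> gamma_factor (critical_arg z) <> RtoC 0.
Proof. intros z_in; apply Cmult_neq_0; [apply cexp_neq_0 | now apply CGamma_critical_arg_neq_0]. Qed.

Lemma exp_itheta_square (z : C) : strip z ->
  (exp_itheta z * exp_itheta z)%C = (gamma_factor (critical_arg z) / gamma_factor (critical_arg (- z)))%C.
Proof.
  intros z_in; rewrite exp_itheta_square_CGamma by trivial; unfold gamma_factor.
  assert (pow_eq : Rcpow PI (- (Ci * z)) =
    (Rcpow PI (- (critical_arg z / 2)) / Rcpow PI (- (critical_arg (- z) / 2)))%C).
  { unfold Rcpow; rewrite <- cexp_minus; f_equal; unfold critical_arg; field. }
  rewrite pow_eq; field; split; [apply CGamma_critical_arg_neq_0; now apply strip_opp | apply cexp_neq_0].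
Qed.

Lemma exp_itheta_square_zeta (z : C) : strip z ->
  (exp_itheta z * exp_itheta z * zeta (critical_arg z))%C = zeta (critical_arg (- z)).
Proof.
  intros z_in; assert (Im_z := strip_Im z z_in).
  assert (neq_0 := gamma_factor_critical_arg_neq_0 (- z) (strip_opp z z_in)).
  assert (functional := zeta_functional_equation (critical_arg z)).
  rewrite Re_critical_arg, <- critical_arg_opp in functional.
  rewrite exp_itheta_square by trivial.
  replace (zeta (critical_arg (- z)))
    with (gamma_factor (critical_arg (- z)) * zeta (critical_arg (- z)) / gamma_factor (critical_arg (- z)))%C
    by (field; trivial).
  rewrite <- functional by lra; field; trivial.
Qed.

Lemma gamma_factor_critical_arg_conj (z : C) : strip z ->
  Cconj (gamma_factor (critical_arg (Cconj z))) = gamma_factor (critical_arg (- z)).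
Proof.
  intros z_in; assert (Im_z := strip_Im z z_in).
  rewrite <- gamma_factor_conj, critical_arg_conj, Cconj_conj; [reflexivity |].
  rewrite Re_critical_arg, im_conj; lra.
Qed.

Lemma exp_itheta_conj_square (z : C) : strip z ->
  (exp_itheta z * Cconj (exp_itheta (Cconj z)) * (exp_itheta z * Cconj (exp_itheta (Cconj z))))%C = RtoC 1.
Proof.
  intros z_in; assert (opp_in := strip_opp z z_in).
  assert (neq_0 := gamma_factor_critical_arg_neq_0 z z_in).
  assert (opp_neq_0 := gamma_factor_critical_arg_neq_0 (- z) opp_in).
  assert (conj_square : Cconj (exp_itheta (Cconj z) * exp_itheta (Cconj z)) =
    (gamma_factor (critical_arg (- z)) / gamma_factor (critical_arg z))%C).
  { rewrite exp_itheta_square, Cdiv_conj, <- Copp_conj, !gamma_factor_critical_arg_conj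
      by (trivial; now apply gamma_factor_critical_arg_neq_0, strip_opp).
    replace (- - z)%C with z by ring; reflexivity. }
  replace (exp_itheta z * Cconj (exp_itheta (Cconj z)) * (exp_itheta z * Cconj (exp_itheta (Cconj z))))%C
    with (exp_itheta z * exp_itheta z * Cconj (exp_itheta (Cconj z) * exp_itheta (Cconj z)))%C
    by (rewrite Cmult_conj; ring).
  rewrite conj_square, exp_itheta_square by trivial; field; now split.
Qed.

Lemma continuous_exp_itheta_conj (z : C) : strip z ->
  Ccontinuous (fun w => exp_itheta w * Cconj (exp_itheta (Cconj w)))%C z.
Proof.
  intros z_in; apply filterlim_Cmult; [now apply ex_Cderive_continuous, ex_Cderive_exp_itheta |].
  apply filterlim_Cconj.
  apply (continuous_comp (V := C_UniformSpace) Cconj exp_itheta).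
  - apply filterlim_Cconj, filterlim_id.
  - now apply ex_Cderive_continuous, ex_Cderive_exp_itheta, strip_Cconj.
Qed.

Lemma exp_itheta_0 : exp_itheta (RtoC 0) = RtoC 1.
Proof. destruct th_RS as (_ & th_0 & _); unfold exp_itheta; rewrite th_0, Cmult_0_r; apply cexp_0. Qed.

(* The product is [1] or [-1] on the strip and [1] at [0], hence [1] along the segment from [0] to [z]. *)
Lemma exp_itheta_conj (z : C) : strip z -> (exp_itheta z * Cconj (exp_itheta (Cconj z)))%C = RtoC 1.
Proof.
  intros z_in; set (q := fun w => (exp_itheta w * Cconj (exp_itheta (Cconj w)))%C).
  assert (segment_in : forall u, 0 <= u <= 1 -> strip (RtoC u * z)).
  { intros u u_in; unfold strip in *; rewrite im_scal_l, Rabs_mult, Rabs_pos_eq by lra.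
    pose proof (Rabs_pos (Im z)); nra. }
  assert (Re_q : Re (q (RtoC 1 * z)%C) = 1).
  { apply (continuous_unit_sign_constant (fun u => Re (q (RtoC u * z)%C)) 0 1); [lra | | |].
    - intros u u_in; apply filterlim_Re.
      apply (continuous_comp (V := C_UniformSpace) (fun u => RtoC u * z)%C q).
      + apply filterlim_Cmult; [apply filterlim_RtoC, filterlim_id | apply filterlim_const].
      + now apply continuous_exp_itheta_conj, segment_in.
    - intros u u_in; destruct (Csquare_eq_1 (q (RtoC u * z)%C)) as [-> | ->];
        [now apply exp_itheta_conj_square, segment_in | now left | now right].
    - unfold q; rewrite Cmult_0_l, Cconj_RtoC, exp_itheta_0, Cconj_RtoC; simpl; ring. }
  rewrite Cmult_1_l in Re_q.
  destruct (Csquare_eq_1 (q z) (exp_itheta_conj_square z z_in)) as [eq | eq]; [exact eq |].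
  rewrite eq in Re_q; simpl in Re_q; lra.
Qed.

(* The holomorphic continuation of [Zfun th] to the strip. *)
Definition Hardy_Z (z : C) : C := (exp_itheta z * zeta (critical_arg z))%C.

Lemma Hardy_Z_conj (z : C) : strip z -> Cconj (Hardy_Z (Cconj z)) = Hardy_Z z.
Proof.
  intros z_in; assert (Im_z := strip_Im z z_in); unfold Hardy_Z.
  rewrite Cmult_conj, <- zeta_conj, critical_arg_conj, Cconj_conj
    by (rewrite Re_critical_arg, im_conj; lra).
  rewrite <- exp_itheta_square_zeta by trivial.
  replace (Cconj (exp_itheta (Cconj z)) * (exp_itheta z * exp_itheta z * zeta (critical_arg z)))%C
    with (exp_itheta z * Cconj (exp_itheta (Cconj z)) * (exp_itheta z * zeta (critical_arg z)))%C by ring.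
  rewrite exp_itheta_conj by trivial; ring.
Qed.

Lemma Cmod_critical_arg_le (z : C) : Cmod (critical_arg z) <= Cmod z + / 2.
Proof.
  eapply Rle_trans; [apply Cmod_triangle |].
  rewrite Cmod_mult, Cmod_Ci, Cmod_R, Rabs_pos_eq; lra.
Qed.

Lemma Cmod_zeta_critical_arg_le (z : C) (d : R) : 0 < d -> Rabs (Im z) <= / 2 - d ->
  Cmod (zeta (critical_arg z)) <= (Cmod z + / 2) / d / (exp (d * ln 2) - 1).
Proof.
  intros d_pos Im_le; apply Rabs_le_between in Im_le; pose proof (exp_mult_ln2_minus_1_pos d d_pos).
  eapply Rle_trans; [apply (Cmod_zeta_le _ d); rewrite Re_critical_arg; lra |].
  apply Rmult_le_compat_r; [left; now apply Rinv_0_lt_compat |].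
  apply Rmult_le_compat_r; [left; now apply Rinv_0_lt_compat | apply Cmod_critical_arg_le].
Qed.

(* [Z^2 = zeta(s) zeta(1 - s)] by the functional equation, so the growth of [Z] is
   controlled without any estimate for Gamma. *)
Lemma Cmod_Hardy_Z_le (z : C) (d : R) : 0 < d -> Rabs (Im z) <= / 2 - d ->
  Cmod (Hardy_Z z) <= (Cmod z + / 2) / d / (exp (d * ln 2) - 1).
Proof.
  intros d_pos Im_le; assert (z_in : strip z) by (unfold strip; lra).
  assert (zeta_le := Cmod_zeta_critical_arg_le z d d_pos Im_le).
  assert (zeta_opp_le := Cmod_zeta_critical_arg_le (- z) d d_pos).
  change (Im (- z)) with (- Im z) in zeta_opp_le; rewrite Rabs_Ropp, Cmod_opp in zeta_opp_le.
  specialize (zeta_opp_le Im_le); set (B := (Cmod z + / 2) / d / (exp (d * ln 2) - 1)) in *.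
  assert (square : (Hardy_Z z * Hardy_Z z)%C = (zeta (critical_arg (- z)) * zeta (critical_arg z))%C)
    by (rewrite <- exp_itheta_square_zeta by trivial; unfold Hardy_Z; ring).
  assert (square_le : Cmod (Hardy_Z z) * Cmod (Hardy_Z z) <= B * B).
  { rewrite <- Cmod_mult, square, Cmod_mult; apply Rmult_le_compat; trivial; apply Cmod_ge_0. }
  pose proof (Cmod_ge_0 (zeta (critical_arg z))).
  apply Rnot_lt_le; intros B_lt; nra.
Qed.

End RiemannSiegelTheta.

(** * The contour shift *)

Definition two_sinh_half_PI (x : C) : C := (RtoC 2 * csinh (RtoC PI * x / RtoC 2))%C.

Lemma two_sinh_half_PI_eq (x : C) : two_sinh_half_PI x = (cexp (RtoC PI / 2 * x) - cexp (- (RtoC PI / 2) * x))%C.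
Proof.
  unfold two_sinh_half_PI, csinh.
  replace (RtoC PI * x / RtoC 2)%C with (RtoC PI / 2 * x)%C by field.
  replace (- (RtoC PI / 2 * x))%C with (- (RtoC PI / 2) * x)%C by ring; field.
Qed.

Lemma two_sinh_half_PI_0 : two_sinh_half_PI (RtoC 0) = RtoC 0.
Proof. rewrite two_sinh_half_PI_eq, !Cmult_0_r; ring. Qed.

Lemma two_sinh_half_PI_opp (x : C) : two_sinh_half_PI (- x) = (- two_sinh_half_PI x)%C.
Proof.
  rewrite !two_sinh_half_PI_eq.
  replace (RtoC PI / 2 * - x)%C with (- (RtoC PI / 2) * x)%C by ring.
  replace (- (RtoC PI / 2) * - x)%C with (RtoC PI / 2 * x)%C by ring; ring.
Qed.

Lemma two_sinh_half_PI_conj (x : C) : two_sinh_half_PI (Cconj x) = Cconj (two_sinh_half_PI x).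
Proof.
  rewrite !two_sinh_half_PI_eq, Cminus_conj, <- !cexp_conj, !Cmult_conj, Copp_conj.
  replace (Cconj (RtoC PI / 2)) with (RtoC PI / 2)%C; [reflexivity |].
  rewrite <- RtoC_div by lra; symmetry; apply Cconj_RtoC.
Qed.

Lemma is_Cderive_two_sinh_half_PI (x : C) :
  is_Cderive two_sinh_half_PI x (RtoC PI / 2 * (cexp (RtoC PI / 2 * x) + cexp (- (RtoC PI / 2) * x)))%C.
Proof.
  apply (is_derive_ext (V := AbsRing_NormedModule C_AbsRing)
    (fun x => cexp (RtoC PI / 2 * x) - cexp (- (RtoC PI / 2) * x))%C); [intros w; symmetry; apply two_sinh_half_PI_eq |].
  replace (RtoC PI / 2 * (cexp (RtoC PI / 2 * x) + cexp (- (RtoC PI / 2) * x)))%C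
    with (RtoC PI / 2 * cexp (RtoC PI / 2 * x) - - (RtoC PI / 2) * cexp (- (RtoC PI / 2) * x))%C by ring.
  exact (is_derive_minus (V := AbsRing_NormedModule C_AbsRing) _ _ _ _ _
    (is_Cderive_cexp_linear _ x) (is_Cderive_cexp_linear _ x)).
Qed.

Lemma two_sinh_half_PI_neq_0 (x : C) : Rabs (Im x) <= 1 -> x <> RtoC 0 -> two_sinh_half_PI x <> RtoC 0.
Proof.
  intros Im_le x_neq_0 sinh_0; apply x_neq_0; assert (PI_pos := PI_RGT_0).
  assert (PI_neq_0 := RtoC_neq_0 PI PI_neq0).
  rewrite two_sinh_half_PI_eq in sinh_0.
  replace x with (RtoC PI * x / RtoC PI)%C by (field; exact PI_neq_0).
  rewrite (cexp_eq_1_small (RtoC PI * x)); [unfold Cdiv; ring | |].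
  - rewrite im_scal_l, Rabs_mult, (Rabs_pos_eq PI) by lra; nra.
  - replace (RtoC PI * x)%C with (RtoC PI / 2 * x - - (RtoC PI / 2) * x)%C by field.
    rewrite cexp_minus.
    replace (cexp (RtoC PI / 2 * x))
      with (cexp (RtoC PI / 2 * x) - cexp (- (RtoC PI / 2) * x) + cexp (- (RtoC PI / 2) * x))%C by ring.
    rewrite sinh_0; field; apply cexp_neq_0.
Qed.

Lemma Cmod_two_sinh_half_PI_ge (x : C) : 1 <= Rabs (Re x) -> exp (Rabs (Re x)) <= 2 * Cmod (two_sinh_half_PI x).
Proof.
  assert (right_half : forall x : C, 1 <= Re x -> exp (Re x) <= 2 * Cmod (two_sinh_half_PI x)).
  { clear x; intros x Re_ge_1; assert (PI_ge_2 := PI2_1); rewrite two_sinh_half_PI_eq.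
    pose proof (Cmod_minus_ge (cexp (RtoC PI / 2 * x)) (cexp (- (RtoC PI / 2) * x))) as ge.
    rewrite !Cmod_cexp in ge.
    replace (Re (RtoC PI / 2 * x)) with (PI / 2 * Re x) in ge by (destruct x; simpl; field).
    replace (Re (- (RtoC PI / 2) * x)) with (- (PI / 2 * Re x)) in ge by (destruct x; simpl; field).
    pose proof (exp_le (Re x) (PI / 2 * Re x) ltac:(nra)).
    pose proof (exp_ineq1_le (PI / 2 * Re x)).
    pose proof (exp_neg_lt_1 (PI / 2 * Re x) ltac:(nra)); nra. }
  destruct (Rle_dec 0 (Re x)) as [Re_pos | Re_neg].
  - rewrite Rabs_pos_eq by trivial; apply right_half.
  - rewrite Rabs_left by lra; intros Re_le.
    rewrite <- Cmod_opp, <- two_sinh_half_PI_opp; now apply (right_half (- x)%C).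
Qed.

Section ContourShift.

Variable th : C -> C.
Hypothesis th_RS : is_RS_theta th.
Variable t : R.

(* [e^(i theta(t))] times the integrand of [U]. *)
Definition contour_integrand (x : C) : C := (Hardy_Z th (RtoC t + x) * (RtoC PI / two_sinh_half_PI x))%C.

(* The factor of the integrand that carries the pole; the other factor is [eta], which is only
   available as a uniform limit of holomorphic functions. *)
Definition polar_factor (x : C) : C :=
  (exp_itheta th (RtoC t + x) / (1 - Rcpow 2 (1 - critical_arg (RtoC t + x))) * RtoC PI / two_sinh_half_PI x)%C.

Lemma contour_integrand_eq (x : C) :
  contour_integrand x = (eta (critical_arg (RtoC t + x)) * polar_factor x)%C.
Proof. unfold contour_integrand, polar_factor, Hardy_Z, zeta, Cdiv; ring. Qed.

Lemma Im_RtoC_plus (x : C) : Im (RtoC t + x) = Im x.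
Proof. destruct x; simpl; ring. Qed.

Lemma strip_RtoC_plus (x : C) : strip x -> strip (RtoC t + x).
Proof. unfold strip; now rewrite Im_RtoC_plus. Qed.

Lemma ex_Cderive_RtoC_plus (f : C -> C) (x : C) :
  ex_Cderive f (RtoC t + x)%C -> ex_Cderive (fun x => f (RtoC t + x)%C) x.
Proof.
  intros diff; apply (ex_Cderive_comp f (fun x => RtoC t + x)%C); [exact diff |].
  apply ex_Cderive_plus; [apply ex_derive_const | apply ex_derive_id].
Qed.

Lemma ex_Cderive_critical_arg_RtoC_plus (x : C) : ex_Cderive (fun x => critical_arg (RtoC t + x)) x.
Proof. apply (ex_Cderive_RtoC_plus critical_arg), ex_Cderive_critical_arg. Qed.

Lemma ex_Cderive_polar_numerator (x : C) : strip x ->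
  ex_Cderive (fun x => exp_itheta th (RtoC t + x) / (1 - Rcpow 2 (1 - critical_arg (RtoC t + x))) * RtoC PI)%C x.
Proof.
  intros x_in; apply ex_Cderive_mult; [| apply ex_derive_const].
  apply (ex_Cderive_RtoC_plus (fun z => exp_itheta th z / (1 - Rcpow 2 (1 - critical_arg z)))%C).
  apply ex_Cderive_div.
  - now apply ex_Cderive_exp_itheta, strip_RtoC_plus.
  - apply ex_Cderive_minus; [apply ex_derive_const |].
    apply ex_Cderive_Rcpow, ex_Cderive_minus; [apply ex_derive_const | apply ex_Cderive_critical_arg].
  - apply zeta_denominator_neq_0; rewrite Re_critical_arg, Im_RtoC_plus; apply strip_Im in x_in; lra.
Qed.

Lemma ex_Cderive_polar_factor (x : C) : strip x -> x <> RtoC 0 -> ex_Cderive polar_factor x.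
Proof.
  intros x_in x_neq_0; apply ex_Cderive_div;
    [now apply ex_Cderive_polar_numerator | eexists; apply is_Cderive_two_sinh_half_PI |].
  apply two_sinh_half_PI_neq_0; [unfold strip in x_in; lra | exact x_neq_0].
Qed.

Lemma is_simple_pole_polar_factor : is_simple_pole polar_factor (RtoC 0)
  (exp_itheta th (RtoC t) / (1 - Rcpow 2 (1 - critical_arg (RtoC t))))%C.
Proof.
  assert (PI_neq_0 := RtoC_neq_0 PI PI_neq0).
  assert (zero_in : strip (RtoC 0)) by (unfold strip; simpl; rewrite Rabs_R0; lra).
  assert (sinh_diff := is_Cderive_two_sinh_half_PI (RtoC 0)).
  rewrite !Cmult_0_r, cexp_0 in sinh_diff.
  replace (RtoC PI / 2 * (1 + 1))%C with (RtoC PI) in sinh_diff by field.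
  assert (pole := is_simple_pole_div _ two_sinh_half_PI (RtoC 0) (RtoC PI)
    (ex_Cderive_continuous _ _ (ex_Cderive_polar_numerator (RtoC 0) zero_in))
    sinh_diff two_sinh_half_PI_0 PI_neq_0).
  cbv beta in pole; rewrite Cplus_0_r in pole.
  replace (exp_itheta th (RtoC t) / (1 - Rcpow 2 (1 - critical_arg (RtoC t))))%C
    with (exp_itheta th (RtoC t) / (1 - Rcpow 2 (1 - critical_arg (RtoC t))) * RtoC PI / RtoC PI)%C; [exact pole |].
  field; split; [| exact PI_neq_0]; apply zeta_denominator_neq_0; rewrite Re_critical_arg; simpl; lra.
Qed.

Lemma continuous_eta_critical_arg (x : C) : strip x ->
  Ccontinuous (fun x => eta (critical_arg (RtoC t + x))) x.
Proof.
  intros x_in; apply (continuous_comp (V := C_UniformSpace) (fun x => critical_arg (RtoC t + x)) eta).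
  - exact (ex_Cderive_continuous _ _ (ex_Cderive_critical_arg_RtoC_plus x)).
  - apply continuous_eta; rewrite Re_critical_arg, Im_RtoC_plus; apply strip_Im in x_in; lra.
Qed.

Lemma continuous_contour_integrand (x : C) : strip x -> x <> RtoC 0 -> Ccontinuous contour_integrand x.
Proof.
  intros x_in x_neq_0.
  apply (continuous_ext (fun x => eta (critical_arg (RtoC t + x)) * polar_factor x)%C);
    [intros w; symmetry; apply contour_integrand_eq |].
  apply filterlim_Cmult; [now apply continuous_eta_critical_arg |].
  now apply ex_Cderive_continuous, ex_Cderive_polar_factor.
Qed.

Lemma contour_integrand_conj (x : C) : strip x -> x <> RtoC 0 ->
  Cconj (contour_integrand x) = contour_integrand (Cconj x).
Proof.
  intros x_in x_neq_0; unfold contour_integrand.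
  rewrite Cmult_conj, Cdiv_conj, Cconj_RtoC, two_sinh_half_PI_conj
    by (apply two_sinh_half_PI_neq_0; [unfold strip in x_in; lra | exact x_neq_0]).
  rewrite <- (Hardy_Z_conj th th_RS (RtoC t + Cconj x)) by now apply strip_RtoC_plus, strip_Cconj.
  now rewrite Cplus_conj, Cconj_conj, Cconj_RtoC.
Qed.

Variable sigma : R.
Hypothesis sigma_in : 0 < sigma < / 2.

Lemma in_rect_strip (a b : R) (x : C) : in_rect a b (- sigma) sigma x -> strip x.
Proof. intros [_ Im_x]; apply Rabs_lt_between; lra. Qed.

Lemma rect_int_contour_integrand (T : R) : 0 < T ->
  rect_int contour_integrand (- T) T (- sigma) sigma = (RtoC (2 * PI) * Ci * Hardy_Z th (RtoC t))%C.
Proof.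
  intros T_pos.
  replace (Hardy_Z th (RtoC t)) with (eta (critical_arg (RtoC t + RtoC 0)) *
    (exp_itheta th (RtoC t) / (1 - Rcpow 2 (1 - critical_arg (RtoC t)))))%C
    by (rewrite Cplus_0_r; unfold Hardy_Z, zeta, Cdiv; ring).
  rewrite (rect_int_ext _ _ _ _ _ _ contour_integrand_eq).
  apply (residue_theorem_uniform_limit (fun n x => eta_partial n (critical_arg (RtoC t + x)))
    (fun x => eta (critical_arg (RtoC t + x))) polar_factor (RtoC 0)).
  - simpl; lra.
  - simpl; lra.
  - apply is_simple_pole_polar_factor.
  - intros x x_in; apply ex_Cderive_polar_factor; now apply in_rect_strip in x_in.
  - intros n x _; apply (ex_Cderive_comp (eta_partial n) (fun x => critical_arg (RtoC t + x)));
      [apply ex_Cderive_eta_partial | apply ex_Cderive_critical_arg_RtoC_plus].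
  - intros x x_in; apply continuous_eta_critical_arg; now apply in_rect_strip in x_in.
  - intros eps eps_pos.
    generalize (eta_uniform_limit (fun s => / 2 - sigma <= Re s /\ Cmod s <= Rabs t + (T + sigma) + / 2)
      (/ 2 - sigma) (Rabs t + (T + sigma) + / 2) ltac:(lra) (fun s s_in => s_in) eps eps_pos).
    apply filter_imp; intros n close x [Re_x Im_x]; apply close.
    rewrite Re_critical_arg, Im_RtoC_plus; split; [lra |].
    eapply Rle_trans; [apply Cmod_critical_arg_le |]; apply Rplus_le_compat_r.
    eapply Rle_trans; [apply Cmod_triangle |]; rewrite Cmod_R; apply Rplus_le_compat_l.
    eapply Rle_trans; [apply Cmod_le_Rabs |]; apply Rplus_le_compat; apply Rabs_le; lra.
Qed.

Lemma contour_integrand_decay : exists K, 0 < K /\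
  forall x, 1 <= Rabs (Re x) -> Rabs (Im x) <= sigma ->
    Cmod (contour_integrand x) <= K * exp (- (/ 2 * Rabs (Re x))).
Proof.
  set (d := / 2 - sigma); assert (d_pos : 0 < d) by (unfold d; lra).
  assert (den_pos := exp_mult_ln2_minus_1_pos d d_pos); assert (PI_pos := PI_RGT_0); assert (t_nonneg := Rabs_pos t).
  set (B := / d / (exp (d * ln 2) - 1)).
  assert (B_pos : 0 < B) by (apply Rmult_lt_0_compat; apply Rinv_0_lt_compat; lra).
  exists (2 * (Rabs t + 1) * B * (PI * 2)); split.
  { apply Rmult_lt_0_compat; [apply Rmult_lt_0_compat; [lra | exact B_pos] | lra]. }
  intros x Re_ge_1 Im_le.
  assert (sinh_ge := Cmod_two_sinh_half_PI_ge x Re_ge_1); assert (exp_Re_pos := exp_pos (Rabs (Re x))).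
  assert (Z_le : Cmod (Hardy_Z th (RtoC t + x)) <= 2 * (Rabs t + 1) * exp (/ 2 * Rabs (Re x)) * B).
  { eapply Rle_trans; [apply (Cmod_Hardy_Z_le th th_RS _ d d_pos); rewrite Im_RtoC_plus; unfold d; lra |].
    unfold Rdiv at 1; unfold Rdiv at 1; rewrite Rmult_assoc; apply Rmult_le_compat_r; [now left |].
    pose proof (Cmod_triangle (RtoC t) x) as triangle; rewrite Cmod_R in triangle.
    pose proof (Cmod_le_Rabs x); pose proof (exp_ineq1_le (/ 2 * Rabs (Re x))); nra. }
  assert (kernel_le : Cmod (RtoC PI / two_sinh_half_PI x) <= PI * 2 * exp (- Rabs (Re x))).
  { rewrite Cmod_div, Cmod_R, (Rabs_pos_eq PI) by (try lra; apply Cmod_gt_0; lra).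
    rewrite exp_Ropp, Rmult_assoc; apply Rmult_le_compat_l; [lra |].
    replace (2 * / exp (Rabs (Re x))) with (/ (exp (Rabs (Re x)) / 2)) by (field; lra).
    apply Rinv_le_contravar; lra. }
  unfold contour_integrand; rewrite Cmod_mult.
  replace (exp (- (/ 2 * Rabs (Re x)))) with (exp (/ 2 * Rabs (Re x)) * exp (- Rabs (Re x)))
    by (rewrite <- exp_plus; f_equal; field).
  replace (2 * (Rabs t + 1) * B * (PI * 2) * (exp (/ 2 * Rabs (Re x)) * exp (- Rabs (Re x))))
    with (2 * (Rabs t + 1) * exp (/ 2 * Rabs (Re x)) * B * (PI * 2 * exp (- Rabs (Re x)))) by ring.
  apply Rmult_le_compat; trivial; apply Cmod_ge_0.
Qed.

Lemma ex_contour_integral (y : R) : Rabs y = sigma ->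
  exists l, is_CInt_line (fun u => contour_integrand (u, y)) l.
Proof.
  intros y_eq; destruct contour_integrand_decay as [K [K_pos decay]].
  assert (line_cont : forall u, Ccontinuous (fun u => contour_integrand (u, y)) u).
  { intros u; apply continuous_horizontal, continuous_contour_integrand; [unfold strip; simpl; lra |].
    intros eq; apply (f_equal Im) in eq; simpl in eq; rewrite eq, Rabs_R0 in y_eq; lra. }
  destruct (continuous_bounded (fun u => contour_integrand (u, y)) (-1) 1) as [M bound]; [auto |].
  assert (M_nonneg : 0 <= M) by (eapply Rle_trans; [apply Cmod_ge_0 | apply (bound 0); lra]).
  apply ex_CInt_line_exp_decay with (K + M * exp (/ 2)) (/ 2); [lra | exact line_cont |].
  intros u; pose proof (exp_pos (- (/ 2 * Rabs u))); pose proof (exp_pos (/ 2)).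
  destruct (Rle_dec 1 (Rabs u)) as [u_large | u_small].
  - eapply Rle_trans; [apply (decay (u, y)); simpl; lra | simpl; apply Rmult_le_compat_r; nra].
  - eapply Rle_trans; [apply bound, Rabs_le_between; lra |].
    assert (1 <= exp (/ 2) * exp (- (/ 2 * Rabs u))) by (rewrite <- exp_plus, <- exp_0; apply exp_le; lra).
    rewrite Rmult_plus_distr_r, Rmult_assoc; nra.
Qed.

Lemma contour_integral_minus_conj (A : C) : is_CInt_line (fun u => contour_integrand (u, - sigma)) A ->
  (A - Cconj A)%C = (RtoC (2 * PI) * Ci * Hardy_Z th (RtoC t))%C.
Proof.
  intros int_A; destruct contour_integrand_decay as [K [K_pos decay]].
  assert (int_conj : is_CInt_line (fun u => contour_integrand (u, sigma)) (Cconj A)).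
  { apply (is_CInt_line_ext (fun u => Cconj (contour_integrand (u, - sigma)))); [| now apply is_CInt_line_Cconj].
    intros u; rewrite contour_integrand_conj; [f_equal; apply injective_projections; simpl; ring | |].
    - unfold strip; simpl; rewrite Rabs_Ropp, Rabs_pos_eq; lra.
    - intros eq; apply (f_equal Im) in eq; simpl in eq; lra. }
  apply (Climit_unique (F := eventually)
    (fun n => rect_int contour_integrand (- (INR n + 1)) (INR n + 1) (- sigma) sigma)).
  - apply (rect_int_line_limit contour_integrand _ _ _ _ (fun n => INR n + 1)
      (fun n => K * exp (- (/ 2 * (INR n + 1))))); trivial; [lra | apply is_lim_seq_INR_plus | |].
    + apply is_lim_seq_exp_decay; [lra | apply is_lim_seq_INR_plus].
    + intros n u y u_eq y_in; assert (n_nonneg := pos_INR n); rewrite (Rabs_pos_eq (INR n + 1)) in u_eq by lra.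
      split; [apply continuous_contour_integrand |].
      * apply (in_rect_strip u u); split; simpl; lra.
      * intros eq; apply (f_equal Re) in eq; simpl in eq; rewrite eq, Rabs_R0 in u_eq; lra.
      * rewrite <- u_eq; apply (decay (u, y)); simpl; [lra | apply Rabs_le; lra].
  - apply (filterlim_ext (fun _ => RtoC (2 * PI) * Ci * Hardy_Z th (RtoC t))%C); [| apply filterlim_const].
    intros n; symmetry; apply rect_int_contour_integrand; pose proof (pos_INR n); lra.
Qed.

Lemma exp_itheta_mult_U (A : C) : is_CInt_line (fun u => contour_integrand (u, - sigma)) A ->
  (exp_itheta th (RtoC t) * U th sigma t)%C = (A / (RtoC (2 * PI) * Ci))%C.
Proof.
  intros int_A; unfold U.
  rewrite (is_RInt_gen_unique (V := C_R_CompleteNormedModule) _ (/ exp_itheta th (RtoC t) * A)%C).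
  - field; repeat split; [apply Ci_nz | apply two_PI_neq_0 | apply cexp_neq_0].
  - apply (is_CInt_line_ext (fun u => / exp_itheta th (RtoC t) * contour_integrand (u, (- sigma)%R))%C);
      [| now apply is_CInt_line_Cmult].
    intros u; cbv zeta; rewrite cexp_minus.
    unfold contour_integrand, Hardy_Z, exp_itheta, critical_arg, two_sinh_half_PI, Cdiv; ring.
Qed.

End ContourShift.

Theorem mainTheorem1 :
  forall (th : C -> C), is_RS_theta th ->
  forall (sigma : R), 0 < sigma < / 2 ->
  forall t : R,
    Zfun th t = RtoC (2 * Re (cexp (Ci * th (RtoC t)) * U th sigma t)%C).
Proof.
  intros th th_RS sigma sigma_in t.
  destruct (ex_contour_integral th th_RS t sigma sigma_in (- sigma)) as [A int_A].
  { rewrite Rabs_Ropp; apply Rabs_pos_eq; lra. }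
  change (Hardy_Z th (RtoC t) = RtoC (2 * Re (exp_itheta th (RtoC t) * U th sigma t)%C)).
  rewrite (exp_itheta_mult_U th t sigma A int_A).
  replace (Hardy_Z th (RtoC t)) with ((A - Cconj A) / (RtoC (2 * PI) * Ci))%C.
  - destruct A as [a b]; apply injective_projections; simpl; field; pose proof PI_RGT_0; lra.
  - rewrite (contour_integral_minus_conj th th_RS t sigma sigma_in A int_A).
    field; split; [apply Ci_nz | apply two_PI_neq_0].
Qed.
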